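(* Let $\mathcal C$ be a class of finite graphs of bounded degree. The model-checking problem for order-invariant $\mathsf{CFO}$ on $\mathcal C$ — given $\mathcal A\in\mathcal C$ and an order-invariant $\mathsf{CFO}$ sentence $\varphi$, decide whether $\mathcal A\models\varphi$ — is fixed-parameter tractable with parameter $|\varphi|$, i.e. solvable in time $f(|\varphi|)\cdot|A|^{c}$ for some computable function $f$ and constant $c$.
   Context: Graphs are loopless undirected coloured simple graphs, viewed as structures over $\sigma=\{E,P_1,\dots,P_N\}$ ($E$ binary symmetric loopless, $P_\ell$ unary colours); an ordered graph additionally interprets a binary symbol $<$ as a linear order on vertices. Cluster first-order logic ($\mathsf{CFO}$): fix an infinite alphabet $\Sigma$; variables $x_w^i$ ($w\in\Sigma^*$, $i\in\mathbb N$). For finite $S\subseteq\Sigma^*\times\mathbb N$, $X_S=\{x_w^i:(w,i)\in S\}$; $S$ is valid if $(w,i)\in S\Rightarrow(w,j)\in S$ for $j<i$ and $(w\alpha,0)\in S\Rightarrow(w,0)\in S$. $\mathsf{CFO}_S[0]$: Boolean combinations of $P_\ell(x_w^i)$, $E(x_w^i,x_w^j)$, $x_w^i\sim x_w^j$, $x_{w\alpha}^0\sim x_w^i$ (variables in $X_S$, $\sim\in\{=,<,>\}$). $\mathsf{CFO}_S[k+1]$: Boolean combinations of $\mathsf{CFO}_S[0]$ formulas and of $\exists x_\epsilon^0\psi$ ($S=\emptyset$, $\psi\in\mathsf{CFO}_{\{(\epsilon,0)\}}[k]$), $\exists x^0_{w\alpha}\psi$ ($(w,0)\in S$, $(w\alpha,0)\notin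 S$, $\psi\in\mathsf{CFO}_{S\cup\{(w\alpha,0)\}}[k]$), $\exists x_w^i(E(x_w^i,x_w^j)\wedge\psi)$ ($(w,j)\in S$, $i$ least with $(w,i)\notin S$, $\psi\in\mathsf{CFO}_{S\cup\{(w,i)\}}[k]$). $\mathsf{CFO}=\bigcup_k\mathsf{CFO}_\emptyset[k]$ with usual first-order semantics. A $\mathsf{CFO}$ sentence $\varphi$ is order-invariant if for every finite graph $\mathcal A$ and all linear orders $<_1,<_2$ on $A$, $(\mathcal A,<_1)\models\varphi\iff(\mathcal A,<_2)\models\varphi$; then one writes $\mathcal A\models\varphi$. *)

(* Defs.v *)
From mathcomp Require Import all_boot finmap.

Set Implicit Arguments.
Unset Strict Implicit.
Unset Printing Implicit Defensive.

(** * Finite coloured graphs *)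

(* The vertex set is nonempty, as is the convention for first-order structures;
   with an empty one a time bound f(|phi|) * |A|^c with c > 0 would be 0. *)
Record cgraph (N : nat) := CGraph {
  vert :> finType;
  adj : rel vert;
  col : 'I_N -> pred vert;
  adj_sym : symmetric adj;
  adj_irr : irreflexive adj;
  vert_gt0 : 0 < #|vert|
}.

Definition bounded_degree N (C : cgraph N -> Prop) : Prop :=
  exists d : nat, forall A : cgraph N, C A -> forall x : A, #|adj x| <= d.

(* Strict linear orders. *)
Definition linear_order (V : finType) (lt : rel V) : Prop :=
  [/\ irreflexive lt, transitive lt & forall x y, x != y -> lt x y || lt y x].

(** * First-order formulas over ordered coloured graphs *)

(* (w, i) stands for x_w^i; the infinite alphabet is nat. *)
Definition var : Type := (seq nat * nat)%type.

Inductive cmp := CEq | CLt | CGt.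

Inductive formula (N : nat) :=
| FTrue
| FCol of 'I_N & var
| FAdj of var & var
| FCmp of cmp & var & var
| FNot of formula N
| FAnd of formula N & formula N
| FOr of formula N & formula N
| FEx of var & formula N.
Arguments FTrue {N}.
Arguments FAdj {N} x y.
Arguments FCmp {N} c x y.

Definition eval_cmp (V : finType) (lt : rel V) (c : cmp) (a b : V) : bool :=
  match c with CEq => a == b | CLt => lt a b | CGt => lt b a end.

Fixpoint sat N (A : cgraph N) (lt : rel A) (v : var -> A) (phi : formula N)
    : bool :=
  match phi with
  | FTrue => true
  | FCol l x => col l (v x)
  | FAdj x y => adj (v x) (v y)
  | FCmp c x y => eval_cmp lt c (v x) (v y)
  | FNot p => ~~ sat lt v p
  | FAnd p q => sat lt v p && sat lt v q
  | FOr p q => sat lt v p || sat lt v q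
  | FEx x p => [exists a : A, sat lt (fun y => if y == x then a else v y) p]
  end.

(* For sentences the assignment is irrelevant. *)
Definition models N (A : cgraph N) (lt : rel A) (phi : formula N) : Prop :=
  forall v : var -> A, sat lt v phi.

(** * Cluster first-order logic *)

Definition valid (S : {fset var}) : Prop :=
  (forall w i j, (w, i) \in S -> j < i -> (w, j) \in S) /\
  (forall w a, (rcons w a, 0) \in S -> (w, 0) \in S).

Inductive CFO_atom N (S : {fset var}) : formula N -> Prop :=
| CFO_col l x : x \in S -> CFO_atom S (FCol l x)
| CFO_adj w i j : (w, i) \in S -> (w, j) \in S ->
    CFO_atom S (FAdj (w, i) (w, j))
| CFO_cmp c w i j : (w, i) \in S -> (w, j) \in S ->
    CFO_atom S (FCmp c (w, i) (w, j))
| CFO_cmp_child c w a i : (rcons w a, 0) \in S -> (w, i) \in S ->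
    CFO_atom S (FCmp c (rcons w a, 0) (w, i)).

(* [CFO k S phi]: phi belongs to CFO_S[k].  Validity of S need not be required:
   it holds for fset0 and is preserved by each quantifier, see below. *)
Inductive CFO N : nat -> {fset var} -> formula N -> Prop :=
| CFO_at k S p : CFO_atom S p -> CFO k S p
| CFO_true k S : CFO k S FTrue
| CFO_not k S p : CFO k S p -> CFO k S (FNot p)
| CFO_and k S p q : CFO k S p -> CFO k S q -> CFO k S (FAnd p q)
| CFO_or k S p q : CFO k S p -> CFO k S q -> CFO k S (FOr p q)
| CFO_root k p : CFO k [fset ([::], 0)]%fset p ->
    CFO k.+1 fset0 (FEx ([::], 0) p)
| CFO_child k S w a p : (w, 0) \in S -> (rcons w a, 0) \notin S ->
    CFO k ((rcons w a, 0) |` S)%fset p ->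
    CFO k.+1 S (FEx (rcons w a, 0) p)
| CFO_nbr k S w i j p : (w, j) \in S ->
    (w, i) \notin S -> (forall i', i' < i -> (w, i') \in S) ->
    CFO k ((w, i) |` S)%fset p ->
    CFO k.+1 S (FEx (w, i) (FAnd (FAdj (w, i) (w, j)) p)).

Lemma valid0 : valid fset0.
Proof. by split=> [w i j|w a]; rewrite in_fset0. Qed.

Lemma valid_root : valid [fset ([::], 0)]%fset.
Proof.
split=> [w i j|w a]; rewrite !in_fset1 !xpair_eqE => /andP[].
  by move=> _ /eqP->.
by case: w.
Qed.

Lemma valid_child S w a :
  valid S -> (w, 0) \in S -> valid ((rcons w a, 0) |` S)%fset.
Proof.
move=> [S1 S2] Sw; split=> [u i j|u b]; rewrite !in_fset1U => /orP[].
- by rewrite xpair_eqE => /andP[_ /eqP->].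
- by move=> Su ji; rewrite (S1 _ _ _ Su ji) orbT.
- by rewrite xpair_eqE eqseq_rcons => /andP[/andP[/eqP-> _] _]; rewrite Sw orbT.
- by move=> /S2 ->; rewrite orbT.
Qed.

Lemma valid_nbr S w i j :
  valid S -> (w, j) \in S -> (forall i', i' < i -> (w, i') \in S) ->
  valid ((w, i) |` S)%fset.
Proof.
move=> [S1 S2] Sw Si; have Sw0 : (w, 0) \in S.
  by case: j Sw => // j Sw; apply: S1 Sw _.
split=> [u k l|u b]; rewrite !in_fset1U => /orP[].
- by rewrite xpair_eqE => /andP[/eqP-> /eqP->] /Si ->; rewrite orbT.
- by move=> Su lk; rewrite (S1 _ _ _ Su lk) orbT.
- rewrite xpair_eqE => /andP[/eqP uw _]; rewrite -uw in Sw0.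
  by rewrite (S2 _ _ Sw0) orbT.
- by move=> /S2 ->; rewrite orbT.
Qed.

Definition CFO_sentence N (phi : formula N) : Prop := exists k, CFO k fset0 phi.

Definition order_invariant N (phi : formula N) : Prop :=
  forall (A : cgraph N) (lt1 lt2 : rel A),
    linear_order lt1 -> linear_order lt2 -> models lt1 phi <-> models lt2 phi.

(* A |= phi for order-invariant phi: any choice of the order will do. *)
Definition inv_models N (A : cgraph N) (phi : formula N) : Prop :=
  forall lt : rel A, linear_order lt -> models lt phi.

(** * Random access machines *)

(* Uniform-cost RAMs with addition and truncated subtraction but no
   multiplication, so that running times are polynomially related to those of
   Turing machines.  [r], [s], [t] are register numbers. *)
Inductive instr :=
| IConst (r k : nat)   (* R[r] := k *)
| IAdd (r s t : nat)   (* R[r] := R[s] + R[t] *)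
| ISub (r s t : nat)   (* R[r] := R[s] - R[t] *)
| ILoad (r s : nat)    (* R[r] := R[R[s]] *)
| IStore (r s : nat)   (* R[R[r]] := R[s] *)
| IJmp (l : nat)       (* goto l *)
| IJz (r l : nat).     (* if R[r] = 0 then goto l *)

Definition program := seq instr.

Record config := Config { pc : nat; reg : nat -> nat }.

Definition upd (m : nat -> nat) (r k : nat) : nat -> nat :=
  fun s => if s == r then k else m s.

Definition exec (i : instr) (c : config) : config :=
  let: Config p m := c in
  match i with
  | IConst r k => Config p.+1 (upd m r k)
  | IAdd r s t => Config p.+1 (upd m r (m s + m t))
  | ISub r s t => Config p.+1 (upd m r (m s - m t))
  | ILoad r s => Config p.+1 (upd m r (m (m s)))
  | IStore r s => Config p.+1 (upd m (m r) (m s))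
  | IJmp l => Config l m
  | IJz r l => Config (if m r == 0 then l else p.+1) m
  end.

(* The machine has halted when the program counter is outside the program. *)
Definition step (P : program) (c : config) : config :=
  if onth P (pc c) is Some i then exec i c else c.

(* The input word w is given by R[0] = |w| and R[i + 1] = w_i. *)
Definition init (w : seq bool) : config :=
  Config 0 (fun r => if r is i.+1 then nat_of_bool (nth false w i) else size w).

(* On input w, P halts after at most t steps with result k in R[0]. *)
Definition outputs (P : program) (w : seq bool) (t k : nat) : Prop :=
  exists2 n, n <= t &
    let c := iter n (step P) (init w) in size P <= pc c /\ reg c 0 = k.

Definition computable (f : nat -> nat) : Prop :=
  exists P : program, forall n, exists t, outputs P (nseq n true) t (f n).

(** * Encodings as binary words *)

(* A sequence of numbers k is written as the concatenation of the 1^k 0. *)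
Definition unary (s : seq nat) : seq bool :=
  flatten [seq rcons (nseq k true) false | k <- s].

Definition code_var (x : var) : seq nat := size x.1 :: rcons x.1 x.2.

Definition code_cmp (c : cmp) : nat :=
  match c with CEq => 0 | CLt => 1 | CGt => 2 end.

(* Polish notation. *)
Fixpoint code_formula N (phi : formula N) : seq nat :=
  match phi with
  | FTrue => [:: 0]
  | FCol l x => [:: 1, nat_of_ord l & code_var x]
  | FAdj x y => 2 :: code_var x ++ code_var y
  | FCmp c x y => [:: 3, code_cmp c & code_var x ++ code_var y]
  | FNot p => 4 :: code_formula p
  | FAnd p q => 5 :: code_formula p ++ code_formula q
  | FOr p q => 6 :: code_formula p ++ code_formula q
  | FEx x p => 7 :: code_var x ++ code_formula p
  end.

Definition enc_formula N (phi : formula N) : seq bool :=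
  unary (code_formula phi).

(* |phi|.  The letters occurring in the variables are part of the input, so
   their length is counted too. *)
Definition fsize N (phi : formula N) : nat := size (enc_formula phi).

(* The encoding of A depends on an enumeration s of its vertices: the number of
   vertices, the adjacency matrix row by row, and the colours of each vertex. *)
Definition enc_graph N (A : cgraph N) (s : seq A) : seq bool :=
  unary [:: size s] ++
  [seq adj x y | x <- s, y <- s] ++
  [seq col l x | x <- s, l <- enum 'I_N].

Definition enumeration (V : finType) (s : seq V) : Prop := perm_eq s (enum V).

(* Main.v *)
Require Import Defs.
From mathcomp Require Import all_boot finmap.
From mathcomp Require Import zify.

(* For any order on a graph of degree at most [D], the truth of a CFO formula
   depends on the clusters chosen so far only through the types of their roots:
   the [k]-type of a vertex records its ordered ball together with, for every
   other vertex, its place relative to that ball and its [(k-1)]-type.  Hence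
   the root of a new cluster may be restricted to one representative for each
   place and type, all quantifiers range over a set of vertices whose size is
   bounded in terms of [D] and the formula, and brute force on that set takes
   time [f(|phi|)] up to a polynomial factor.  Order invariance allows the order
   of the input enumeration to be used.  The algorithm is written in a small
   loop language with a cost semantics, which is compiled to RAMs. *)

Set Implicit Arguments.
Unset Strict Implicit.
Unset Printing Implicit Defensive.

(** * A loop language over arrays and its compilation to RAMs *)

(** Why types suffice: an atom relates variables of one cluster, or the root of a child cluster to a
    member of its parent. So apart from the ordered ball of each root only the [cut] of a child root
    by the ball of its parent root is visible, and a back-and-forth along the tree of clusters can
    match these data. Balls are indexed by walks rather than vertices: all of them then share the
    index set below [W], and a neighbour in one ball is answered by the walk of the same number in
    another. The formula is part of the input, so one program must serve all ranks. The length [F]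
    of its encoding serves as bound on rank, radius, nesting depth and number of variables at once.
    Types are of tower size and never computed; only their equality on pairs of vertices is, level
    by level. Their number enters through the count [M] of marked vertices, hence only through [f].
    For the running time, every loop of the checker is bounded by a stored number, so the time is a
    fixed power of the largest one, which is at most [sizebound N D F] times the square of the
    number of vertices. *)

(* Local variables are de Bruijn indices.  [Sum eb e] binds the loop counter,
   [Rec eb e0 e1] binds the counter (index 0) and the accumulator (index 1). *)
Inductive expr :=
| Loc of nat
| Cst of nat
| Rd of nat & expr
| Add of expr & expr
| Sub of expr & expr
| Ite of expr & expr & expr
| Let of expr & expr
| Sum of expr & expr
| Rec of expr & expr & expr.

Definition mem := nat -> nat -> nat.

Fixpoint eval (m : mem) (env : seq nat) (e : expr) : nat :=
  match e with
  | Loc k => nth 0 env k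
  | Cst c => c
  | Rd a e1 => m a (eval m env e1)
  | Add e1 e2 => eval m env e1 + eval m env e2
  | Sub e1 e2 => eval m env e1 - eval m env e2
  | Ite e0 e1 e2 => if eval m env e0 == 0 then eval m env e2 else eval m env e1
  | Let e1 e2 => eval m (eval m env e1 :: env) e2
  | Sum eb e1 =>
      iteri (eval m env eb) (fun i acc => acc + eval m (i :: env) e1) 0
  | Rec eb e0 e1 =>
      iteri (eval m env eb) (fun i acc => eval m [:: i, acc & env] e1)
        (eval m env e0)
  end.

Definition write (m : mem) a i x : mem :=
  fun b j => if (b == a) && (j == i) then x else m b j.

(* Entry i may read the entries of the same array below i. *)
Definition fill (m : mem) (a B : nat) (e : expr) : mem :=
  iteri B (fun i m' => write m' a i (eval m' [:: i] e)) m.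

(* The commands of a program successively fill the arrays k, k + 1, ... *)
Definition cmd := (expr * expr)%type.

Fixpoint run (m : mem) (k : nat) (cs : seq cmd) : mem :=
  if cs is c :: cs' then
    run (fill m k (eval m [::] c.1) c.2) k.+1 cs'
  else m.

Section Compiler.

Variables Z0 KA : nat.

(** The arrays are interleaved above register [Z0], so each can be arbitrarily long. As [KA] is a
    constant of the program, [set_addr] obtains the product by [KA] additions. *)
Definition address a i := Z0 + KA * i + a.

Definition set_addr r a s := IConst r (Z0 + a) :: nseq KA (IAdd r r s).

Fixpoint cost (m : mem) (env : seq nat) (e : expr) : nat :=
  match e with
  | Loc k => 2
  | Cst c => 1
  | Rd a e1 => cost m env e1 + KA.+2
  | Add e1 e2 | Sub e1 e2 => cost m env e1 + cost m env e2 + 1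
  | Ite e0 e1 e2 => cost m env e0 + cost m env e1 + cost m env e2 + 2
  | Let e1 e2 => cost m env e1 + cost m (eval m env e1 :: env) e2 + 2
  | Sum eb e1 => cost m env eb + 3 +
      \sum_(i < eval m env eb) (cost m (val i :: env) e1 + 8)
  | Rec eb e0 e1 => cost m env e0 + cost m env eb + 3 +
      \sum_(i < eval m env eb)
        (cost m [:: val i, iteri i (fun i acc => eval m [:: i, acc & env] e1)
                         (eval m env e0) & env] e1 + 8)
  end.

(* Code for e placed at address p; the result goes to register s, and the
   registers from s on are used as scratch space.  [loc] lists the registers
   of the local variables. *)
Fixpoint comp (loc : seq nat) (s p : nat) (e : expr) : seq instr :=
  match e with
  | Loc k => if k < size loc then [:: IConst s 0; IAdd s s (nth 0 loc k)]
             else [:: IConst s 0]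
  | Cst c => [:: IConst s c]
  | Rd a e1 => comp loc s p e1 ++ set_addr s.+1 a s ++ [:: ILoad s s.+1]
  | Add e1 e2 => let c1 := comp loc s p e1 in
      c1 ++ comp loc s.+1 (p + size c1) e2 ++ [:: IAdd s s s.+1]
  | Sub e1 e2 => let c1 := comp loc s p e1 in
      c1 ++ comp loc s.+1 (p + size c1) e2 ++ [:: ISub s s s.+1]
  | Ite e0 e1 e2 =>
      let c0 := comp loc s p e0 in
      let p1 := (p + size c0).+1 in
      let c1 := comp loc s p1 e1 in
      let p2 := (p1 + size c1).+1 in
      let c2 := comp loc s p2 e2 in
      c0 ++ IJz s p2 :: c1 ++ IJmp (p2 + size c2) :: c2
  | Let e1 e2 => let c1 := comp loc s p e1 in
      c1 ++ comp (s :: loc) s.+1 (p + size c1) e2 ++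
      [:: IConst s 0; IAdd s s s.+1]
  | Sum eb e1 =>
      let cb := comp loc s.+2 p eb in
      let h := (p + size cb).+2 in
      let c1 := comp (s.+1 :: loc) s.+3 h.+1 e1 in
      cb ++ [:: IConst s 0, IConst s.+1 0, IJz s.+2 (h.+1 + size c1 + 5) &
      c1 ++ [:: IAdd s s s.+3; IConst s.+3 1; IAdd s.+1 s.+1 s.+3;
                ISub s.+2 s.+2 s.+3; IJmp h]]
  | Rec eb e0 e1 =>
      let c0 := comp loc s p e0 in
      let p1 := p + size c0 in
      let cb := comp loc s.+2 p1 eb in
      let h := (p1 + size cb).+1 in
      let c1 := comp [:: s.+1, s & loc] s.+3 h.+1 e1 in
      c0 ++ cb ++ [:: IConst s.+1 0, IJz s.+2 (h.+1 + size c1 + 6) &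
      c1 ++ [:: IConst s 0; IAdd s s s.+3; IConst s.+3 1;
                IAdd s.+1 s.+1 s.+3; ISub s.+2 s.+2 s.+3; IJmp h]]
  end.

Fixpoint need (e : expr) : nat :=
  match e with
  | Loc _ | Cst _ => 1
  | Rd _ e1 => (need e1).+2
  | Add e1 e2 | Sub e1 e2 | Let e1 e2 => (need e1 + need e2).+1
  | Ite e0 e1 e2 => need e0 + need e1 + need e2
  | Sum eb e1 => need eb + need e1 + 4
  | Rec eb e0 e1 => need eb + need e0 + need e1 + 4
  end.

(** * Correctness and running time of compiled expressions *)

Definition at_code (P : program) p (c : seq instr) :=
  forall i, i < size c -> onth P (p + i) = onth c i.

Lemma at_code_cat P p c1 c2 :
  at_code P p (c1 ++ c2) -> at_code P p c1 /\ at_code P (p + size c1) c2.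
Proof.
move=> H; split=> i Hi.
  rewrite H ?size_cat ?ltn_addr //.
  by rewrite !onthE map_cat nth_cat size_map Hi.
rewrite -addnA H ?size_cat ?ltn_add2l //.
rewrite !onthE map_cat nth_cat size_map ltnNge leq_addr /=.
by rewrite addKn.
Qed.

Lemma at_code_cons P p i c :
  at_code P p (i :: c) -> onth P p = Some i /\ at_code P p.+1 c.
Proof.
move=> H; split; first by rewrite -[p]addn0 H.
by move=> j Hj; rewrite addSnnS H.
Qed.

(** A Hoare triple with exit address [p'] and time bound [t]. Since [t] is only an upper bound,
    [cost] may add up both branches of a conditional. *)
Definition exe P p mu p' t (Q : (nat -> nat) -> Prop) :=
  exists k mu', [/\ k <= t,
    iter k (step P) (Config p mu) = Config p' mu' & Q mu'].

Lemma exe_refl P p mu t (Q : (nat -> nat) -> Prop) : Q mu -> exe P p mu p t Q.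
Proof. by move=> HQ; exists 0, mu. Qed.

Lemma exe_step P p mu p1 mu1 i p' t (Q : (nat -> nat) -> Prop) :
  onth P p = Some i -> exec i (Config p mu) = Config p1 mu1 -> 0 < t ->
  exe P p1 mu1 p' t.-1 Q -> exe P p mu p' t Q.
Proof.
move=> Hp Hi Ht [k [mu' [Hk Hit HQ]]]; exists k.+1, mu'; split=> //; first lia.
have E : step P (Config p mu) = Config p1 mu1 by rewrite /step /= Hp -Hi.
by rewrite iterSr E.
Qed.

Lemma exe_bind P p mu p1 t1 Q1 p2 t2 t Q2 :
  exe P p mu p1 t1 Q1 -> t1 + t2 <= t ->
  (forall mu1, Q1 mu1 -> exe P p1 mu1 p2 t2 Q2) -> exe P p mu p2 t Q2.
Proof.
move=> [k1 [mu1 [Hk1 H1 HQ1]]] Ht /(_ _ HQ1) [k2 [mu2 [Hk2 H2 HQ2]]].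
exists (k2 + k1), mu2; split=> //; first lia.
by rewrite iterD H1.
Qed.

Lemma exe_cast P p mu p1 p2 t Q : p1 = p2 -> exe P p mu p1 t Q -> exe P p mu p2 t Q.
Proof. by move->. Qed.

Lemma updE m r k s : upd m r k s = if s == r then k else m s.
Proof. by []. Qed.

Lemma exe_adds P r s n : forall p mu, r != s ->
  at_code P p (nseq n (IAdd r r s)) ->
  exe P p mu (p + n) n
    (fun mu' => mu' r = mu r + n * mu s /\ forall q, q != r -> mu' q = mu q).
Proof.
elim: n => [|n IHn] p mu Hrs Hc.
  by rewrite addn0; apply: exe_refl; rewrite mul0n addn0.
have [H1 H2] := at_code_cons Hc.
apply: (exe_step H1) => //=.
apply: (@exe_bind _ _ _ (p.+1 + n) n _ _ 0).
- exact: IHn.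
- by rewrite addn0.
- move=> mu1 [E1 E2]; rewrite addSnnS; apply: exe_refl; split.
    by rewrite E1 /= !updE eqxx eq_sym (negPf Hrs); lia.
  by move=> q Hq; rewrite E2 // updE (negPf Hq).
Qed.

Lemma exe_set_addr P p mu r a s : r != s -> at_code P p (set_addr r a s) ->
  exe P p mu (p + KA.+1) KA.+1
    (fun mu' => mu' r = address a (mu s) /\ forall q, q != r -> mu' q = mu q).
Proof.
move=> Hrs /at_code_cons [H1 H2]; apply: (exe_step H1) => //=.
apply: (@exe_bind _ _ _ (p.+1 + KA) KA _ _ 0).
- exact: (exe_adds _ Hrs H2).
- by rewrite addn0.
- move=> mu1 [E1 E2]; rewrite addSnnS; apply: exe_refl; split.
    by rewrite E1 !updE eqxx eq_sym (negPf Hrs) /address; lia.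
  by move=> q Hq; rewrite E2 // updE (negPf Hq).
Qed.

Definition frame s (mu mu' : nat -> nat) :=
  (forall r, r < s -> mu' r = mu r) /\ (forall r, Z0 <= r -> mu' r = mu r).

Lemma frame_refl s mu : frame s mu mu. Proof. by []. Qed.

Lemma frame_trans s s1 s2 mu mu1 mu2 : s <= s1 -> s <= s2 ->
  frame s1 mu mu1 -> frame s2 mu1 mu2 -> frame s mu mu2.
Proof.
move=> H1 H2 [F1 G1] [F2 G2]; split=> r Hr; last by rewrite G2 // G1.
by rewrite F2 ?F1 //; apply: leq_trans Hr _.
Qed.

Lemma frame_upd s mu r k : s <= r -> r < Z0 -> frame s mu (upd mu r k).
Proof. by move=> H1 H2; split=> q Hq; rewrite updE; case: eqP => // E; lia. Qed.

Lemma frame_upd2 s mu r k r' k' : s <= r -> r < Z0 -> s <= r' -> r' < Z0 ->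
  frame s mu (upd (upd mu r k) r' k').
Proof.
by move=> *; apply: (frame_trans (leqnn s) (leqnn s)) (frame_upd _ _ _ _) (frame_upd _ _ _ _).
Qed.

Definition env_ok (loc env : seq nat) s (mu : nat -> nat) :=
  [/\ size loc = size env, all (fun r => r < s) loc &
      forall k, k < size loc -> mu (nth 0 loc k) = nth 0 env k].

Lemma env_ok_frame loc env s s' mu mu' : s <= s' -> frame s mu mu' ->
  env_ok loc env s mu -> env_ok loc env s' mu'.
Proof.
move=> Hs [F _] [H1 H2 H3]; split=> //.
  by apply: sub_all H2 => r Hr; apply: leq_trans Hr _.
by move=> k Hk; rewrite F ?H3 //; apply: (all_nthP 0 H2).
Qed.

Lemma env_ok_cons loc env s mu r v : r < s -> mu r = v ->
  env_ok loc env s mu -> env_ok (r :: loc) (v :: env) s mu.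
Proof.
move=> Hr Hv [H1 H2 H3]; split=> /=; first by rewrite H1.
  by rewrite Hr.
by case=> [|k] //= Hk; apply: H3.
Qed.

Definition mem_ok (m : mem) (mu : nat -> nat) :=
  forall a i, a < KA -> mu (address a i) = m a i.

Lemma mem_ok_frame m s mu mu' : frame s mu mu' -> mem_ok m mu -> mem_ok m mu'.
Proof.
by move=> [_ G] H a i Ha; rewrite G ?H // /address -addnA leq_addr.
Qed.

Fixpoint arrs_ok (e : expr) : bool :=
  match e with
  | Loc _ | Cst _ => true
  | Rd a e1 => (a < KA) && arrs_ok e1
  | Add e1 e2 | Sub e1 e2 | Let e1 e2 | Sum e1 e2 => arrs_ok e1 && arrs_ok e2
  | Ite e0 e1 e2 | Rec e0 e1 e2 => [&& arrs_ok e0, arrs_ok e1 & arrs_ok e2]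
  end.

Definition comp_spec P p loc s e m env mu :=
  exe P p mu (p + size (comp loc s p e)) (cost m env e)
    (fun mu' => mu' s = eval m env e /\ frame s mu mu').

Ltac one H := apply: (exe_step H); [reflexivity | by [] | ].

Lemma exe_weaken P p mu p' t t' (Q Q' : (nat -> nat) -> Prop) :
  exe P p mu p' t Q -> t <= t' -> (forall mu', Q mu' -> Q' mu') ->
  exe P p mu p' t' Q'.
Proof.
move=> [k [mu' [H1 H2 H3]]] H4 H5; exists k, mu'; split=> //; last exact: H5.
exact: leq_trans H4.
Qed.

(** Register [s] counts the rounds that are left, so the test at [h] is a test for zero; the
    induction is on that number. *)
Lemma exe_loop P h h' s B (c : nat -> nat) (I : nat -> (nat -> nat) -> Prop) :
  onth P h = Some (IJz s h') ->
  (forall i mu, I i mu -> mu s = B - i) ->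
  (forall i mu, i < B -> I i mu -> exe P h.+1 mu h (c i) (I i.+1)) ->
  forall mu, I 0 mu ->
  exe P h mu h' (1 + \sum_(i < B) (c i + 1)) (I B).
Proof.
move=> Hh Hs Hb.
suff H j : forall i mu, i + j = B -> I i mu ->
    exe P h mu h' (1 + \sum_(i <= k < B) (c k + 1)) (I B).
  by move=> mu HI; rewrite -(big_mkord xpredT (fun i => c i + 1)); apply: (H B).
elim: j => [|j IHj] i mu Hij HI.
  apply: (exe_step Hh) => //=; rewrite (Hs _ _ HI) (_ : B - i = 0); last lia.
  by apply: exe_refl; rewrite -Hij addn0.
have Hi : i < B by lia.
apply: (exe_step Hh) => //=; rewrite (Hs _ _ HI) (_ : (B - i == 0) = false);
  last by apply/eqP; lia.
rewrite big_ltn //; apply: (exe_bind (Hb _ _ Hi HI)); last first.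
  by move=> mu1 HI1; apply: (IHj i.+1) => //; lia.
by rewrite add0n; lia.
Qed.

Lemma compP P e : forall loc s p m env mu,
  at_code P p (comp loc s p e) -> s + need e <= Z0 -> arrs_ok e ->
  env_ok loc env s mu -> mem_ok m mu -> comp_spec P p loc s e m env mu.
Proof.
rewrite /comp_spec; elim: e => [k|c|a e IHe|e1 IH1 e2 IH2|e1 IH1 e2 IH2|
  e0 IH0 e1 IH1 e2 IH2|e1 IH1 e2 IH2|eb IHb e1 IH1|eb IHb e0 IH0 e1 IH1]
  loc s p m env mu /=.
- case: ifP => Hk Hc Hn _ [E1 E2 E3] Hm.
    have [C1 /at_code_cons [C2 _]] := at_code_cons Hc.
    one C1; one C2; apply: exe_cast (esym (addn2 p)) _; apply: exe_refl.
    have Hls := all_nthP 0 E2 _ Hk.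
    split; last by apply: frame_upd2 => //; lia.
    by rewrite !updE eqxx ltn_eqF // E3.
  have [C1 _] := at_code_cons Hc.
  one C1; apply: exe_cast (esym (addn1 p)) _; apply: exe_refl.
  split; last by apply: frame_upd; lia.
  by rewrite updE eqxx nth_default // -E1 leqNgt Hk.
- move=> Hc Hn _ _ _; have [C1 _] := at_code_cons Hc.
  one C1; apply: exe_cast (esym (addn1 p)) _; apply: exe_refl.
  split; last by apply: frame_upd; lia.
  by rewrite updE eqxx.
- move=> /at_code_cat [Ha]; rewrite -cat_cons => /at_code_cat [Hs].
  move=> /at_code_cons [Hl _] Hn /andP[Hak Har] He Hm.
  rewrite !size_cat /= size_nseq.
  apply: (exe_bind (IHe _ _ _ _ _ _ Ha _ Har He Hm) (t2 := KA.+2)); [lia|lia|].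
  move=> mu1 [V1 F1].
  have Hss : s.+1 != s by rewrite neq_ltn ltnSn orbT.
  apply: (exe_bind (exe_set_addr mu1 Hss Hs) (t2 := 1)); first by rewrite addn1.
  move=> mu2 [V2 F2]; rewrite /= size_nseq in Hl; one Hl.
  apply: (@exe_cast _ _ _ (p + size (comp loc s p e) + KA.+1).+1); first lia.
  apply: exe_refl; rewrite !updE eqxx V2 V1; split.
    have := leq_addr (KA * eval m env e + a) Z0; rewrite addnA => Hz.
    rewrite F2; last by rewrite /address; apply/eqP; lia.
    by have := mem_ok_frame F1 Hm => ->.
  apply: (frame_trans _ _ F1 (s2 := s)) => //; split=> q Hq.
    by rewrite updE ifN ?F2 //; apply/eqP; lia.
  by rewrite updE ifN ?F2 //; apply/eqP; lia.
- move=> /at_code_cat [H1] /at_code_cat [H2] /at_code_cons [H3 _] Hn /andP[A1 A2] He Hm.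
  rewrite !size_cat /=.
  apply: (exe_bind (IH1 _ _ _ _ _ _ H1 _ A1 He Hm) (t2 := (cost m env e2).+1)); [lia|lia|].
  move=> mu1 [V1 F1].
  apply: (exe_bind (IH2 _ _ _ _ _ _ H2 _ A2 (env_ok_frame _ F1 He) (mem_ok_frame F1 Hm))
           (t2 := 1)); [lia..|].
  move=> mu2 [V2 F2]; one H3.
  apply: exe_cast; last apply: exe_refl; first lia.
  split; first by rewrite updE eqxx V2 (proj1 F2) // V1.
  apply: (frame_trans _ _ F1 (s2 := s)) => //.
  by apply: (frame_trans _ _ F2 (s2 := s)) => //; apply: frame_upd; lia.
- move=> /at_code_cat [H1] /at_code_cat [H2] /at_code_cons [H3 _] Hn /andP[A1 A2] He Hm.
  rewrite !size_cat /=.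
  apply: (exe_bind (IH1 _ _ _ _ _ _ H1 _ A1 He Hm) (t2 := (cost m env e2).+1)); [lia|lia|].
  move=> mu1 [V1 F1].
  apply: (exe_bind (IH2 _ _ _ _ _ _ H2 _ A2 (env_ok_frame _ F1 He) (mem_ok_frame F1 Hm))
           (t2 := 1)); [lia..|].
  move=> mu2 [V2 F2]; one H3.
  apply: exe_cast; last apply: exe_refl; first lia.
  split; first by rewrite updE eqxx V2 (proj1 F2) // V1.
  apply: (frame_trans _ _ F1 (s2 := s)) => //.
  by apply: (frame_trans _ _ F2 (s2 := s)) => //; apply: frame_upd; lia.
- move=> /at_code_cat [H0] /at_code_cons [J1] /at_code_cat [H1] /at_code_cons [J2 H2].
  move=> Hn /and3P[A0 A1 A2] He Hm; rewrite !size_cat /= size_cat /=.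
  apply: (exe_bind (IH0 _ _ _ _ _ _ H0 _ A0 He Hm)
    (t2 := cost m env e1 + cost m env e2 + 2)); [lia|lia|].
  move=> mu1 [V1 F1]; apply: (exe_step J1) => //=; first lia.
  rewrite V1; have He1 := env_ok_frame (leqnn s) F1 He.
  have Hm1 := mem_ok_frame F1 Hm; case: ifP => V.
    apply: exe_cast; last apply: (exe_bind (IH2 _ _ _ _ _ _ H2 _ A2 He1 Hm1) (t2 := 0));
      last (move=> mu2 [V2 F2]; apply: exe_refl; split=> //; exact: (frame_trans _ _ F1 F2));
      lia.
  apply: (exe_bind (IH1 _ _ _ _ _ _ H1 _ A1 He1 Hm1) (t2 := 1)); [lia|lia|].
  move=> mu2 [V2 F2]; one J2.
  apply: exe_cast; last (apply: exe_refl; split=> //; exact: (frame_trans _ _ F1 F2)).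
  lia.
- move=> /at_code_cat [H1] /at_code_cat [H2] /at_code_cons [H3] /at_code_cons [H4 _].
  move=> Hn /andP[A1 A2] He Hm; rewrite !size_cat /=.
  apply: (exe_bind (IH1 _ _ _ _ _ _ H1 _ A1 He Hm)
    (t2 := cost m (eval m env e1 :: env) e2 + 2)); [lia|lia|].
  move=> mu1 [V1 F1].
  have He1 := env_ok_cons (ltnSn s) V1 (env_ok_frame (leqnSn s) F1 He).
  apply: (exe_bind (IH2 _ _ _ _ _ _ H2 _ A2 He1 (mem_ok_frame F1 Hm))
           (t2 := 2)); [lia..|].
  move=> mu2 [V2 F2]; one H3; one H4.
  apply: exe_cast; last apply: exe_refl; first lia.
  split; first by rewrite !updE eqxx (gtn_eqF (ltnSn s)) V2.
  apply: (frame_trans _ _ F1 (s2 := s)) => //.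
  apply: (frame_trans _ _ F2 (s2 := s)) => //.
  by apply: frame_upd2 => //; lia.
- move=> /at_code_cat [H1] /at_code_cons [J1] /at_code_cons [J2] /at_code_cons [J3].
  move=> /at_code_cat [H2] /at_code_cons [J4] /at_code_cons [J5] /at_code_cons [J6].
  move=> /at_code_cons [J7] /at_code_cons [J8 _] Hn /andP[A1 A2] He Hm.
  rewrite !size_cat /= size_cat /=; set B := eval m env eb.
  have Hs2 : s <= s.+2 by lia.
  have He2 := env_ok_frame Hs2 (frame_refl s mu) He.
  apply: (exe_bind (IHb _ _ _ _ _ _ H1 _ A1 He2 Hm) (t2 := 2 +
    (1 + \sum_(i < B) (cost m (val i :: env) e1 + 5 + 1)))); first lia.
    by rewrite -addnA leq_add2l addnA leq_add2l; apply: leq_sum => i _; rewrite -addnA leq_add2l.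
  move=> mu1 [V1 F1]; one J1; one J2; rewrite /=.
  (* Register [s] holds the partial sum, [s.+1] the index that the body sees as its innermost
     variable, [s.+2] the number of remaining rounds; the body works from [s.+3] on. *)
  pose I i mu' := [/\ mu' s = iteri i (fun i acc => acc + eval m (i :: env) e1) 0,
    mu' s.+1 = i, mu' s.+2 = B - i & frame s mu mu'].
  set h := (p + _).+2 in J3 H2 J4 J5 J6 J7 J8 *.
  have Hl := @exe_loop P h _ s.+2 B (fun i => cost m (i :: env) e1 + 5) I J3.
  apply: exe_cast; last apply: (exe_weaken (Hl _ _ _ _)); last 2 first.
  - by [].
  - by move=> mu' [W1 _ _ W2].
  - rewrite /h; lia.
  - by move=> i mu' [].
  - move=> i mu' Hi [W1 W2 W3 F2].
    have He3 : env_ok (s.+1 :: loc) (i :: env) s.+3 mu'.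
      by apply: env_ok_cons W2 (env_ok_frame _ F2 He); lia.
    apply: (exe_bind (IH1 _ _ _ _ _ _ H2 _ A2 He3 (mem_ok_frame F2 Hm)) (t2 := 5)); [lia..|].
    move=> mu2 [V2 F3]; one J4; one J5; one J6; one J7; one J8.
    apply: exe_refl; have [F4 F5] := F3.
    have E1 : (s == s.+1) = false by apply/eqP; lia.
    have E2 : (s == s.+2) = false by apply/eqP; lia.
    have E3 : (s == s.+3) = false by apply/eqP; lia.
    have E4 : (s.+1 == s.+2) = false by apply/eqP; lia.
    have E5 : (s.+1 == s.+3) = false by apply/eqP; lia.
    have E6 : (s.+2 == s.+3) = false by apply/eqP; lia.
    have E7 : (s.+2 == s.+1) = false by apply/eqP; lia.
    have E8 : (s.+3 == s) = false by apply/eqP; lia.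
    have E9 : (s.+3 == s.+1) = false by apply/eqP; lia.
    have E10 : (s.+2 == s) = false by apply/eqP; lia.
    have E11 : (s.+1 == s) = false by apply/eqP; lia.
    have [G1 G2 G3] : [/\ mu2 s = mu' s, mu2 s.+1 = mu' s.+1 & mu2 s.+2 = mu' s.+2].
      by rewrite !F4 //; lia.
    rewrite /I ?(updE, eqxx, E1, E2, E3, E4, E5, E6, E7, E8, E9, E10, E11).
    rewrite V2 ?G1 G2 G3 ?W1 W2 W3 addn1 subn1; split=> //; first by lia.
    apply: (frame_trans (leqnn s) _ F2 (s2 := s)) => //.
    apply: (frame_trans _ _ F3 (s2 := s)) => //; first lia.
    split=> q Hq; rewrite !updE !ifN //; apply/eqP; lia.
  - rewrite /I !updE !eqxx; have -> : (s == s.+1) = false by apply/eqP; lia.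
    have -> : (s.+2 == s) = false by apply/eqP; lia.
    have -> : (s.+2 == s.+1) = false by apply/eqP; lia.
    rewrite V1 subn0; split=> //.
    apply: (frame_trans Hs2 (leqnn s) F1).
    by apply: frame_upd2 => //; lia.
- move=> /at_code_cat [H0] /at_code_cat [H1] /at_code_cons [J2] /at_code_cons [J3].
  move=> /at_code_cat [H2] /at_code_cons [J4] /at_code_cons [J4'] /at_code_cons [J5].
  move=> /at_code_cons [J6] /at_code_cons [J7] /at_code_cons [J8 _] Hn.
  move=> /and3P[A1 A0 A2] He Hm.
  rewrite !size_cat /= !size_cat /=; set B := eval m env eb.
  pose acc i := iteri i (fun i acc => eval m [:: i, acc & env] e1) (eval m env e0).
  set sm := \sum_(i < B) _.
  apply: (exe_bind (IH0 _ _ _ _ _ _ H0 _ A0 He Hm) (t2 := cost m env eb + 3 + sm)); [lia|lia|].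
  move=> mu0 [V0 F0].
  have Hs2 : s <= s.+2 by lia.
  have He0 := env_ok_frame Hs2 F0 He.
  apply: (exe_bind (IHb _ _ _ _ _ _ H1 _ A1 He0 (mem_ok_frame F0 Hm)) (t2 := 2 +
    (1 + \sum_(i < B) (cost m [:: val i, acc i & env] e1 + 6 + 1)))); first lia.
    by rewrite -addnA leq_add2l addnA leq_add2l; apply: leq_sum => i _; rewrite -addnA leq_add2l.
  move=> mu1 [V1 F1]; one J2; rewrite /=.
  pose I i mu' := [/\ mu' s = acc i,
    mu' s.+1 = i, mu' s.+2 = B - i & frame s mu mu'].
  set h := (p + _ + _).+1 in J3 H2 J4 J4' J5 J6 J7 J8 *.
  have Hl := @exe_loop P h _ s.+2 B (fun i => cost m [:: i, acc i & env] e1 + 6) I J3.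
  apply: exe_cast; last apply: (exe_weaken (Hl _ _ _ _)); last 2 first.
  - by [].
  - by move=> mu' [W1 _ _ W2].
  - rewrite /h; lia.
  - by move=> i mu' [].
  - move=> i mu' Hi [W1 W2 W3 F2].
    have He3 : env_ok [:: s.+1, s & loc] [:: i, acc i & env] s.+3 mu'.
      apply: env_ok_cons W2 (env_ok_cons _ W1 (env_ok_frame _ F2 He)); lia.
    apply: (exe_bind (IH1 _ _ _ _ _ _ H2 _ A2 He3 (mem_ok_frame F2 Hm)) (t2 := 6)); [lia..|].
    move=> mu2 [V2 F3]; one J4; one J4'; one J5; one J6; one J7; one J8.
    apply: exe_refl; have [F4 F5] := F3.
    have E1 : (s == s.+1) = false by apply/eqP; lia.
    have E2 : (s == s.+2) = false by apply/eqP; lia.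
    have E3 : (s == s.+3) = false by apply/eqP; lia.
    have E4 : (s.+1 == s.+2) = false by apply/eqP; lia.
    have E5 : (s.+1 == s.+3) = false by apply/eqP; lia.
    have E6 : (s.+2 == s.+3) = false by apply/eqP; lia.
    have E7 : (s.+2 == s.+1) = false by apply/eqP; lia.
    have E8 : (s.+3 == s) = false by apply/eqP; lia.
    have E9 : (s.+3 == s.+1) = false by apply/eqP; lia.
    have E10 : (s.+2 == s) = false by apply/eqP; lia.
    have E11 : (s.+1 == s) = false by apply/eqP; lia.
    have [G1 G2 G3] : [/\ mu2 s = mu' s, mu2 s.+1 = mu' s.+1 & mu2 s.+2 = mu' s.+2].
      by rewrite !F4 //; lia.
    rewrite /I ?(updE, eqxx, E1, E2, E3, E4, E5, E6, E7, E8, E9, E10, E11).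
    rewrite V2 ?G1 G2 G3 ?W1 W2 W3 addn1 subn1; split=> //; first by lia.
    apply: (frame_trans (leqnn s) _ F2 (s2 := s)) => //.
    apply: (frame_trans _ _ F3 (s2 := s)) => //; first lia.
    split=> q Hq; rewrite !updE !ifN //; apply/eqP; lia.
  - rewrite /I !updE !eqxx; have -> : (s == s.+1) = false by apply/eqP; lia.
    have -> : (s.+2 == s.+1) = false by apply/eqP; lia.
    rewrite V1 subn0; split=> //; first by rewrite (proj1 F1) ?V0 //; lia.
    apply: (frame_trans _ _ F0 (s2 := s)) => //.
    apply: (frame_trans Hs2 (leqnn s) F1).
    by apply: frame_upd; lia.
Qed.

End Compiler.

Ltac one H := apply: (exe_step H); [reflexivity | by [] | ].

(** * Compilation of commands and loading of the input *)

Section CompilePrograms.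

Variables Z0 KA : nat.

Notation addr := (address Z0 KA).
Notation mem_ok := (mem_ok Z0 KA).

Lemma addr_inj a b i j : a < KA -> b < KA ->
  addr a i = addr b j -> a = b /\ i = j.
Proof.
rewrite /addr -!addnA => Ha Hb /addnI H.
have E : (KA * i + a) %/ KA = (KA * j + b) %/ KA by rewrite H.
rewrite ![KA * _]mulnC !divnMDl ?divn_small ?addn0 // in E; try lia.
Qed.

Lemma mem_ok_write m mu a i x : a < KA -> mem_ok m mu ->
  mem_ok (write m a i x) (upd mu (addr a i) x).
Proof.
move=> Ha H b j Hb; rewrite updE /write; case: ifP => [/eqP E|/eqP E].
  by have [-> ->] := addr_inj Hb Ha E; rewrite !eqxx.
case: ifP => [/andP[/eqP Eb /eqP Ej]|_]; last exact: H.
by rewrite Eb Ej in E.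
Qed.

Lemma mem_ok_upd m mu r x : r < Z0 -> mem_ok m mu -> mem_ok m (upd mu r x).
Proof.
move=> Hr H b j Hb; rewrite updE ifN ?H //; apply/eqP => E.
have := leq_addr (KA * j + b) Z0; rewrite addnA; rewrite /address in E; lia.
Qed.

(** Register 0 holds the index, 1 the number of remaining entries, 2 the computed entry and 3 its
    address. *)
Definition comp_cmd a p (c : cmd) : seq instr :=
  let cb := comp Z0 KA [::] 1 p c.1 in
  let h := (p + size cb).+1 in
  let c1 := comp Z0 KA [:: 0] 2 h.+1 c.2 in
  cb ++ [:: IConst 0 0, IJz 1 (h.+1 + size c1 + KA + 6) &
  c1 ++ set_addr Z0 KA 3 a 0 ++
  [:: IStore 3 2; IConst 2 1; IAdd 0 0 2; ISub 1 1 2; IJmp h]].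

Definition cmd_cost m a (c : cmd) :=
  cost KA m [::] c.1 + 2 +
  \sum_(i < eval m [::] c.1) (cost KA (fill m a i c.2) [:: val i] c.2 + KA + 7).

Definition cmd_ok (c : cmd) := [&& 1 + need c.1 <= Z0, 2 + need c.2 <= Z0,
  arrs_ok KA c.1 & arrs_ok KA c.2].

Lemma comp_cmdP P a p c m mu :
  at_code P p (comp_cmd a p c) -> a < KA -> 4 <= Z0 -> cmd_ok c ->
  mem_ok m mu ->
  exe P p mu (p + size (comp_cmd a p c)) (cmd_cost m a c)
    (mem_ok (fill m a (eval m [::] c.1) c.2)).
Proof.
move=> + Ha HZ /and4P[N1 N2 A1 A2] Hm; case: c N1 N2 A1 A2 => eb e /= N1 N2 A1 A2.
rewrite /comp_cmd /cmd_cost /= => /at_code_cat [H1] /at_code_cons [J1].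
move=> /at_code_cons [J2] /at_code_cat [H2]; rewrite -cat_cons => /at_code_cat [H3].
move=> /at_code_cons [J3] /at_code_cons [J4] /at_code_cons [J5] /at_code_cons [J6].
move=> /at_code_cons [J7 _]; rewrite !size_cat /= !size_cat /= size_cat size_nseq /=.
set B := eval m [::] eb.
have He : env_ok [::] [::] 1 mu by split.
apply: (exe_bind (compP H1 N1 A1 He Hm) (t2 := 1 +
  (1 + \sum_(i < B) (cost KA (fill m a i e) [:: val i] e + KA + 6 + 1)))).
  rewrite -addnA leq_add2l addnA leq_add2l; apply: leq_sum => i _.
  by rewrite -addnA.
move=> mu1 [V1 F1]; one J1; rewrite /=.
pose I i mu' := [/\ mem_ok (fill m a i e) mu', mu' 0 = i & mu' 1 = B - i].
set h := (p + _).+1 in J2 H2 H3 J3 J4 J5 J6 J7 *.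
have Hl := @exe_loop P h _ 1 B
  (fun i => cost KA (fill m a i e) [:: i] e + KA + 6) I J2.
apply: exe_cast; last apply: (exe_weaken (Hl _ _ _ _)).
- rewrite /h; lia.
- by move=> i mu' [].
- move=> i mu' Hi [W1 W2 W3].
  have He3 : env_ok [:: 0] [:: i] 2 mu' by split=> //; case.
  apply: (exe_bind (compP H2 N2 A2 He3 W1) (t2 := KA + 6)); first lia.
  move=> mu2 [V2 F2].
  apply: (exe_bind (exe_set_addr mu2 (isT : 3 != 0) H3) (t2 := 5)); first lia.
  move=> mu3 [V3 F3].
  have ES : size (IConst 3 (Z0 + a) :: nseq KA (IAdd 3 3 0)) = KA.+1.
    by rewrite /= size_nseq.
  rewrite ES in J3 J4 J5 J6 J7.
  one J3; one J4; one J5; one J6; one J7; apply: exe_refl.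
  have E0 : mu3 0 = i by rewrite F3 // (proj1 F2) // W2.
  have E1 : mu3 1 = B - i by rewrite F3 // (proj1 F2) // W3.
  have E2 : mu3 2 = eval (fill m a i e) [:: i] e by rewrite F3 // V2.
  have E3 : mu3 3 = addr a i by rewrite V3 (proj1 F2) // W2.
  have Hz : 4 <= addr a i by rewrite /addr -addnA ltn_addr.
  have HN r : r < 4 -> (r == addr a i) = false by move=> Hr; apply/eqP; lia.
  split.
  - rewrite !E3 E2; do 3 (apply: mem_ok_upd; first lia).
    apply: mem_ok_write => // b j Hb; rewrite F3.
      exact: (mem_ok_frame F2 W1).
    by apply/eqP; rewrite /address; lia.
  - by rewrite /upd /= E3 !HN //= E0 addn1.
  - by rewrite /upd /= E3 !HN //= E1; lia.
- split=> //=; last by rewrite subn0.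
  by apply: mem_ok_upd; [lia|exact: mem_ok_frame F1 Hm].
- by [].
- by move=> mu' [].
Qed.

Fixpoint comp_cmds a p (cs : seq cmd) : seq instr :=
  if cs is c :: cs' then
    let c1 := comp_cmd a p c in c1 ++ comp_cmds a.+1 (p + size c1) cs'
  else [::].

Fixpoint run_cost m a (cs : seq cmd) : nat :=
  if cs is c :: cs' then
    cmd_cost m a c + run_cost (fill m a (eval m [::] c.1) c.2) a.+1 cs'
  else 0.

Lemma comp_cmdsP P cs : forall a p m mu,
  at_code P p (comp_cmds a p cs) -> a + size cs <= KA -> 4 <= Z0 ->
  all cmd_ok cs -> mem_ok m mu ->
  exe P p mu (p + size (comp_cmds a p cs)) (run_cost m a cs)
    (mem_ok (run m a cs)).
Proof.
elim: cs => [|c cs IHcs] a p m mu.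
  by move=> _ _ _ _ Hm; rewrite addn0; apply: exe_refl.
move=> /at_code_cat [H1 H2] Ha HZ /andP[Hc Hcs] Hm; rewrite /= in Ha.
rewrite [size _]size_cat addnA.
apply: (exe_bind (comp_cmdP H1 _ HZ Hc Hm) (leqnn _)); first lia.
by move=> mu1 Hm1; apply: IHcs => //; lia.
Qed.

(* The first four input bits are packed into register 1, which frees registers
   2, 3 and 4; the input is then spread out, from its end, over array 0.  Since
   the target of a copy lies beyond all bits still to be copied, nothing is
   lost.  Array 1 receives the length and array 2 the packed bits. *)
Definition prelude : seq instr :=
  [:: IAdd 1 1 1; IAdd 1 1 2; IAdd 1 1 1; IAdd 1 1 3; IAdd 1 1 1; IAdd 1 1 4;
      ISub 2 2 2; IAdd 2 2 0] ++
  set_addr Z0 KA 3 0 0 ++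
  [:: IJz 0 (17 + KA); ILoad 4 0; IStore 3 4; IConst 4 KA; ISub 3 3 4;
      IConst 4 1; ISub 0 0 4; IJmp (9 + KA);
      IConst 3 (Z0 + 1); IStore 3 2; IConst 3 (Z0 + 2); IStore 3 1].

Definition pack (w : seq bool) : nat :=
  8 * nth false w 0 + 4 * nth false w 1 + 2 * nth false w 2 + nth false w 3.

(** Array 0 is described from bit 4 on, the registers of the earlier bits having served as scratch
    space. The arrays from 3 on may contain left-over input bits, so nothing is said of them. *)
Definition initial (w : seq bool) (m : mem) :=
  [/\ m 1 0 = size w, m 2 0 = pack w &
      forall i, 4 <= i -> i < size w -> m 0 i.+1 = nth false w i].

Lemma preludeP P w : at_code P 0 prelude -> 5 <= Z0 -> 3 <= KA ->
  exe P 0 (reg (init w)) (size prelude) (14 + KA + 8 * size w)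
    (fun mu => initial w (fun a i => mu (addr a i))).
Proof.
move=> H HZ HK; have -> : size prelude = 21 + KA.
  by rewrite /prelude !size_cat /= size_nseq; lia.
move: H; rewrite /prelude.
do 8 move=> /at_code_cons [?]; move=> /at_code_cat [H1].
have -> : size (set_addr Z0 KA 3 0 0) = KA.+1 by rewrite /= size_nseq.
do 12 (let J := fresh "J" in move=> /at_code_cons [J]); move=> _.
do 8 match goal with H : onth P _ = Some _ |- exe P ?p _ _ _ _ =>
  match type of H with onth P p = _ => one H; clear H end end.
rewrite /=; set mu0 := upd _ 2 _.
apply: (exe_bind (exe_set_addr mu0 (isT : 3 != 0) H1)
  (t2 := 1 + (\sum_(i < size w) (7 + 1)) + 4)); first by rewrite sum_nat_const card_ord; lia.
move=> mu1 [V1 F1].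
(* After [i] rounds the last [i] bits are in array 0 and the others still in their input registers;
   register 3 holds the next target. *)
pose I i mu := [/\ mu 0 = size w - i, mu 1 = pack w, mu 2 = size w,
  mu 3 = Z0 + KA * (size w - i) & forall j, 4 <= j ->
  (j < size w - i -> mu j.+1 = nth false w j) /\
  (size w - i <= j -> j < size w -> mu (Z0 + KA * j.+1) = nth false w j)].
have M0 : mu0 0 = size w by [].
have M1 : mu0 1 = pack w by rewrite /mu0 /upd /= /pack; lia.
have M2 : mu0 2 = size w by rewrite /mu0 /upd /=; lia.
have M3 j : 4 <= j -> mu0 j.+1 = nth false w j.
  by case: j => [|[|[|[|j]]]].
move: mu0 V1 F1 M0 M1 M2 M3 => mu0 V1 F1 M0 M1 M2 M3.
have Hl := @exe_loop P (9 + KA) (17 + KA) 0 (size w) (fun=> 7) I J.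
apply: (exe_bind (Hl _ _ mu1 _)) => //.
- by move=> i mu [].
- move=> i mu Hi [W0 W1 W2 W3 W4].
  one J0; one J1; one J2; one J3; one J4; one J5; one J6; apply: exe_refl.
  have HD : size w - i = (size w - i.+1).+1 by lia.
  have HZ3 : Z0 <= mu 3 by rewrite W3 leq_addr.
  have HN r : r < 5 -> (r == mu 3) = false by move=> Hr; apply/eqP; lia.
  rewrite /I /upd /= !HN //= W0 W1 W2; split=> //; first lia.
    by rewrite W3 HD mulnS addnCA addKn.
  move=> j Hj; rewrite HD in W0 W3 W4.
  have X3 : (j.+1 == 3) = false by apply/eqP; lia.
  have X4 : (j.+1 == 4) = false by apply/eqP; lia.
  have HX : size w - i.+1 < KA * (size w - i.+1).+1.
    by rewrite -[X in X <= _]mul1n leq_mul //; lia.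
  split=> [Hj1|Hj1 Hj2].
    rewrite X3 X4 ifN; first by apply: (proj1 (W4 _ Hj)); lia.
    move: W3 HX; generalize (KA * (size w - i.+1).+1) => x W3 HX; apply/eqP; lia.
  have HKj : j < KA * j.+1 by rewrite -[X in X <= _]mul1n leq_mul //; lia.
  have HY r : r < 5 -> (Z0 + KA * j.+1 == r) = false.
    by move: HKj; generalize (KA * j.+1) => x *; apply/eqP; lia.
  rewrite (HY 0) // (HY 3) // (HY 4) // W3 HD; case: eqP => [/addnI/eqP E|E].
    rewrite eqn_mul2l in E; have Ej : j = size w - i.+1 by lia.
    by rewrite -Ej; apply: (proj1 (W4 _ Hj)); lia.
  have Ej : j <> size w - i.+1 by move=> Ej; rewrite Ej in E.
  by apply: (proj2 (W4 _ Hj)); lia.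
- rewrite /I V1 !F1 // M0 M1 M2 /address subn0 addn0; split=> // j Hj.
  split=> [Hj1|]; last lia.
  by rewrite F1 ?M3 //; apply/eqP; lia.
- move=> mu [W0 W1 W2 W3 W4]; rewrite subnn in W0 W3 W4.
  one J7; one J8; one J9; one J10; apply: exe_cast; last apply: exe_refl; first lia.
  rewrite /initial /address /upd /= muln0 addn0 W2 W1.
  have E12 : (Z0 + 1 == Z0 + 2) = false by apply/eqP; lia.
  have E21 : (Z0 + 2 == Z0 + 1) = false by apply/eqP; lia.
  have E13 : (Z0 + 1 == 3) = false by apply/eqP; lia.
  have E23 : (Z0 + 2 == 3) = false by apply/eqP; lia.
  have E11 : (1 == Z0 + 1) = false by apply/eqP; lia.
  have E22 : (2 == Z0 + 1) = false by apply/eqP; lia.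
  rewrite ?(E12, E21, E13, E23, E11, E22, eqxx); split=> // i Hi Hi2.
  rewrite !addn0.
  have HKj : 3 <= KA * i.+1 by rewrite -[X in X <= _]muln1 leq_mul.
  have HK3 : KA * i.+1 != 1 /\ KA * i.+1 != 2 by lia.
  rewrite !eqn_add2l (negPf (proj1 HK3)) (negPf (proj2 HK3)).
  rewrite ifN; last by apply/eqP; lia.
  rewrite ifN; last by apply/eqP; lia.
  by rewrite (proj2 (W4 _ Hi)).
Qed.

End CompilePrograms.

(* The first command fills array 3; the result is entry 0 of the last array. *)
Definition compile (cs : seq cmd) : program :=
  let Z0 := 5 + \sum_(c <- cs) (need c.1 + need c.2) in
  let KA := 3 + size cs in
  let P1 := prelude Z0 KA in
  let P2 := comp_cmds Z0 KA 3 (size P1) cs in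
  P1 ++ P2 ++ [:: IConst 1 (Z0 + (size cs).+2); ILoad 0 1].

(** The memory is existentially quantified because the registers above [Z0] hold left-over input:
    only [initial] is known of it. *)
Theorem compileP (cs : seq cmd) (w : seq bool) :
  all (fun c => arrs_ok (3 + size cs) c.1 && arrs_ok (3 + size cs) c.2) cs ->
  exists2 m, initial w m &
    outputs (compile cs) w
      (19 + size cs + 8 * size w + run_cost (3 + size cs) m 3 cs)
      (run m 3 cs (size cs).+2 0).
Proof.
move=> Harr; set P := compile cs.
have : at_code P 0 P by [].
rewrite {2}/P /compile; set Z0 := 5 + _; set KA := 3 + _.
move=> /at_code_cat [H1] /at_code_cat [H2] /at_code_cons [H3] /at_code_cons [H4 _].
have Hok : all (cmd_ok Z0 KA) cs.
  have : 5 + \sum_(c <- cs) (need c.1 + need c.2) <= Z0 by [].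
  have {}Harr : all (fun c => arrs_ok KA c.1 && arrs_ok KA c.2) cs by [].
  elim: (cs) Harr => //= c l IHl /andP[/andP[A1 A2] Hl].
  rewrite big_cons => HZ; rewrite IHl ?andbT //; last lia.
  by rewrite /cmd_ok A1 A2 !andbT; apply/andP; split; lia.
have HZ : 5 <= Z0 by rewrite leq_addr.
have HK : 3 <= KA by rewrite leq_addr.
have [k [mu [Hk Hit Hmu]]] := preludeP w H1 HZ HK.
set m : mem := fun a i => mu (address Z0 KA a i).
exists m => //.
have Hm : mem_ok Z0 KA m mu by [].
have [] := comp_cmdsP H2 (leqnn _) _ Hok Hm; first lia.
move=> k2 [mu2 [Hk2 Hit2 Hmu2]].
exists (2 + (k2 + k)); first by have EK : KA = 3 + size cs by []; lia.
have -> : init w = Config 0 (reg (init w)) by [].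
have SP : size P = size (prelude Z0 KA) +
    (size (comp_cmds Z0 KA 3 (size (prelude Z0 KA)) cs) + 2).
  by rewrite /P /compile !size_cat.
have := Hmu2 (size cs).+2 0; rewrite /address muln0 addn0 => /(_ _) <-; last first.
  by rewrite /KA; lia.
clearbody P KA Z0; rewrite !add0n in H3 H4 Hit2.
rewrite iterD iterD Hit Hit2; rewrite addnA in SP.
move: (_ + size (comp_cmds _ _ _ _ _)) H3 H4 SP => p H3 H4 SP.
have S1 mu' : step P (Config p mu') = Config p.+1 (upd mu' 1 (Z0 + (size cs).+2)).
  by rewrite /step [pc _]/= H3.
have S2 mu' : step P (Config p.+1 mu') = Config p.+2 (upd mu' 0 (mu' (mu' 1))).
  by rewrite /step [pc _]/= H4.
have -> : iter 2 (step P) (Config p mu2) = step P (step P (Config p mu2)) by [].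
rewrite S1 S2 /= /upd /= SP addn2; split=> //.
by rewrite ifN //; apply/eqP; lia.
Qed.

(** * Running times and specifications of programs *)

(* All loops are bounded by global variables, i.e. entries 0 of arrays in g. *)
Definition loop_bound (g : pred nat) (e : expr) : bool :=
  if e is Rd b (Cst 0) then g b else false.

Fixpoint bounded (g : pred nat) (e : expr) : bool :=
  match e with
  | Loc _ | Cst _ => true
  | Rd _ e1 => bounded g e1
  | Add e1 e2 | Sub e1 e2 | Let e1 e2 => bounded g e1 && bounded g e2
  | Ite e0 e1 e2 => [&& bounded g e0, bounded g e1 & bounded g e2]
  | Sum eb e1 => loop_bound g eb && bounded g e1
  | Rec eb e0 e1 => [&& loop_bound g eb, bounded g e0 & bounded g e1]
  end.

(** The [KA + 14] of a loop consists of [KA + 3] for reading its bound, 3 for the set-up and 8 for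
    the administration of a round. *)
Fixpoint esize KA (e : expr) : nat :=
  match e with
  | Loc _ => 2
  | Cst _ => 1
  | Rd _ e1 => esize KA e1 + KA.+2
  | Add e1 e2 | Sub e1 e2 => esize KA e1 + esize KA e2 + 1
  | Ite e0 e1 e2 => esize KA e0 + esize KA e1 + esize KA e2 + 2
  | Let e1 e2 => esize KA e1 + esize KA e2 + 2
  | Sum eb e1 => esize KA e1 + KA + 14
  | Rec eb e0 e1 => esize KA e0 + esize KA e1 + KA + 14
  end.

Fixpoint depth (e : expr) : nat :=
  match e with
  | Loc _ | Cst _ => 0
  | Rd _ e1 => depth e1
  | Add e1 e2 | Sub e1 e2 | Let e1 e2 => maxn (depth e1) (depth e2)
  | Ite e0 e1 e2 => maxn (depth e0) (maxn (depth e1) (depth e2))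
  | Sum eb e1 => (depth e1).+1
  | Rec eb e0 e1 => maxn (depth e0) (depth e1).+1
  end.

Lemma leq_size_depth c s Z d D : 0 < Z -> c <= s * Z ^ d -> d <= D ->
  c <= s * Z ^ D.
Proof.
by move=> HZ Hc Hd; apply: leq_trans Hc _; rewrite leq_mul // leq_pexp2l.
Qed.

Lemma leq_addn_exp c1 c2 s k X : 0 < X -> c1 <= s * X -> c2 <= k -> c1 + c2 <= (s + k) * X.
Proof.
move=> HX H1 H2; rewrite mulnDl leq_add //; apply: leq_trans H2 _.
by rewrite leq_pmulr.
Qed.

(** The numbers of rounds are read from memory and do not depend on [env]. Accumulators may grow
    freely, as every instruction has unit cost. So nesting of depth [d] accounts for at most [Z ^ d]
    rounds. *)
Lemma cost_bounded KA g m Z e : forall env, bounded g e -> 0 < Z ->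
  (forall b, g b -> m b 0 <= Z) -> cost KA m env e <= esize KA e * Z ^ depth e.
Proof.
elim: e => [k|c|a e IHe|e1 IH1 e2 IH2|e1 IH1 e2 IH2|e0 IH0 e1 IH1 e2 IH2|
  e1 IH1 e2 IH2|eb IHb e1 IH1|eb IHb e0 IH0 e1 IH1] env /= Hb HZ Hg //.
- by apply: leq_addn_exp; rewrite ?expn_gt0 ?HZ //; apply: IHe.
- case/andP: Hb => B1 B2; apply: leq_addn_exp; rewrite ?expn_gt0 ?HZ // mulnDl.
  by apply: leq_add; [apply: leq_size_depth HZ (IH1 _ B1 HZ Hg) (leq_maxl _ _)
    |apply: leq_size_depth HZ (IH2 _ B2 HZ Hg) (leq_maxr _ _)].
- case/andP: Hb => B1 B2; apply: leq_addn_exp; rewrite ?expn_gt0 ?HZ // mulnDl.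
  by apply: leq_add; [apply: leq_size_depth HZ (IH1 _ B1 HZ Hg) (leq_maxl _ _)
    |apply: leq_size_depth HZ (IH2 _ B2 HZ Hg) (leq_maxr _ _)].
- case/and3P: Hb => B0 B1 B2; apply: leq_addn_exp; rewrite ?expn_gt0 ?HZ // !mulnDl.
  apply: leq_add; first apply: leq_add.
  + by apply: leq_size_depth HZ (IH0 _ B0 HZ Hg) _; rewrite leq_maxl.
  + by apply: leq_size_depth HZ (IH1 _ B1 HZ Hg) _; rewrite !leq_max leqnn !orbT.
  + by apply: leq_size_depth HZ (IH2 _ B2 HZ Hg) _; rewrite !leq_max leqnn !orbT.
- case/andP: Hb => B1 B2; apply: leq_addn_exp; rewrite ?expn_gt0 ?HZ // mulnDl.
  by apply: leq_add; [apply: leq_size_depth HZ (IH1 _ B1 HZ Hg) (leq_maxl _ _)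
    |apply: leq_size_depth HZ (IH2 _ B2 HZ Hg) (leq_maxr _ _)].
- case/andP: Hb; case: eb IHb => // b [] //= [] // _ HB B1.
  have HX : 0 < Z ^ depth e1 by rewrite expn_gt0 HZ.
  have HS : \sum_(i < m b 0) (cost KA m (val i :: env) e1 + 8) <=
      Z * (esize KA e1 * Z ^ depth e1 + 8).
    apply: leq_trans (_ : \sum_(i < m b 0) (esize KA e1 * Z ^ depth e1 + 8) <= _).
      by apply: leq_sum => i _; rewrite leq_add2r; apply: IH1.
    by rewrite sum_nat_const card_ord leq_mul // Hg.
  rewrite expnS; move: HS HX; move: (Z ^ depth e1) => X HS HX.
  apply: leq_trans (leq_add (leqnn _) HS) _; nia.
- case/and3P: Hb; case: eb IHb => // b [] //= [] // _ HB B0 B1.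
  have HX : 0 < Z ^ depth e1 by rewrite expn_gt0 HZ.
  have HS : \sum_(i < m b 0) (cost KA m [:: val i, iteri i
      (fun i acc => eval m [:: i, acc & env] e1) (eval m env e0) & env] e1 + 8) <= Z * (esize KA e1 * Z ^ depth e1 + 8).
    apply: leq_trans (_ : \sum_(i < m b 0) (esize KA e1 * Z ^ depth e1 + 8) <= _).
      by apply: leq_sum => i _; rewrite leq_add2r; apply: IH1.
    by rewrite sum_nat_const card_ord leq_mul // Hg.
  have H0 := leq_size_depth HZ (IH0 env B0 HZ Hg) (leq_maxl _ (depth e1).+1).
  have H1 : Z * Z ^ depth e1 <= Z ^ maxn (depth e0) (depth e1).+1.
    by rewrite -expnS leq_pexp2l ?leq_maxr.
  move: HS HX H0 H1; move: (Z ^ depth e1) (Z ^ maxn _ _) => X Y HS HX H0 H1.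
  apply: leq_trans (leq_add (leqnn _) HS) _.
  apply: (@leq_trans (esize KA e0 * Y + (esize KA e1 + KA + 14) * (Z * X))).
    move: H0; move: (esize KA e0 * Y) => Q H0.
    have : 0 < Z * X by rewrite muln_gt0 HZ.
    have : Z <= Z * X by rewrite leq_pmulr.
    rewrite mulnDr mulnCA; move: (Z * X) => T; nia.
  rewrite (_ : esize KA e0 + esize KA e1 + KA + 14 =
    esize KA e0 + (esize KA e1 + KA + 14)); last lia.
  by rewrite [in X in _ <= X]mulnDl leq_add2l leq_mul.
Qed.

Lemma fill_other m a B e b i : b != a -> fill m a B e b i = m b i.
Proof.
by rewrite /fill => Hb; elim: B => //= B IH; rewrite /write (negPf Hb) IH.
Qed.

Lemma fill_lt m a B e i : i < B ->
  fill m a B e a i = eval (fill m a i e) [:: i] e.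
Proof.
elim: B => // B IH; rewrite ltnS leq_eqVlt /fill /= => /orP[/eqP->|Hi].
  by rewrite /write !eqxx.
by rewrite /write eqxx ltn_eqF //=; apply: IH.
Qed.

(* The intended contents of the arrays: [Spec a i v] should hold of the entry v
   of array a at i, for i < bnd a. *)
Section Spec.

Variables (KA Z : nat) (G : seq nat) (bnd : nat -> nat) (Spec : nat -> nat -> nat -> Prop).

Definition inv k (m : mem) :=
  forall a, a < k -> forall i, i < bnd a -> Spec a i (m a i).

Definition obligation k (c : cmd) := forall m, inv k m ->
  eval m [::] c.1 = bnd k /\
  forall j, j < bnd k -> (forall i, i < j -> Spec k i (m k i)) ->
    Spec k j (eval m [:: j] c.2).

Definition cmd_size (c : cmd) := esize KA c.1 + 2 + esize KA c.2 + KA + 7.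
Definition cmd_depth (c : cmd) := maxn (depth c.1) (depth c.2).+1.

Definition globals k : pred nat := fun b => (b < k) && (b \in G).

Lemma run_spec cs : forall k m,
  (forall j, j < size cs -> obligation (k + j) (nth (Cst 0, Cst 0) cs j)) ->
  (forall j, j < size cs -> let c := nth (Cst 0, Cst 0) cs j in
    bounded (globals (k + j)) c.1 && bounded (globals (k + j)) c.2) ->
  (forall j, j < size cs -> bnd (k + j) <= Z) ->
  (forall b, b \in G -> 0 < bnd b /\ forall v, Spec b 0 v -> v <= Z) ->
  0 < Z -> inv k m ->
  inv (k + size cs) (run m k cs) /\
  run_cost KA m k cs <= (\sum_(c <- cs) cmd_size c) * Z ^ (\max_(c <- cs) cmd_depth c).
Proof.
elim: cs => [|[eb e] cs IH] k m Hob Hg HB HG HZ Hm.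
  by rewrite addn0; split.
have Hob0 : obligation k (eb, e) by have := Hob 0 isT; rewrite addn0.
have [/= EB He] := Hob0 _ Hm.
have Hfill i : i <= bnd k -> forall a, a < k \/ a = k -> forall j, (a = k -> j < i) -> j < bnd a ->
    Spec a j (fill m k i e a j).
  elim: i => [|i IHi] Hi a [Ha|->] j Hj Hja.
  - by apply: Hm.
  - by have := Hj erefl.
  - by rewrite fill_other ?ltn_eqF //; apply: Hm.
  - have {}Hj := Hj erefl; rewrite fill_lt //.
    (* Entry [j] is computed in the memory [fill m k j e], which agrees with [m] on all arrays below
       [k]; so the obligation applies there. *)
    have [] := Hob0 (fill m k j e).
      by move=> b Hb l Hl; rewrite fill_other ?ltn_eqF //; apply: Hm.
    move=> /= _; apply=> // l Hl.
    case: (ltngtP j i) => Hji; [|lia|].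
      rewrite fill_lt // -(fill_lt m k e (ltn_trans Hl Hji)).
      by apply: (IHi (ltnW Hi) k (or_intror erefl)) => [_|]; apply: ltn_trans Hl _ => //; lia.
    by rewrite Hji; apply: (IHi (ltnW Hi) k (or_intror erefl)); lia.
have Hinv : inv k.+1 (fill m k (bnd k) e).
  move=> a; rewrite ltnS leq_eqVlt => /orP[/eqP Ha|Ha] j Hj.
    by apply: Hfill; [|right| rewrite -Ha|].
  by apply: Hfill; [|left| |] => //; lia.
have [H1 H2] : inv (k.+1 + size cs) (run (fill m k (bnd k) e) k.+1 cs) /\
    run_cost KA (fill m k (bnd k) e) k.+1 cs <=
    (\sum_(c <- cs) cmd_size c) * Z ^ (\max_(c <- cs) cmd_depth c).
  apply: IH => // j Hj.
  - by have := Hob j.+1 Hj; rewrite addnS.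
  - by have := Hg j.+1 Hj; rewrite addnS.
  - by have := HB j.+1 Hj; rewrite addnS.
rewrite /= EB addnS -addSn; split=> //.
rewrite !big_cons mulnDl; apply: leq_add; last first.
  by apply: leq_size_depth HZ H2 (leq_maxr _ _).
apply: (@leq_size_depth _ _ _ (cmd_depth (eb, e))) => //; last exact: leq_maxl.
have /andP[] := Hg 0 isT; rewrite !addn0 /= => G1 G2.
have HK m' : inv k m' -> forall b, globals k b -> m' b 0 <= Z.
  by move=> Hm' b /andP[Hb /HG [Hb0]]; apply; apply: Hm'.
rewrite /cmd_cost /= EB /cmd_size /cmd_depth /=.
set D := maxn _ _; have HX : 0 < Z ^ D by rewrite expn_gt0 HZ.
have C1 : cost KA m [::] eb <= esize KA eb * Z ^ D.
  apply: leq_size_depth HZ (cost_bounded KA [::] G1 HZ (HK _ Hm)) (leq_maxl _ _).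
have C2 : \sum_(i < bnd k) (cost KA (fill m k i e) [:: val i] e + KA + 7) <=
    (esize KA e + KA + 7) * Z ^ D.
  apply: (@leq_trans (\sum_(i < bnd k) (esize KA e + KA + 7) * Z ^ depth e)).
    apply: leq_sum => i _; rewrite -!addnA; apply: leq_addn_exp => //.
      by rewrite expn_gt0 HZ.
    apply: (cost_bounded KA [:: val i] G2 HZ) => b Hb.
    by rewrite fill_other ?HK //; case/andP: Hb => Hb _; rewrite ltn_eqF.
  rewrite sum_nat_const card_ord mulnCA leq_mul //.
  apply: (@leq_trans (Z ^ (depth e).+1)); last by rewrite leq_pexp2l ?leq_maxr.
  rewrite expnS leq_mul //.
  by have := HB 0 isT; rewrite addn0.
move: C1 C2 HX; move: (Z ^ D) (\sum_(i < _) _) => X S; nia.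
Qed.

End Spec.

(** * Derived expressions *)

Fixpoint lift c n (e : expr) : expr :=
  match e with
  | Loc k => Loc (if k < c then k else k + n)
  | Cst x => Cst x
  | Rd a e1 => Rd a (lift c n e1)
  | Add e1 e2 => Add (lift c n e1) (lift c n e2)
  | Sub e1 e2 => Sub (lift c n e1) (lift c n e2)
  | Ite e0 e1 e2 => Ite (lift c n e0) (lift c n e1) (lift c n e2)
  | Let e1 e2 => Let (lift c n e1) (lift c.+1 n e2)
  | Sum eb e1 => Sum (lift c n eb) (lift c.+1 n e1)
  | Rec eb e0 e1 => Rec (lift c n eb) (lift c n e0) (lift c.+2 n e1)
  end.

Lemma eq_iteri n (f g : nat -> nat -> nat) x :
  (forall i y, f i y = g i y) -> iteri n f x = iteri n g x.
Proof. by move=> H; elim: n => //= n ->. Qed.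

Lemma eval_lift m e : forall s1 s2 s3,
  eval m (s1 ++ s2 ++ s3) (lift (size s1) (size s2) e) = eval m (s1 ++ s3) e.
Proof.
elim: e => [k|c|a e IHe|e1 IH1 e2 IH2|e1 IH1 e2 IH2|e0 IH0 e1 IH1 e2 IH2|
  e1 IH1 e2 IH2|eb IHb e1 IH1|eb IHb e0 IH0 e1 IH1] s1 s2 s3 //=;
  rewrite ?IHe ?IH0 ?IHb ?IH1 ?IH2 //.
- rewrite !nth_cat; case: (ltnP k (size s1)) => Hk; first by rewrite Hk.
  rewrite ifN; last by lia.
  by rewrite ifN; [congr nth; lia|lia].
- exact: (IH2 (_ :: s1)).
- by apply: eq_iteri => i y; rewrite (IH1 (i :: s1)).
- by apply: eq_iteri => i y; rewrite (IH1 [:: i, y & s1]).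
Qed.

Definition Gl b := Rd b (Cst 0).
Definition Not e := Ite e (Cst 0) (Cst 1).
Definition And e1 e2 := Ite e1 e2 (Cst 0).
Definition Imp e1 e2 := Ite e1 e2 (Cst 1).
Definition Iff e1 e2 := Ite e1 e2 (Not e2).
Definition Lt e1 e2 := Ite (Sub e2 e1) (Cst 1) (Cst 0).
Definition Le e1 e2 := Ite (Sub e1 e2) (Cst 0) (Cst 1).
Definition Eq e1 e2 := Ite (Add (Sub e1 e2) (Sub e2 e1)) (Cst 0) (Cst 1).
Definition Ex b e := Ite (Sum (Gl b) e) (Cst 1) (Cst 0).
Definition All b e := Ite (Sum (Gl b) (Not e)) (Cst 0) (Cst 1).
Definition Mul b e := Sum (Gl b) (lift 0 1 e).
(** The quotient is found by counting the multiples of the divisor up to the dividend. The count is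
    right as long as the quotient does not exceed the global [g]. *)
Definition Div g b e :=
  Sum (Gl g) (Le (Mul b (Add (Loc 0) (Cst 1))) (lift 0 1 e)).
Definition Mod g b e := Sub e (Mul b (Div g b e)).
(* Splits the index j of a two-dimensional array: the environment of the body
   is [:: j %% d; j %/ d; j] for d the global b. *)
Definition Split g b e := Let (Div g b (Loc 0)) (Let (Mod g b (Loc 1)) e).

(** * Values of the derived expressions *)

Section Eval.

Variable m : mem.

Notation ev env e v := (eval m env e = v).

Lemma ev_rd env a e i v : ev env e i -> m a i = v -> ev env (Rd a e) v.
Proof. by move=> /= ->. Qed.

Lemma ev_add env e1 e2 x y : ev env e1 x -> ev env e2 y ->
  ev env (Add e1 e2) (x + y).
Proof. by move=> /= -> ->. Qed.

Lemma ev_sub env e1 e2 x y : ev env e1 x -> ev env e2 y ->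
  ev env (Sub e1 e2) (x - y).
Proof. by move=> /= -> ->. Qed.

Lemma ev_ite env e0 e1 e2 (p : bool) x y : ev env e0 (p : nat) ->
  (p -> ev env e1 x) -> (~~ p -> ev env e2 y) ->
  ev env (Ite e0 e1 e2) (if p then x else y).
Proof. by move=> /= ->; case: p => /= [-> | _ ->]. Qed.

Lemma ev_ite0 env e0 e1 e2 k x y : ev env e0 k ->
  (k != 0 -> ev env e1 x) -> (k = 0 -> ev env e2 y) ->
  ev env (Ite e0 e1 e2) (if k == 0 then y else x).
Proof. by move=> /= ->; case: eqP => /= [E _ ->|_ -> //]. Qed.

Lemma ev_let env e1 e2 x y : ev env e1 x -> ev (x :: env) e2 y ->
  ev env (Let e1 e2) y.
Proof. by move=> /= -> ->. Qed.

Lemma ev_not env e (p : bool) : ev env e (p : nat) -> ev env (Not e) (~~ p : nat).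
Proof. by move=> /= ->; case: p. Qed.

Lemma ev_and env e1 e2 (p q : bool) : ev env e1 (p : nat) ->
  (p -> ev env e2 (q : nat)) -> ev env (And e1 e2) (p && q : nat).
Proof. by move=> /= ->; case: p => // ->. Qed.

Lemma ev_imp env e1 e2 (p q : bool) : ev env e1 (p : nat) ->
  (p -> ev env e2 (q : nat)) -> ev env (Imp e1 e2) (p ==> q : nat).
Proof. by move=> /= ->; case: p => // ->. Qed.

Lemma ev_iff env e1 e2 (p q : bool) : ev env e1 (p : nat) ->
  ev env e2 (q : nat) -> ev env (Iff e1 e2) ((p == q) : nat).
Proof. by move=> /= -> ->; case: p; case: q. Qed.

Lemma ev_lt env e1 e2 x y : ev env e1 x -> ev env e2 y ->
  ev env (Lt e1 e2) ((x < y) : nat).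
Proof. by move=> /= -> ->; rewrite subn_eq0; case: leqP. Qed.

Lemma ev_le env e1 e2 x y : ev env e1 x -> ev env e2 y ->
  ev env (Le e1 e2) ((x <= y) : nat).
Proof. by move=> /= -> ->; rewrite subn_eq0; case: leqP. Qed.

Lemma ev_eq env e1 e2 x y : ev env e1 x -> ev env e2 y ->
  ev env (Eq e1 e2) ((x == y) : nat).
Proof.
by move=> /= -> ->; rewrite addn_eq0 !subn_eq0 -eqn_leq; case: eqP.
Qed.

Lemma iteri_sum n (f : nat -> nat) :
  iteri n (fun i acc => acc + f i) 0 = \sum_(i < n) f i.
Proof. by elim: n => [|n IH] /=; rewrite ?big_ord0 // big_ord_recr /= IH. Qed.

Lemma ev_sum env b e n (f : nat -> nat) : m b 0 = n ->
  (forall i, i < n -> ev (i :: env) e (f i)) ->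
  ev env (Sum (Gl b) e) (\sum_(i < n) f i).
Proof.
move=> /= -> H; rewrite iteri_sum; apply: eq_bigr => i _; exact: H.
Qed.

Lemma ev_sum_bool env b e n (p : nat -> bool) : m b 0 = n ->
  (forall i, i < n -> ev (i :: env) e (p i : nat)) ->
  ev env (Sum (Gl b) e) (count p (iota 0 n)).
Proof.
move=> Hb H; rewrite (ev_sum Hb H) -(big_mkord xpredT (fun i => (p i : nat))).
by rewrite /index_iota subn0 -sumn_count sumnE big_map.
Qed.

Lemma ev_ex env b e n (p : nat -> bool) : m b 0 = n ->
  (forall i, i < n -> ev (i :: env) e (p i : nat)) ->
  ev env (Ex b e) (has p (iota 0 n) : nat).
Proof.
move=> Hb H; have /= -> := ev_sum_bool Hb H.
by rewrite has_count; case: (count _ _).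
Qed.

Lemma ev_all env b e n (p : nat -> bool) : m b 0 = n ->
  (forall i, i < n -> ev (i :: env) e (p i : nat)) ->
  ev env (All b e) (all p (iota 0 n) : nat).
Proof.
move=> Hb H; have /= -> := @ev_sum_bool env b (Not e) n (fun i => ~~ p i) Hb _.
  rewrite -[all _ _]negbK -has_predC has_count.
  by rewrite (@eq_count _ (predC p) (fun i => ~~ p i)) //; case: (count _ _).
by move=> i Hi; apply: ev_not; apply: H.
Qed.

Lemma ev_lift env x e v : ev env e v -> ev (x :: env) (lift 0 1 e) v.
Proof. by move=> <-; rewrite (eval_lift m e [::] [:: x] env). Qed.

Lemma ev_mul env b e n x : m b 0 = n -> ev env e x -> ev env (Mul b e) (x * n).
Proof.
move=> Hb He; rewrite (@ev_sum env b _ n (fun=> x) Hb).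
  by rewrite sum_nat_const card_ord mulnC.
by move=> i _; apply: ev_lift.
Qed.

Lemma count_lt_iota n k : k <= n -> count (fun i => i < k) (iota 0 n) = k.
Proof.
by move=> Hk; rewrite -(subnKC Hk) iotaD count_cat add0n;
  rewrite (@eq_in_count _ _ xpredT) ?count_predT ?size_iota => [|i];
  [rewrite (@eq_in_count _ _ pred0) ?count_pred0 ?addn0 // => i|];
  rewrite mem_iota => /andP[H1 H2] //=; lia.
Qed.

Lemma ev_div env g b e n d x : m g 0 = n -> m b 0 = d -> ev env e x -> 0 < d ->
  x %/ d <= n -> ev env (Div g b e) (x %/ d).
Proof.
move=> Hg Hb He Hd Hx.
rewrite -[RHS](count_lt_iota Hx); apply: ev_sum_bool => // i Hi.
rewrite (_ : (i < x %/ d) = (i.+1 * d <= x)); last by rewrite -leq_divRL.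
apply: ev_le; last exact: ev_lift.
by apply: ev_mul => //; rewrite /= addn1.
Qed.

Lemma ev_mod env g b e n d x : m g 0 = n -> m b 0 = d -> ev env e x -> 0 < d ->
  x %/ d <= n -> ev env (Mod g b e) (x %% d).
Proof.
move=> Hg Hb He Hd Hx.
apply: etrans (ev_sub He (ev_mul Hb (ev_div Hg Hb He Hd Hx))) _.
by rewrite {1}(divn_eq x d) addKn.
Qed.

Lemma ev_split j g b e n d v : m g 0 = n -> m b 0 = d -> 0 < d -> j %/ d <= n ->
  ev [:: j %% d; j %/ d; j] e v -> ev [:: j] (Split g b e) v.
Proof.
move=> Hg Hb Hd Hj He; apply: ev_let; first exact: (ev_div Hg Hb).
by apply: ev_let He; apply: (ev_mod Hg Hb).
Qed.

End Eval.

(** * Types of vertices *)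

Section Types.

(* A graph on the vertices 0, ..., n - 1, ordered as numbers, together with an
   indexing [nb] of the at most D neighbours of each vertex. *)
Variables (N n D F : nat) (adjn : nat -> nat -> bool) (coln : nat -> nat -> bool)
  (nb : nat -> nat -> nat).

Hypothesis adj_symn : forall x y, adjn x y = adjn y x.
Hypothesis D_gt0 : 0 < D.
Hypothesis nb_lt : forall x i, x < n -> i < D -> nb x i < n.
Hypothesis nb_surj : forall x y, x < n -> y < n -> adjn x y ->
  exists2 i, i < D & nb x i = y.

(* Walks from b are numbered in heap order: the i-th successor of the walk u is
   the walk u * D + i + 1. *)
Fixpoint walk_rec k b u : nat :=
  if k is k'.+1 then
    if u == 0 then b else nb (walk_rec k' b (u.-1 %/ D)) (u.-1 %% D)
  else b.

Definition walk b u := walk_rec u b u.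

Definition W := D.+1 ^ F.

Lemma walk_recE k b u : u <= k -> walk_rec k b u = walk b u.
Proof.
rewrite /walk; elim/ltn_ind: u k => u IH [|k]; first by case: u {IH}.
case: u IH => [|u] //= IH Hk.
have Hu : u %/ D <= u := leq_div u D.
by rewrite !IH //; lia.
Qed.

Lemma walkE b u : u != 0 ->
  walk b u = nb (walk b (u.-1 %/ D)) (u.-1 %% D).
Proof.
case: u => // u _; rewrite {1}/walk /= walk_recE //; exact: leq_div.
Qed.

Lemma walk_child b u i : i < D -> walk b (u * D + i).+1 = nb (walk b u) i.
Proof.
by move=> Hi; rewrite walkE //= divnMDl // divn_small // addn0 modnMDl modn_small.
Qed.

Lemma walk_lt b u : b < n -> walk b u < n.
Proof.
move=> Hb; elim/ltn_ind: u => [[|u]] IH //; rewrite walkE //= nb_lt ?ltn_mod //.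
by apply: IH; rewrite ltnS leq_div.
Qed.

(** Walks of length at most [t] therefore have numbers below [D.+1 ^ t], a convenient substitute for
    the geometric sum; [W] accommodates length [F]. *)
Lemma child_lt u i t : i < D -> u < D.+1 ^ t -> (u * D + i).+1 < D.+1 ^ t.+1.
Proof.
move=> Hi Hu; rewrite expnS; apply: (@leq_ltn_trans (u.+1 * D)).
  by rewrite mulSn; lia.
apply: (@leq_ltn_trans (D.+1 ^ t * D)); first by rewrite leq_mul2r Hu orbT.
by rewrite mulnC ltn_mul2r ltnSn andbT expn_gt0.
Qed.

(** The place of [c] relative to the ball around [b]. Equality with the end of a walk is the case of
    two false booleans. *)
Definition cut b c : {ffun 'I_W -> bool * bool} :=
  [ffun u : 'I_W => (c < walk b u, walk b u < c)].

Definition type0 : finType :=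
  ({ffun 'I_W * 'I_W -> bool * bool} * {ffun 'I_W * 'I_N -> bool})%type.

(** The semantic form of Hintikka formulas: level [k + 1] collects the pairs of a place and a
    [k]-type that occur in the graph. *)
Fixpoint type k : finType :=
  if k is k'.+1 then (type k' * {set {ffun 'I_W -> bool * bool} * type k'})%type
  else type0.

Definition tau0 b : type0 :=
  ([ffun p : 'I_W * 'I_W => (walk b p.1 < walk b p.2, adjn (walk b p.1) (walk b p.2))],
   [ffun p : 'I_W * 'I_N => coln (walk b p.1) p.2]).

Fixpoint tau k b : type k :=
  if k is k'.+1 return type k then
    (tau k' b, [set x in [seq (cut b c, tau k' c) | c <- iota 0 n]])
  else tau0 b.

Lemma tau_le j k b b' : j <= k -> tau k b = tau k b' -> tau j b = tau j b'.
Proof.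
elim: k => [|k IH]; first by rewrite leqn0 => /eqP->.
by rewrite leq_eqVlt => /orP[/eqP-> //|Hj] [E _]; apply: IH.
Qed.

Lemma tau_step k b b' c : tau k.+1 b = tau k.+1 b' -> c < n ->
  exists c', [/\ c' < n, cut b c = cut b' c' & tau k c = tau k c'].
Proof.
move=> [_ E] Hc; have : (cut b c, tau k c) \in
    [set x in [seq (cut b c, tau k c) | c <- iota 0 n]].
  by rewrite inE; apply/mapP; exists c; rewrite // mem_iota.
by rewrite E inE => /mapP[c']; rewrite mem_iota => Hc' [E1 E2]; exists c'.
Qed.

Lemma tauS k b : tau k.+1 b =
  (tau k b, [set x in [seq (cut b c, tau k c) | c <- iota 0 n]]).
Proof. by []. Qed.

(** Expresses equality at level [k + 1] by loops over vertices and equality at level [k]. This is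
    how the program decides it without ever building a type. *)
Lemma tau_stepE k b b' : (tau k.+1 b == tau k.+1 b') =
  [&& tau k b == tau k b',
      all (fun c => has (fun c' => (cut b c == cut b' c') && (tau k c == tau k c'))
        (iota 0 n)) (iota 0 n) &
      all (fun c' => has (fun c => (cut b c == cut b' c') && (tau k c == tau k c'))
        (iota 0 n)) (iota 0 n)].
Proof.
apply/eqP/and3P => [E|[/eqP E1 /allP H1 /allP H2]].
  split; first by case: E => ->.
    apply/allP => c; rewrite mem_iota => Hc.
    have [c' [Hc' -> ->]] := tau_step E Hc.
    by apply/hasP; exists c'; rewrite ?mem_iota ?eqxx.
  apply/allP => c; rewrite mem_iota => Hc.
  have [c' [Hc' -> ->]] := tau_step (esym E) Hc.
  by apply/hasP; exists c'; rewrite ?mem_iota ?eqxx.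
rewrite !tauS E1; congr (_, _); apply/setP => x; rewrite !inE; apply/mapP/mapP => -[c Hc ->].
  by have /hasP[c' Hc' /andP[/eqP -> /eqP ->]] := H1 _ Hc; exists c'.
by have /hasP[c' Hc' /andP[/eqP <- /eqP <-]] := H2 _ Hc; exists c'.
Qed.

Lemma cut_eqE b b' c c' : (cut b c == cut b' c') =
  all (fun u => ((c < walk b u) == (c' < walk b' u)) &&
                ((walk b u < c) == (walk b' u < c'))) (iota 0 W).
Proof.
apply/eqP/allP => [E u|H].
  rewrite mem_iota => Hu; have := congr1 (fun f : {ffun _ -> _} => f (Ordinal Hu)) E.
  by rewrite !ffunE /= => -[-> ->]; rewrite !eqxx.
apply/ffunP => u; rewrite !ffunE.
have Hu : nat_of_ord u \in iota 0 W by rewrite mem_iota /=.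
by have /andP[/eqP -> /eqP ->] := H _ Hu.
Qed.

Lemma tau0_eqE b b' : (tau 0 b == tau 0 b') =
  all (fun u => all (fun u' =>
      ((walk b u < walk b u') == (walk b' u < walk b' u')) &&
      (adjn (walk b u) (walk b u') == adjn (walk b' u) (walk b' u')))
    (iota 0 W)) (iota 0 W) &&
  all (fun u => all (fun l => coln (walk b u) l == coln (walk b' u) l) (iota 0 N))
    (iota 0 W).
Proof.
apply/eqP/andP => [[E1 E2]|[/allP H1 /allP H2]].
  split; apply/allP => u; rewrite mem_iota => Hu; apply/allP => u'; rewrite mem_iota => Hu'.
    have := congr1 (fun f : {ffun _ -> _} => f (Ordinal Hu, Ordinal Hu')) E1.
    by rewrite !ffunE /= => -[-> ->]; rewrite !eqxx.
  have := congr1 (fun f : {ffun _ -> _} => f (Ordinal Hu, Ordinal Hu')) E2.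
  by rewrite !ffunE /= => ->.
congr (_, _); apply/ffunP => -[u u']; rewrite !ffunE /=;
  have Hu : nat_of_ord u \in iota 0 W by rewrite mem_iota /=.
  have Hu' : nat_of_ord u' \in iota 0 W by rewrite mem_iota /=.
  by have /allP/(_ _ Hu')/andP[/eqP -> /eqP ->] := H1 _ Hu.
have Hu' : nat_of_ord u' \in iota 0 N by rewrite mem_iota /=.
by have /allP/(_ _ Hu')/eqP -> := H2 _ Hu.
Qed.

(** * Evaluation in the numbered graph *)

Definition cmpn (c : cmp) (a b : nat) : bool :=
  match c with CEq => a == b | CLt => a < b | CGt => b < a end.

(* Quantifiers over x range over the vertices allowed by [dom x]. *)
Fixpoint nsat (dom : var -> nat -> bool) (v : var -> nat) (phi : formula N) : bool :=
  match phi with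
  | FTrue => true
  | FCol l x => coln (v x) l
  | FAdj x y => adjn (v x) (v y)
  | FCmp c x y => cmpn c (v x) (v y)
  | FNot p => ~~ nsat dom v p
  | FAnd p q => nsat dom v p && nsat dom v q
  | FOr p q => nsat dom v p || nsat dom v q
  | FEx x p => has (fun a => dom x a && nsat dom (fun y => if y == x then a else v y) p)
                   (iota 0 n)
  end.

Fixpoint qrank (phi : formula N) : nat :=
  match phi with
  | FNot p => qrank p
  | FAnd p q | FOr p q => maxn (qrank p) (qrank q)
  | FEx x p => (qrank p).+1
  | _ => 0
  end.

Definition root_var (x : var) : var := (x.1, 0).

(* Assignments v and v' to the variables in S look alike with k quantifiers to
   go. *)
Record sim k (S : {fset var}) (v v' : var -> nat) : Prop := Sim {
  sim_lt : forall w, (w, 0) \in S -> v (w, 0) < n /\ v' (w, 0) < n;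
  sim_tau : forall w, (w, 0) \in S -> tau k (v (w, 0)) = tau k (v' (w, 0));
  sim_walk : forall x, x \in S -> exists2 u, u < D.+1 ^ (F - k) &
    v x = walk (v (root_var x)) u /\ v' x = walk (v' (root_var x)) u;
  sim_cut : forall w a, (rcons w a, 0) \in S ->
    cut (v (w, 0)) (v (rcons w a, 0)) = cut (v' (w, 0)) (v' (rcons w a, 0))
}.

Lemma walk_ltW k u : u < D.+1 ^ (F - k) -> u < W.
Proof.
by move=> Hu; apply: leq_trans Hu _; rewrite leq_pexp2l // leq_subr.
Qed.

Lemma tau_walk k b b' u u' : tau k b = tau k b' -> u < W -> u' < W ->
  [/\ (walk b u < walk b u') = (walk b' u < walk b' u'),
      adjn (walk b u) (walk b u') = adjn (walk b' u) (walk b' u') &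
      forall l, l < N -> coln (walk b u) l = coln (walk b' u) l].
Proof.
move=> /(tau_le (leq0n k)) /eqP; rewrite tau0_eqE => /andP[/allP H1 /allP H2] Hu Hu'.
have Iu : u \in iota 0 W by rewrite mem_iota.
have Iu' : u' \in iota 0 W by rewrite mem_iota.
have /allP/(_ _ Iu')/andP[/eqP-> /eqP->] := H1 _ Iu.
split=> // l Hl; have Il : l \in iota 0 N by rewrite mem_iota.
by have /allP/(_ _ Il)/eqP -> := H2 _ Iu.
Qed.

Lemma cmpn_cong c a b a' b' : (a < b) = (a' < b') -> (b < a) = (b' < a') ->
  cmpn c a b = cmpn c a' b'.
Proof. by case: c => //=; case: (ltngtP a b); case: (ltngtP a' b'). Qed.

Lemma cut_walk b b' c c' u : cut b c = cut b' c' -> u < W ->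
  (c < walk b u) = (c' < walk b' u) /\ (walk b u < c) = (walk b' u < c').
Proof.
move=> /eqP; rewrite cut_eqE => /allP/(_ u); rewrite mem_iota => H Hu.
by have /andP[/eqP-> /eqP->] := H Hu.
Qed.

Lemma valid_root_in S x : valid S -> x \in S -> root_var x \in S.
Proof. by case: x => w [|i] [H _] // Hx; apply: (H w i.+1 0). Qed.

(** Three kinds of atoms stay inside one cluster, hence inside the ball of its root, whose type
    decides them; the fourth compares a child root with the parent cluster, which is what [sim_cut]
    controls. *)
Lemma sim_atom k S v v' p dom : sim k S v v' -> valid S -> CFO_atom S p ->
  nsat dom v p = nsat dom v' p.
Proof.
move=> [Hlt Ht Hw Hc] HS [l x Sx|w i j Si Sj|c w i j Si Sj|c w a i Sa Si] /=.
- have [u Hu [-> ->]] := Hw _ Sx; have Hr := valid_root_in HS Sx.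
  by have [_ _ ->] := tau_walk (Ht _ Hr) (walk_ltW Hu) (walk_ltW Hu).
- have [u Hu [-> ->]] := Hw _ Si; have [u' Hu' [-> ->]] := Hw _ Sj.
  have Hr := valid_root_in HS Si.
  by have [_ -> _] := tau_walk (Ht _ Hr) (walk_ltW Hu) (walk_ltW Hu').
- have [u Hu [-> ->]] := Hw _ Si; have [u' Hu' [-> ->]] := Hw _ Sj.
  have Hr := valid_root_in HS Si; apply: cmpn_cong.
    by have [-> _ _] := tau_walk (Ht _ Hr) (walk_ltW Hu) (walk_ltW Hu').
  by have [-> _ _] := tau_walk (Ht _ Hr) (walk_ltW Hu') (walk_ltW Hu).
- have [u Hu [-> ->]] := Hw _ Si.
  have [H1 H2] := cut_walk (Hc _ _ Sa) (walk_ltW Hu); exact: cmpn_cong.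
Qed.

Lemma sim_sym k S v v' : sim k S v v' -> sim k S v' v.
Proof.
move=> [H1 H2 H3 H4]; split=> [w Hw|w Hw|x Hx|w a Hw].
- by have [] := H1 _ Hw.
- by rewrite H2.
- by have [u Hu [E1 E2]] := H3 _ Hx; exists u.
- by rewrite H4.
Qed.

Definition assign (v : var -> nat) x c : var -> nat :=
  fun y => if y == x then c else v y.

(** By validity no child of the new root is in [S] yet, so the only new cut is the one by its
    parent. *)
Lemma sim_add_root k S v v' w0 c c' : valid S -> (w0, 0) \notin S ->
  sim k.+1 S v v' -> c < n -> c' < n -> tau k c = tau k c' ->
  (forall w a, w0 = rcons w a -> (w, 0) \in S /\ cut (v (w, 0)) c = cut (v' (w, 0)) c') ->
  sim k ((w0, 0) |` S)%fset (assign v (w0, 0) c) (assign v' (w0, 0) c').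
Proof.
move=> HS Sx [H1 H2 H3 H4] Hc Hc' Ht Hcut.
have ne y : y \in S -> (y == (w0, 0)) = false.
  by move=> Hy; apply/negP => /eqP E; rewrite -E Hy in Sx.
split=> [w|w|x|w a]; rewrite in_fset1U /assign => /orP[/eqP|] Hw.
- by rewrite Hw eqxx.
- by rewrite ne //; apply: H1.
- by rewrite Hw eqxx.
- by rewrite ne //; apply: (tau_le (leqnSn k)); apply: H2.
- by exists 0; rewrite ?expn_gt0 // Hw eqxx.
- have Hr := valid_root_in HS Hw; rewrite !ne //.
  have [u Hu E] := H3 _ Hw; exists u => //.
  by apply: leq_trans Hu _; rewrite leq_pexp2l // leq_sub2l.
- case: Hw => E; have [Hr Hcc] := Hcut _ _ (esym E).
  by rewrite E eqxx ne.
- have [_ HS2] := HS; rewrite !ne //; first exact: H4.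
  exact: HS2 Hw.
Qed.

(** Roots, and with them types and cuts, stay as they are. One more step of a walk is paid for by
    one rank, so all walk numbers remain below [D.+1 ^ (F - k)]. *)
Lemma sim_add_nbr k S v v' w i j u0 i0 : valid S -> (w, i) \notin S ->
  (w, j) \in S -> i != 0 -> k < F -> sim k.+1 S v v' -> i0 < D -> u0 < D.+1 ^ (F - k.+1) ->
  sim k ((w, i) |` S)%fset
    (assign v (w, i) (walk (v (w, 0)) (u0 * D + i0).+1))
    (assign v' (w, i) (walk (v' (w, 0)) (u0 * D + i0).+1)).
Proof.
move=> HS Sx Sj Hi Hk [H1 H2 H3 H4] Hi0 Hu0.
have ne y : y \in S -> (y == (w, i)) = false.
  by move=> Hy; apply/negP => /eqP E; rewrite -E Hy in Sx.
have nei w' : ((w', 0) == (w, i)) = false.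
  by apply/negP => /eqP[_ E]; rewrite -E in Hi.
split=> [w'|w'|x|w' a]; rewrite in_fset1U /assign /root_var ?nei //=.
- exact: H1.
- by move=> /H2 /(tau_le (leqnSn k)).
- case/orP=> [/eqP ->|Hx].
    by exists (u0 * D + i0).+1; rewrite ?eqxx // (_ : F - k = (F - k.+1).+1) ?child_lt //; lia.
  have [u Hu E] := H3 _ Hx; exists u; last by rewrite ne.
  by apply: leq_trans Hu _; rewrite leq_pexp2l // leq_sub2l.
- exact: H4.
Qed.

Definition domT (x : var) (c : nat) := true.

Lemma nbr_index S w i j : valid S -> (w, j) \in S -> (w, i) \notin S -> i != 0.
Proof.
move=> HS Sj Si; apply/eqP => E; move: Si.
by rewrite E -[(w, 0)]/(root_var (w, j)) valid_root_in.
Qed.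

(** An Ehrenfeucht-Fraisse argument. The first root is answered by itself, a child root through
    [tau_step] at its parent root, and a neighbour by the walk of the same number from the other
    root. *)
Lemma sim_nsat kk S phi : CFO kk S phi -> forall k v v', valid S ->
  qrank phi <= k -> k <= F -> sim k S v v' ->
  nsat domT v phi = nsat domT v' phi.
Proof.
elim=> {kk S phi} [kk S p Hp|//|kk S p _ IH|kk S p q _ IHp _ IHq|
  kk S p q _ IHp _ IHq|kk p _ IH|kk S w a p Sw Sx _ IH|
  kk S w i j p Sj Sx Si _ IH] k v v' HS Hq HkF Hsim.
- exact: sim_atom Hsim HS Hp.
- by rewrite /= (IH _ _ _ HS Hq HkF Hsim).
- rewrite /= geq_max in Hq; case/andP: Hq => Hp Hq.
  by rewrite /= (IHp _ _ _ HS Hp HkF Hsim) (IHq _ _ _ HS Hq HkF Hsim).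
- rewrite /= geq_max in Hq; case/andP: Hq => Hp Hq.
  by rewrite /= (IHp _ _ _ HS Hp HkF Hsim) (IHq _ _ _ HS Hq HkF Hsim).
- case: k Hq HkF Hsim => // k Hq HkF Hsim /=.
  apply: eq_in_has => c; rewrite mem_iota => Hc.
  apply: (IH k); rewrite ?(ltnW HkF) //; first exact: valid_root.
  have -> : [fset ([::] : seq nat, 0)]%fset = (([::], 0) |` fset0)%fset.
    by apply/fsetP => x; rewrite !inE orbF.
  by apply: sim_add_root => //; case.
- case: k Hq HkF Hsim => // k Hq HkF Hsim /=.
  suff one v1 v2 : sim k.+1 S v1 v2 ->
    has (fun c => nsat domT (assign v1 (rcons w a, 0) c) p) (iota 0 n) ->
    has (fun c => nsat domT (assign v2 (rcons w a, 0) c) p) (iota 0 n).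
    by apply/idP/idP; apply: one => //; apply: sim_sym.
  move=> Hs /hasP[c]; rewrite mem_iota => Hc Hp.
  have [c' [Hc' E1 E2]] := tau_step (sim_tau Hs Sw) Hc.
  apply/hasP; exists c'; first by rewrite mem_iota.
  rewrite -(IH k (assign v1 (rcons w a, 0) c)) ?(ltnW HkF) //; first exact: valid_child.
  by apply: sim_add_root => // w' a' /rcons_inj[<- _].
- case: k Hq HkF Hsim => // k Hq HkF Hsim /=; rewrite /= max0n in Hq.
  have Hi := nbr_index HS Sj Sx.
  have Hr : (w, 0) \in S := valid_root_in HS Sj.
  have neij : ((w, j) == (w, i)) = false.
    by apply/negP => /eqP E; rewrite -E Sj in Sx.
  suff one v1 v2 : sim k.+1 S v1 v2 ->
    has (fun c => adjn c (v1 (w, j)) && nsat domT (assign v1 (w, i) c) p) (iota 0 n) ->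
    has (fun c => adjn c (v2 (w, j)) && nsat domT (assign v2 (w, i) c) p) (iota 0 n).
    by rewrite !eqxx neij; apply/idP/idP; apply: one => //; apply: sim_sym.
  move=> Hs /hasP[c]; rewrite mem_iota => Hc /andP[Hadj Hp].
  have [H1 H1'] := sim_lt Hs Hr.
  have [u Hu [E1 E2]] := sim_walk Hs Sj; rewrite /root_var /= in E1 E2.
  have Hn1 : v1 (w, j) < n by rewrite E1 walk_lt.
  rewrite adj_symn in Hadj.
  have [i0 Hi0 Ei0] := nb_surj Hn1 Hc Hadj.
  have Ec : c = walk (v1 (w, 0)) (u * D + i0).+1 by rewrite walk_child // -E1 Ei0.
  have Hu' : (u * D + i0).+1 < D.+1 ^ (F - k).
    by rewrite (_ : F - k = (F - k.+1).+1) ?child_lt //; lia.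
  apply/hasP; exists (walk (v2 (w, 0)) (u * D + i0).+1).
    by rewrite mem_iota walk_lt.
  apply/andP; split.
    rewrite E2; have [_ <- _] := tau_walk (sim_tau Hs Hr) (walk_ltW Hu') (walk_ltW Hu).
    by rewrite -Ec -E1 adj_symn.
  rewrite -(IH k (assign v1 (w, i) c)) ?(ltnW HkF) //; first exact: valid_nbr Sj Si.
  by rewrite Ec; apply: sim_add_nbr Hs _ _ => //; exact: Sj.
Qed.

(** * Representatives *)

(* c is the least vertex of its type that lies in the same place relative to
   the walks from q. *)
Definition rep q c : bool :=
  ~~ has (fun c' => (c' < c) && ((cut q c' == cut q c) && (tau F c' == tau F c)))
      (iota 0 n).

(** The vertex 0 is an arbitrary anchor, relative to which the first root is chosen like all others;
    the root of cluster [w] thus gets level [(size w).+1]. *)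
Fixpoint mark t c : bool :=
  if t is t'.+1 then has (fun q => mark t' q && rep q c) (iota 0 n) else c == 0.

Lemma rep_exists q c : c < n ->
  exists c', [/\ c' < n, rep q c', cut q c' = cut q c & tau F c' = tau F c].
Proof.
move=> Hc; have H : exists c', (cut q c' == cut q c) && (tau F c' == tau F c).
  by exists c; rewrite !eqxx.
case: (ex_minnP H) => c' /andP[/eqP E1 /eqP E2] Hmin; exists c'; split=> //.
  by apply: leq_ltn_trans Hc; apply: Hmin; rewrite !eqxx.
apply/hasPn => d _; rewrite E1 E2; apply/negP => /andP[Hd /Hmin].
by rewrite leqNgt Hd.
Qed.

(** A vertex on a walk from [q] is alone in its place. So each level contains the balls around all
    vertices of the previous one, which takes care of the neighbour variables and makes the marks
    increase with the level. *)
Lemma rep_walk q u : u < W -> rep q (walk q u).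
Proof.
move=> Hu; apply/hasPn => c _; apply/negP => /andP[Hc /andP[/eqP E _]].
by have [] := cut_walk E Hu; rewrite ltnn Hc.
Qed.

Lemma W_gt0 : 0 < W. Proof. by rewrite expn_gt0. Qed.

Lemma mark_step t q c : q < n -> mark t q -> rep q c -> mark t.+1 c.
Proof.
move=> Hq Hm Hr; apply/hasP; exists q; first by rewrite mem_iota.
by apply/andP; split.
Qed.

Lemma mark_le t t' q : q < n -> t <= t' -> mark t q -> mark t' q.
Proof.
move=> Hq; elim: t' => [|t' IH]; first by rewrite leqn0 => /eqP->.
rewrite leq_eqVlt => /orP[/eqP-> //|Ht] /(IH Ht) Hm.
by apply: mark_step Hm _ => //; apply: (rep_walk q W_gt0).
Qed.

(** A neighbour variable is on a walk from the root of its cluster, hence one level above it. *)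
Definition level (x : var) : nat := size x.1 + 1 + (x.2 != 0).

Definition domL (x : var) (c : nat) := mark (level x) c.

Record good k (S : {fset var}) (v : var -> nat) : Prop := Good {
  good_root : forall w, (w, 0) \in S -> v (w, 0) < n /\ mark (size w).+1 (v (w, 0));
  good_walk : forall x, x \in S -> exists2 u, u < D.+1 ^ (F - k) &
    v x = walk (v (root_var x)) u
}.

Lemma good_sim k S v : good k S v -> sim k S v v.
Proof.
move=> [H1 H2]; split=> // [w Hw|x Hx]; first by have [] := H1 _ Hw.
by have [u Hu E] := H2 _ Hx; exists u.
Qed.

Lemma good_add_root k S v w0 c : valid S -> (w0, 0) \notin S ->
  good k.+1 S v -> c < n -> mark (size w0).+1 c ->
  good k ((w0, 0) |` S)%fset (assign v (w0, 0) c).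
Proof.
move=> HS Sx [H1 H2] Hc Hm.
have ne y : y \in S -> (y == (w0, 0)) = false.
  by move=> Hy; apply/negP => /eqP E; rewrite -E Hy in Sx.
split=> [w|x]; rewrite in_fset1U /assign => /orP[/eqP|] Hw.
- by case: Hw => ->; rewrite eqxx.
- by rewrite ne //; apply: H1.
- by exists 0; rewrite ?expn_gt0 // Hw eqxx.
- have Hr := valid_root_in HS Hw; rewrite !ne //.
  have [u Hu E] := H2 _ Hw; exists u => //.
  by apply: leq_trans Hu _; rewrite leq_pexp2l // leq_sub2l.
Qed.

Lemma good_add_nbr k S v w i j c : valid S -> (w, i) \notin S ->
  (w, j) \in S -> i != 0 -> k < F -> good k.+1 S v -> c < n -> adjn c (v (w, j)) ->
  good k ((w, i) |` S)%fset (assign v (w, i) c) /\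
  exists2 u, u < D.+1 ^ (F - k) & c = walk (v (w, 0)) u.
Proof.
move=> HS Sx Sj Hi Hk [H1 H2] Hc Hadj.
have Hr : (w, 0) \in S := valid_root_in HS Sj.
have [u Hu E1] := H2 _ Sj; rewrite /root_var /= in E1.
have Hn1 : v (w, j) < n by rewrite E1 walk_lt //; case: (H1 _ Hr).
rewrite adj_symn in Hadj.
have [i0 Hi0 Ei0] := nb_surj Hn1 Hc Hadj.
have Ec : c = walk (v (w, 0)) (u * D + i0).+1 by rewrite walk_child // -E1 Ei0.
have Hu' : (u * D + i0).+1 < D.+1 ^ (F - k).
  by rewrite (_ : F - k = (F - k.+1).+1) ?child_lt //; lia.
split; last by exists (u * D + i0).+1.
have ne y : y \in S -> (y == (w, i)) = false.
  by move=> Hy; apply/negP => /eqP E; rewrite -E Hy in Sx.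
have nei w' : ((w', 0) == (w, i)) = false.
  by apply/negP => /eqP[_ E]; rewrite -E in Hi.
split=> [w'|x]; rewrite in_fset1U /assign /root_var ?nei //=; first exact: H1.
case/orP=> [/eqP ->|Hx]; first by exists (u * D + i0).+1; rewrite ?eqxx.
have [u1 Hu1 E] := H2 _ Hx; exists u1; last by rewrite ne.
by apply: leq_trans Hu1 _; rewrite leq_pexp2l // leq_sub2l.
Qed.

(** A witness for a root is exchanged for the representative of its place and type, and by
    [sim_nsat] the rest of the formula cannot tell them apart. A witness for a neighbour lies on a
    short walk from a marked root and is marked already. *)
Lemma nsat_domL kk S phi : CFO kk S phi -> forall k v, valid S ->
  qrank phi <= k -> k <= F -> good k S v -> nsat domL v phi = nsat domT v phi.
Proof.
elim=> {kk S phi} [kk S p Hp|//|kk S p _ IH|kk S p q _ IHp _ IHq|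
  kk S p q _ IHp _ IHq|kk p Hp IH|kk S w a p Sw Sx Hp IH|
  kk S w i j p Sj Sx Si Hp IH] k v HS Hq HkF Hg.
- by case: Hp.
- by rewrite /= (IH _ _ HS Hq HkF Hg).
- rewrite /= geq_max in Hq; case/andP: Hq => Hp Hq.
  by rewrite /= (IHp _ _ HS Hp HkF Hg) (IHq _ _ HS Hq HkF Hg).
- rewrite /= geq_max in Hq; case/andP: Hq => Hp Hq.
  by rewrite /= (IHp _ _ HS Hp HkF Hg) (IHq _ _ HS Hq HkF Hg).
- case: k Hq HkF Hg => // k Hq HkF Hg /=; have HkF' := ltnW HkF.
  have E0 : [fset ([::] : seq nat, 0)]%fset = (([::], 0) |` fset0)%fset.
    by apply/fsetP => x; rewrite !inE orbF.
  have IH' c : c < n -> mark 1 c ->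
      nsat domL (assign v ([::], 0) c) p = nsat domT (assign v ([::], 0) c) p.
    move=> Hc Hm; apply: (IH k) => //; first exact: valid_root.
    by rewrite E0; apply: good_add_root.
  apply/hasP/hasP => -[c]; rewrite mem_iota => Hc.
    by move=> /andP[Hm Hs]; exists c; rewrite ?mem_iota // -IH'.
  move=> /= Hs; have [c' [Hc' Hr Ec Et]] := rep_exists 0 Hc.
  have Hm : mark 1 c' by apply: (@mark_step 0 0) => //; apply: leq_ltn_trans Hc.
  exists c'; first by rewrite mem_iota.
  rewrite [domL _ _]Hm /= IH' //.
  rewrite -(sim_nsat Hp (k := k) (v := assign v ([::], 0) c)) //; first exact: valid_root.
  rewrite E0; apply: sim_add_root (good_sim Hg) _ _ _ _ => //; last by case.
  by apply: tau_le (esym Et).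
- case: k Hq HkF Hg => // k Hq HkF Hg /=; have HkF' := ltnW HkF.
  set x := (rcons w a, 0).
  have IH' c : c < n -> mark (size (rcons w a)).+1 c ->
      nsat domL (assign v x c) p = nsat domT (assign v x c) p.
    move=> Hc Hm; apply: (IH k) => //; first exact: valid_child.
    exact: good_add_root.
  have Elev : level x = (size (rcons w a)).+1 by rewrite /level /= addn0 addn1.
  have [Hwn Hwm] := good_root Hg Sw.
  apply/hasP/hasP => -[c]; rewrite mem_iota => Hc.
    by move=> /andP[]; rewrite /domL Elev => Hm Hs; exists c; rewrite ?mem_iota // -IH'.
  move=> /= Hs; have [c' [Hc' Hr Ec Et]] := rep_exists (v (w, 0)) Hc.
  have Hm : mark (size (rcons w a)).+1 c'.
    by rewrite size_rcons; apply: mark_step Hwm Hr.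
  exists c'; first by rewrite mem_iota.
  rewrite /domL Elev Hm /= IH' //.
  rewrite -(sim_nsat Hp (k := k) (v := assign v x c)) //; first exact: valid_child.
  apply: sim_add_root (good_sim Hg) _ _ _ _ => //; first by apply: tau_le (esym Et).
  by move=> w' a' /rcons_inj[<- _].
- case: k Hq HkF Hg => // k Hq HkF Hg /=; have HkF' := ltnW HkF.
  rewrite /= max0n in Hq; have Hi := nbr_index HS Sj Sx.
  have neij : ((w, j) == (w, i)) = false.
    by apply/negP => /eqP E; rewrite -E Sj in Sx.
  rewrite !eqxx neij; apply: eq_in_has => c; rewrite mem_iota => Hc.
  case Hadj: (adjn c _); last by rewrite andbF.
  have [Hg' [u Hu Ec]] := good_add_nbr HS Sx Sj Hi HkF Hg Hc Hadj.
  have [Hwn Hwm] := good_root Hg (valid_root_in HS Sj).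
  have Hl : level (w, i) = (size w).+2 by rewrite /level /= Hi !addn1.
  have Hm : mark (size w).+2 c.
    by rewrite Ec; apply: mark_step Hwn Hwm (rep_walk _ (walk_ltW Hu)).
  have -> : domL (w, i) c by rewrite /domL Hl.
  by apply: (IH k) => //; exact: valid_nbr Sj Si.
Qed.

(** The start counts two bits for each pair of walks and one for each walk and colour. The power set
    at each level produces a tower of exponentials in [k]. *)
Definition ntypes k := iteri k (fun _ x => x * 2 ^ (4 ^ W * x)) (4 ^ (W * W) * 2 ^ (W * N)).
Definition nreps := 4 ^ W * ntypes F.

Lemma card_set_type (T : finType) : #|{set T}| = 2 ^ #|T|.
Proof. by rewrite -(cardsT {: {set T}}) -powersetT card_powerset cardsT. Qed.

Lemma card_type k : #|type k| = ntypes k.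
Proof.
elim: k => [|k IH]; first by rewrite card_prod !card_ffun !card_prod card_bool !card_ord.
by rewrite card_prod card_set_type card_prod card_ffun !card_prod card_bool card_ord IH.
Qed.

(** Two representatives with the same place and type would both be least in their class. The bound
    is therefore the number of pairs of a place and a type, free of [n]. *)
Lemma count_rep q : count (rep q) (iota 0 n) <= nreps.
Proof.
rewrite -size_filter -(size_map (fun c => (cut q c, tau F c))).
have -> : nreps = #|{: {ffun 'I_W -> bool * bool} * type F}|.
  by rewrite card_prod card_ffun card_prod card_bool card_ord card_type.
rewrite cardE; apply: uniq_leq_size => [|x _]; last by rewrite mem_enum.
rewrite map_inj_in_uniq ?filter_uniq ?iota_uniq // => c c'.
rewrite !mem_filter !mem_iota => /andP[Hr Hc] /andP[Hr' Hc'] [E1 E2].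
have H d d' : d < n -> rep q d' -> cut q d = cut q d' -> tau F d = tau F d' -> d' <= d.
  move=> Hd /hasPn Hd' F1 F2; rewrite leqNgt; apply/negP => Hdd.
  by have := Hd' d; rewrite mem_iota Hd Hdd F1 F2 !eqxx => /(_ isT).
apply/eqP; rewrite eqn_leq (H c' c Hc' Hr (esym E1) (esym E2)).
exact: (H c c' Hc Hr' E1 E2).
Qed.

Lemma count_has (A : pred nat) (B : nat -> pred nat) s l R :
  (forall q, count (B q) l <= R) ->
  count (fun c => has (fun q => A q && B q c) s) l <= count A s * R.
Proof.
move=> HB; elim: s => [|q s IH] /=; first by rewrite count_pred0.
apply: (@leq_trans (count (fun c => A q && B q c) l + count A s * R)).
  apply: leq_trans (leq_add (leqnn _) IH).
  by rewrite -count_predUI leq_addr.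
rewrite mulnDl leq_add2r; case: (A q); last by rewrite count_pred0.
by rewrite mul1n; apply: HB.
Qed.

Lemma count_mark t : count (mark t) (iota 0 n) <= nreps ^ t.
Proof.
elim: t => [|t IH]; last first.
  rewrite expnSr; apply: leq_trans (count_has _ _ count_rep) _.
  by rewrite leq_mul2r IH orbT.
rewrite (@eq_count _ _ (pred1 0)) // count_uniq_mem ?iota_uniq //.
by case: (_ \in _).
Qed.

End Types.

(** * The model-checking program *)

(* Arrays: 3 the input bits; 4 D; 5 N; 6 n; 7 n * n; 8 the position of the
   formula; 9 its length F; 10 its tokens; 11 neighbours; 12 W; 13 walks;
   14 equality of types; 15 marks; 16 the number M of marked vertices; 17 the
   marked vertices; 18 powers of M; 19 M ^ F; 20 quotients by powers of M;
   21 ends of subformulas; 22 identifiers of variables; 23 truth values;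
   24 the result.  Arrays with two indices i, j < b are stored at i * b + j.
   Assignments to marked vertices are coded by numbers below M ^ F in base M,
   the identifier of a variable being the position of its digit.  The arrays 21
   and 23 are indexed by the distance from the end of the formula, so that
   subformulas are treated first. *)

Fixpoint switch e k (es : seq expr) : expr :=
  if es is e1 :: es' then Ite (Eq e (Cst k)) e1 (switch e k.+1 es') else Cst 0.

(** The table lists the four bits for each of the 16 values of [pack w]. The later bits are shifted
    by one, since register 0 of the input holds the length. *)
Definition e_bits := Ite (Lt (Loc 0) (Cst 4))
  (switch (Gl 2) 0 [seq switch (Loc 0) 0
    [:: Cst (p %/ 8 %% 2); Cst (p %/ 4 %% 2); Cst (p %/ 2 %% 2); Cst (p %% 2)]
    | p <- iota 0 16])
  (Rd 0 (Add (Loc 0) (Cst 1))).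

(** The word begins with [n] ones and a zero, so [n] is the length of the initial run of ones. *)
Definition e_n := Sum (Gl 1) (All 1 (Imp (Le (Loc 0) (Loc 1)) (Rd 3 (Loc 0)))).
Definition e_start := Add (Add (Add (Gl 6) (Cst 1)) (Gl 7)) (Mul 5 (Gl 6)).
(** In the unary code, token [p] is the number of ones with exactly [p] zeros before them. *)
Definition e_tok := Sum (Gl 9) (And (Rd 3 (Add (Gl 8) (Loc 0)))
  (Eq (Loc 1) (Sum (Gl 9) (And (Lt (Loc 0) (Loc 1)) (Not (Rd 3 (Add (Gl 8) (Loc 0)))))))).

Definition Adj x y := Rd 3 (Add (Add (Add (Gl 6) (Cst 1)) (Mul 6 x)) y).
Definition Col x l :=
  Rd 3 (Add (Add (Add (Add (Gl 6) (Cst 1)) (Gl 7)) (Mul 5 x)) l).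

(** The count yields [n] if there are too few neighbours; the vertex itself is stored then, so that
    walks of every number stay in the graph. *)
Definition e_nb := Split 6 4 (Let
  (Sum (Gl 6) (Le (Sum (Gl 6) (And (Le (Loc 0) (Loc 1)) (Adj (Loc 3) (Loc 0)))) (Loc 1)))
  (Ite (Lt (Loc 0) (Gl 6)) (Loc 0) (Loc 2))).

Definition e_W := Rec (Gl 9) (Cst 1) (Add (Mul 4 (Loc 1)) (Loc 1)).

Definition Walk b u := Rd 13 (Add (Mul 12 b) u).

Definition e_walk := Split 6 12 (Ite (Loc 0)
  (Let (Div 12 4 (Sub (Loc 0) (Cst 1))) (Let (Mod 12 4 (Sub (Loc 1) (Cst 1)))
    (Rd 11 (Add (Mul 4 (Walk (Loc 3) (Loc 1))) (Loc 0)))))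
  (Loc 1)).

Definition SameType k b c := Rd 14 (Add (Add (Mul 7 k) (Mul 6 b)) c).

Definition SameCut b c b' c' := All 12 (And
  (Iff (Lt (Loc c.+1) (Walk (Loc b.+1) (Loc 0))) (Lt (Loc c'.+1) (Walk (Loc b'.+1) (Loc 0))))
  (Iff (Lt (Walk (Loc b.+1) (Loc 0)) (Loc c.+1)) (Lt (Walk (Loc b'.+1) (Loc 0)) (Loc c'.+1)))).

(** The two branches transcribe [tau_stepE] and [tau0_eqE]. *)
Definition e_type := Split 9 7 (Let (Div 6 6 (Loc 0)) (Let (Mod 6 6 (Loc 1))
  (Ite (Loc 3)
    (And (SameType (Sub (Loc 3) (Cst 1)) (Loc 1) (Loc 0))
      (And (All 6 (Ex 6 (And (SameCut 3 1 2 0) (SameType (Sub (Loc 5) (Cst 1)) (Loc 1) (Loc 0)))))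
           (All 6 (Ex 6 (And (SameCut 3 0 2 1) (SameType (Sub (Loc 5) (Cst 1)) (Loc 0) (Loc 1)))))))
    (And (All 12 (All 12 (And
        (Iff (Lt (Walk (Loc 3) (Loc 1)) (Walk (Loc 3) (Loc 0)))
             (Lt (Walk (Loc 2) (Loc 1)) (Walk (Loc 2) (Loc 0))))
        (Iff (Adj (Walk (Loc 3) (Loc 1)) (Walk (Loc 3) (Loc 0)))
             (Adj (Walk (Loc 2) (Loc 1)) (Walk (Loc 2) (Loc 0)))))))
      (All 12 (All 5 (Iff (Col (Walk (Loc 3) (Loc 1)) (Loc 0))
                          (Col (Walk (Loc 2) (Loc 1)) (Loc 0))))))))).

Definition Mark t c := Rd 15 (Add (Mul 6 t) c).

Definition e_mark := Split 9 6 (Ite (Loc 1)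
  (Ex 6 (And (Mark (Sub (Loc 2) (Cst 1)) (Loc 0))
    (Not (Ex 6 (And (Lt (Loc 0) (Loc 2))
      (And (SameCut 1 0 1 2) (SameType (Gl 9) (Loc 0) (Loc 2))))))))
  (Eq (Loc 0) (Cst 0))).

Definition e_marked := Sum (Gl 6)
  (Le (Sum (Gl 6) (And (Le (Loc 0) (Loc 1)) (Mark (Gl 9) (Loc 0)))) (Loc 1)).

Definition e_pow := Ite (Loc 0) (Mul 16 (Rd 18 (Sub (Loc 0) (Cst 1)))) (Cst 1).

Definition Quot x al := Rd 20 (Add (Mul 19 x) al).

Definition e_quot := Split 9 19 (Ite (Loc 1)
  (Div 19 16 (Quot (Sub (Loc 1) (Cst 1)) (Loc 0))) (Loc 0)).

Definition Rev e := Sub (Sub (Gl 9) (Cst 1)) e.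
Definition Tok p := Rd 10 p.
(** A variable takes the length of its word, the letters and the index, hence two tokens more than
    letters. *)
Definition VarEnd p := Add p (Add (Tok p) (Cst 2)).
Definition End p := Rd 21 (Rev p).
Definition Plus k c := Add (Loc k) (Cst c).

Definition e_end := Let (Rev (Loc 0)) (switch (Tok (Loc 0)) 0
  [:: Plus 0 1; VarEnd (Plus 0 2); Let (VarEnd (Plus 0 1)) (VarEnd (Loc 0));
      Let (VarEnd (Plus 0 2)) (VarEnd (Loc 0)); End (Plus 0 1);
      End (End (Plus 0 1)); End (End (Plus 0 1)); End (VarEnd (Plus 0 1))]).

Definition e_id := Sum (Gl 9) (Not (Ex 9 (And (Le (Loc 0) (Loc 1))
  (All 9 (Imp (Lt (Loc 0) (Add (Tok (Loc 3)) (Cst 2)))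
              (Eq (Tok (Add (Loc 1) (Loc 0))) (Tok (Add (Loc 3) (Loc 0))))))))).

Definition Digit x al := Mod 19 16 (Quot x al).
Definition Value p al := Rd 17 (Digit (Rd 22 p) al).
(** [Mul] only multiplies by a global. Here neither factor is one, but the first is at most [M], so
    a loop of [M] rounds suffices. *)
Definition MulM e1 e2 :=
  Sum (Gl 16) (Ite (Lt (Loc 0) (lift 0 1 e1)) (lift 0 1 e2) (Cst 0)).
Definition Update x al m :=
  Sub (Add al (MulM m (Rd 18 x))) (MulM (Digit x al) (Rd 18 x)).
Definition Val p al := Rd 23 (Add (Mul 19 (Rev p)) al).

(** Below the switch [Loc 0] is the position and [Loc 1] the coded assignment. In the case of a
    quantifier the first argument of [Mark] computes [level]: the first token of a variable is the
    length of its word, the last one its index. *)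
Definition e_val := Split 9 19 (Let (Rev (Loc 1)) (switch (Tok (Loc 0)) 0
  [:: Cst 1;
      Col (Value (Plus 0 2) (Loc 1)) (Tok (Plus 0 1));
      Adj (Value (Plus 0 1) (Loc 1)) (Value (VarEnd (Plus 0 1)) (Loc 1));
      Let (Value (Plus 0 2) (Loc 1)) (Let (Value (VarEnd (Plus 1 2)) (Loc 2))
        (switch (Tok (Plus 2 1)) 0 [:: Eq (Loc 1) (Loc 0); Lt (Loc 1) (Loc 0);
                                       Lt (Loc 0) (Loc 1)]));
      Not (Val (Plus 0 1) (Loc 1));
      And (Val (Plus 0 1) (Loc 1)) (Val (End (Plus 0 1)) (Loc 1));
      Ite (Val (Plus 0 1) (Loc 1)) (Cst 1) (Val (End (Plus 0 1)) (Loc 1));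
      Let (VarEnd (Plus 0 1)) (Ex 16 (And
        (Mark (Add (Add (Tok (Plus 2 1)) (Cst 1))
                   (Ite (Tok (Sub (Loc 1) (Cst 1))) (Cst 1) (Cst 0)))
              (Rd 17 (Loc 0)))
        (Val (Loc 1) (Update (Rd 22 (Plus 2 1)) (Loc 3) (Loc 0)))))])).

(** The token array is twice as long as the formula because [e_id] reads it at sums of two numbers
    below [F]. *)
Definition checker (N D : nat) : seq cmd :=
  [:: (Gl 1, e_bits); (Cst 1, Cst D); (Cst 1, Cst N); (Cst 1, e_n);
      (Cst 1, Mul 6 (Gl 6)); (Cst 1, e_start); (Cst 1, Sub (Gl 1) (Gl 8));
      (Add (Gl 9) (Gl 9), e_tok); (Mul 4 (Gl 6), e_nb); (Cst 1, e_W);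
      (Mul 12 (Gl 6), e_walk); (Add (Mul 7 (Gl 9)) (Gl 7), e_type);
      (Add (Mul 6 (Gl 9)) (Gl 6), e_mark);
      (Cst 1, Sum (Gl 6) (Mark (Gl 9) (Loc 0))); (Gl 16, e_marked);
      (Add (Gl 9) (Cst 1), e_pow); (Cst 1, Rd 18 (Gl 9));
      (Add (Mul 19 (Gl 9)) (Gl 19), e_quot); (Gl 9, e_end); (Gl 9, e_id);
      (Mul 19 (Gl 9), e_val); (Cst 1, Val (Cst 0) (Cst 0))].

Lemma ev_switch m env e es : forall k x v, eval m env e = k + x -> x < size es ->
  eval m env (nth (Cst 0) es x) = v -> eval m env (switch e k es) = v.
Proof.
elim: es => // e1 es IH k [|x] v He Hx Hv /=; rewrite He.
  by rewrite addn0 subnn.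
rewrite (_ : k + x.+1 - k + (k - (k + x.+1)) = x.+1) /=; last by lia.
by apply: (IH k.+1 x) => //; rewrite He addnS.
Qed.

(** * The arrays for input, walks, types and marks *)

Section Obligations.

Variables (w : seq bool) (N n D F : nat) (adjn coln : nat -> nat -> bool) (m : mem).

Let bit i := nth false w i.
Let start := n.+1 + n * n + n * N.

Hypothesis D_gt0 : 0 < D.
Hypothesis n_gt0 : 0 < n.
Hypothesis w_ones : forall i, i < n -> bit i.
Hypothesis w_zero : bit n = false.
Hypothesis w_size : size w = start + F.
Hypothesis w_adj : forall x y, x < n -> y < n -> bit (n.+1 + x * n + y) = adjn x y.
Hypothesis w_col : forall x l, x < n -> l < N -> bit (n.+1 + n * n + x * N + l) = coln x l.

(* The (i + 1)-th vertex satisfying p; it is n if there is none. *)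
Definition select (p : pred nat) i :=
  count (fun y => count (fun z => (z <= y) && p z) (iota 0 n) <= i) (iota 0 n).

Definition nbf x i := if select (adjn x) i < n then select (adjn x) i else x.

Notation walk := (walk D nbf).
Notation W := (W D F).
Notation cut := (cut D F nbf).
Notation tau := (tau N n D F adjn coln nbf).
Notation mark := (mark N n D F adjn coln nbf).

Definition tokf p := count (fun i => bit (start + i) &&
  (p == count (fun j => (j < i) && ~~ bit (start + j)) (iota 0 F))) (iota 0 F).

Hypothesis H0 : forall i, 4 <= i -> i < size w -> m 0 i.+1 = bit i.
Hypothesis H1 : m 1 0 = size w.
Hypothesis H2 : m 2 0 = pack w.

Lemma ev_bits j : j < size w -> eval m [:: j] e_bits = bit j.
Proof.
rewrite /e_bits => Hj.
have -> : (bit j : nat) = if j < 4 then (bit j : nat) else bit j by case: ifP.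
apply: ev_ite => [|Hj4|Hj4]; first exact: ev_lt.
  apply: (@ev_switch _ _ _ _ 0 (pack w)); first exact: H2.
    by rewrite size_map size_iota /pack; do 4 case: nth.
  rewrite (nth_map 0) ?size_iota; last by rewrite /pack; do 4 case: nth.
  rewrite nth_iota; last by rewrite /pack; do 4 case: nth.
  rewrite add0n; apply: (@ev_switch _ _ _ _ 0 j) => //.
  rewrite /pack /bit; case: j Hj Hj4 => [|[|[|[|j]]]] //= _ _; do 4 case: nth; by [].
by apply: ev_rd (H0 _ Hj); [rewrite /= addn1|lia].
Qed.

Hypothesis H3 : forall i, i < size w -> m 3 i = bit i.
Hypothesis H4 : m 4 0 = D.
Hypothesis H5 : m 5 0 = N.

Lemma size_w_n : n < size w.
Proof. by rewrite w_size /start; lia. Qed.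

Lemma ev_n : eval m [:: 0] e_n = n.
Proof.
rewrite /e_n; apply: etrans (_ : count (fun i => all (fun i' => (i' <= i) ==> bit i')
  (iota 0 (size w))) (iota 0 (size w)) = _).
  apply: ev_sum_bool => // i Hi; apply: ev_all => // i' Hi'.
  by apply: ev_imp => [|_]; [apply: ev_le|apply: ev_rd (H3 Hi')].
rewrite -[RHS](count_lt_iota (ltnW size_w_n)); apply: eq_in_count => i.
rewrite mem_iota => Hi; apply/allP/idP => [H|Hin i' _].
  rewrite ltnNge; apply/negP => Hni; have := H n.
  by rewrite mem_iota size_w_n w_zero Hni => /(_ isT).
by apply/implyP => Hii; apply: w_ones; lia.
Qed.

Hypothesis H6 : m 6 0 = n.

Lemma ev_sq env : eval m env (Mul 6 (Gl 6)) = n * n.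
Proof. exact: ev_mul. Qed.

Hypothesis H7 : m 7 0 = n * n.

Lemma ev_start env : eval m env e_start = start.
Proof.
rewrite /e_start /start; apply: ev_add; last exact: ev_mul.
by apply: ev_add; [rewrite /= H6 addn1|exact: H7].
Qed.

Hypothesis H8 : m 8 0 = start.

Lemma ev_F env : eval m env (Sub (Gl 1) (Gl 8)) = F.
Proof. by rewrite /= H1 H8 w_size addKn. Qed.

Hypothesis H9 : m 9 0 = F.

Lemma ev_tok p : eval m [:: p] e_tok = tokf p.
Proof.
rewrite /e_tok /tokf; have Hb env i k : i < F -> nth 0 env k = i ->
    eval m env (Rd 3 (Add (Gl 8) (Loc k))) = bit (start + i).
  by move=> Hi Hk; rewrite -H3 /= ?Hk ?H8 // w_size ltn_add2l.
apply: ev_sum_bool => // i Hi; apply: ev_and => [|_]; first exact: Hb.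
apply: ev_eq => //; apply: ev_sum_bool => // j Hj; apply: ev_and => [|_].
  exact: ev_lt.
by apply: ev_not; apply: Hb.
Qed.

Lemma ev_Adj env x y vx vy : eval m env x = vx -> eval m env y = vy ->
  vx < n -> vy < n -> eval m env (Adj x y) = adjn vx vy.
Proof.
move=> Hx Hy Hxn Hyn; rewrite -w_adj //; apply: ev_rd (H3 _).
  apply: ev_add Hy; apply: ev_add; last exact: ev_mul.
  by rewrite /= H6 addn1.
rewrite w_size /start; apply: (@leq_trans (n.+1 + n * n)); last by lia.
rewrite -addnA ltn_add2l; apply: (@leq_trans (vx * n + n)); first by lia.
by rewrite -mulSnr leq_mul2r Hxn orbT.
Qed.

Lemma ev_Col env x l vx vl : eval m env x = vx -> eval m env l = vl ->
  vx < n -> vl < N -> eval m env (Col x l) = coln vx vl.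
Proof.
move=> Hx Hl Hxn HlN; rewrite -w_col //; apply: ev_rd (H3 _).
  apply: ev_add Hl; apply: ev_add; last exact: ev_mul.
  by apply: ev_add; [rewrite /= H6 addn1|exact: H7].
rewrite w_size /start; apply: (@leq_trans (n.+1 + n * n + n * N)); last by lia.
rewrite -[X in X < _]addnA ltn_add2l; apply: (@leq_trans (vx * N + N)); first by lia.
by rewrite -mulSnr leq_mul2r Hxn orbT.
Qed.

Lemma divn_lt j a b : 0 < b -> j < a * b -> j %/ b < a.
Proof. by move=> Hb; rewrite ltn_divLR. Qed.

Lemma ev_nb j : j < n * D -> eval m [:: j] e_nb = nbf (j %/ D) (j %% D).
Proof.
move=> Hj; have Hx := divn_lt D_gt0 Hj; apply: (ev_split H6 H4) => //; first exact: ltnW.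
apply: (ev_let (x := select (adjn (j %/ D)) (j %% D))).
  apply: ev_sum_bool => // y Hy; apply: ev_le => //.
  apply: ev_sum_bool => // z Hz; apply: ev_and => [|_]; first exact: ev_le.
  exact: ev_Adj.
by apply: ev_ite => //; apply: ev_lt => //; exact: H6.
Qed.

Lemma ev_W env : eval m env e_W = W.
Proof.
have -> : W = D.+1 ^ F by [].
rewrite /e_W [LHS]/= H9; elim: (F) => //= k ->.
rewrite H4 iteri_sum sum_nat_const card_ord expnS; lia.
Qed.

Hypothesis H10 : forall p, p < F + F -> m 10 p = tokf p.
Hypothesis H11 : forall x i, x < n -> i < D -> m 11 (x * D + i) = nbf x i.
Hypothesis H12 : m 12 0 = W.

Lemma nbf_lt x i : x < n -> nbf x i < n.
Proof. by rewrite /nbf; case: ifP. Qed.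

Lemma ev_walk j : j < n * W ->
  (forall b u, b < n -> u < W -> b * W + u < j -> m 13 (b * W + u) = walk b u) ->
  eval m [:: j] e_walk = walk (j %/ W) (j %% W).
Proof.
have HW : 0 < W by apply: W_gt0.
move=> Hj IH; have Hx := divn_lt HW Hj.
apply: (ev_split H6 H12) => //; first exact: ltnW.
set u := j %% W; set b := j %/ W.
have -> : walk b u = if u == 0 then b else nbf (walk b (u.-1 %/ D)) (u.-1 %% D).
  by case: eqP => [->//|/eqP Hu]; rewrite walkE.
have Hu : u < W by rewrite ltn_mod.
apply: ev_ite0 => // Hu0.
have Hv : u.-1 %/ D <= W by apply: leq_trans (leq_div _ _) _; lia.
have Hvu : u.-1 %/ D < u by have := leq_div u.-1 D; lia.
apply: (ev_let (x := u.-1 %/ D)).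
  by apply: (ev_div H12 H4) => //; rewrite /= subn1.
apply: (ev_let (x := u.-1 %% D)).
  by apply: (ev_mod H12 H4) => //; rewrite /= subn1.
apply: ev_rd (H11 _ _); last by rewrite ltn_mod.
  apply: ev_add => //; apply: ev_mul => //.
  apply: ev_rd (IH b _ Hx _ _) => //; last 2 first.
  - by apply: ltn_trans Hu.
  - by rewrite [X in _ < X](divn_eq j W) ltn_add2l.
  by apply: ev_add => //; apply: ev_mul.
by apply: walk_lt => // x i Hxn _; apply: nbf_lt.
Qed.

Hypothesis H13 : forall b u, b < n -> u < W -> m 13 (b * W + u) = walk b u.

Lemma walkf_lt b u : b < n -> walk b u < n.
Proof. by apply: walk_lt => // x i Hxn _; apply: nbf_lt. Qed.

Lemma ev_Walk env b u vb vu : eval m env b = vb -> eval m env u = vu ->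
  vb < n -> vu < W -> eval m env (Walk b u) = walk vb vu.
Proof.
move=> Hb Hu Hbn HuW; apply: ev_rd (H13 Hbn HuW).
by apply: ev_add => //; apply: ev_mul.
Qed.

Lemma ev_SameCut env b c b' c' :
  nth 0 env b < n -> nth 0 env b' < n ->
  eval m env (SameCut b c b' c') =
  (cut (nth 0 env b) (nth 0 env c) == cut (nth 0 env b') (nth 0 env c')).
Proof.
move=> Hb Hb'; rewrite cut_eqE; apply: ev_all => // u Hu; apply: ev_and => [|_].
  by apply: ev_iff; apply: ev_lt => //; exact: ev_Walk.
by apply: ev_iff; apply: ev_lt => //; exact: ev_Walk.
Qed.

Section SameType.

Variable good : nat -> Prop.
Hypothesis H14 : forall k b c, k <= F -> b < n -> c < n ->
  good (k * (n * n) + b * n + c) ->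
  m 14 (k * (n * n) + b * n + c) = (tau k b == tau k c).

(** The predicate [good] singles out the available entries of array 14: those below [j] while it is
    being filled, all of them later. *)
Lemma ev_SameType env ek eb ec k b c :
  eval m env ek = k -> eval m env eb = b -> eval m env ec = c ->
  k <= F -> b < n -> c < n -> good (k * (n * n) + b * n + c) ->
  eval m env (SameType ek eb ec) = (tau k b == tau k c).
Proof.
move=> Hk Hb Hc HkF Hbn Hcn Hg; apply: ev_rd (H14 HkF Hbn Hcn Hg).
by apply: ev_add => //; apply: ev_add; apply: ev_mul.
Qed.

End SameType.

Lemma ev_type j : j < F.+1 * (n * n) ->
  (forall k b c, k <= F -> b < n -> c < n -> k * (n * n) + b * n + c < j ->
    m 14 (k * (n * n) + b * n + c) = (tau k b == tau k c)) ->
  eval m [:: j] e_type =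
  (tau (j %/ (n * n)) (j %% (n * n) %/ n) == tau (j %/ (n * n)) (j %% (n * n) %% n)).
Proof.
have Hnn : 0 < n * n by rewrite muln_gt0 n_gt0.
move=> Hj IH; have Hk := divn_lt Hnn Hj; rewrite ltnS in Hk.
apply: (ev_split H9 H7) => //.
set k := j %/ (n * n); set r := j %% (n * n).
have Hr : r < n * n by rewrite ltn_mod.
have Hb := divn_lt n_gt0 Hr.
apply: (ev_let (x := r %/ n)); first by apply: (ev_div H6 H6) => //; apply: ltnW.
apply: (ev_let (x := r %% n)); first by apply: (ev_mod H6 H6) => //; apply: ltnW.
set b := r %/ n in Hb *; set c := r %% n.
have Hc : c < n by rewrite ltn_mod.
(* All indices of level [k - 1] are below [k * (n * n)], hence below [j]. *)
have Hlt x y : k != 0 -> x < n -> y < n -> k.-1 * (n * n) + x * n + y < j.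
  move=> Hk0 Hx Hy; rewrite [X in _ < X](divn_eq j (n * n)) -/k.
  apply: (@leq_trans (k * (n * n))); last by rewrite leq_addr.
  rewrite -[in X in _ <= X](prednK (n := k)) ?lt0n // mulSnr -addnA ltn_add2l.
  apply: (@leq_trans (x * n + n)); first by lia.
  by rewrite -mulSnr leq_mul2r Hx orbT.
have ST env ek eb ec x y : k != 0 -> eval m env ek = k.-1 -> eval m env eb = x ->
    eval m env ec = y -> x < n -> y < n ->
    eval m env (SameType ek eb ec) = (tau k.-1 x == tau k.-1 y).
  move=> Hk0 E1 E2 E3 Hx Hy; apply: (ev_SameType (good := fun i => i < j) IH E1 E2 E3) => //; last exact: Hlt.
  by rewrite (leq_trans (leq_pred _)).
have -> : (tau k b == tau k c : nat) = if k == 0 then (tau 0 b == tau 0 c : nat) else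
    (tau k.-1.+1 b == tau k.-1.+1 c).
  by case: (k).
apply: ev_ite0 => // Hk0.
  rewrite tau_stepE; apply: ev_and => [|_]; first by apply: ST => //; rewrite /= subn1.
  apply: ev_and => [|_]; apply: ev_all => // x Hx; apply: ev_ex => // y Hy;
    (apply: ev_and => [|_]; [exact: ev_SameCut|by apply: ST => //; rewrite /= subn1]).
rewrite tau0_eqE; apply: ev_and => [|_]; apply: ev_all => // u Hu; apply: ev_all => // u' Hu'.
  apply: ev_and => [|_]; apply: ev_iff.
  - by apply: ev_lt; apply: ev_Walk.
  - by apply: ev_lt; apply: ev_Walk.
  - by apply: ev_Adj; rewrite ?walkf_lt //; apply: ev_Walk.
  - by apply: ev_Adj; rewrite ?walkf_lt //; apply: ev_Walk.
by apply: ev_iff; apply: ev_Col; rewrite ?walkf_lt //; apply: ev_Walk.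
Qed.

Hypothesis H14 : forall k b c, k <= F -> b < n -> c < n ->
  m 14 (k * (n * n) + b * n + c) = (tau k b == tau k c).

Section Mark.

Variable good : nat -> Prop.
Hypothesis H15 : forall t c, t <= F -> c < n -> good (t * n + c) ->
  m 15 (t * n + c) = mark t c.

Lemma ev_Mark env et ec t c : eval m env et = t -> eval m env ec = c ->
  t <= F -> c < n -> good (t * n + c) -> eval m env (Mark et ec) = mark t c.
Proof.
move=> Ht Hc HtF Hcn Hg; apply: ev_rd (H15 HtF Hcn Hg).
by apply: ev_add => //; apply: ev_mul.
Qed.

End Mark.

Lemma ev_mark j : j < F.+1 * n ->
  (forall t c, t <= F -> c < n -> t * n + c < j -> m 15 (t * n + c) = mark t c) ->
  eval m [:: j] e_mark = mark (j %/ n) (j %% n).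
Proof.
move=> Hj IH; have Ht := divn_lt n_gt0 Hj; rewrite ltnS in Ht.
apply: (ev_split H9 H6) => //.
set t := j %/ n; set c := j %% n.
have -> : (mark t c : nat) = if t == 0 then (mark 0 c : nat) else mark t.-1.+1 c.
  by case: (t).
have Hc : c < n by rewrite ltn_mod.
apply: ev_ite0 => // Ht0; last exact: ev_eq.
apply: ev_ex => // q Hq; apply: ev_and => [|_].
  apply: (ev_Mark (good := fun i => i < j) IH) => //; first by rewrite /= subn1.
    by rewrite (leq_trans (leq_pred _)).
  rewrite [X in _ < X](divn_eq j n) -/t -/c.
  rewrite -[in X in _ < X](prednK (n := t)) ?lt0n // mulSnr; lia.
apply: ev_not; apply: ev_ex => // c' Hc'; apply: ev_and => [|_]; first exact: ev_lt.
apply: ev_and => [|_]; first exact: ev_SameCut.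
by apply: (ev_SameType (good := fun=> True)) => // k x y *; apply: H14.
Qed.

End Obligations.

(** * Tokens, digits and selection *)

Lemma count_ltn (p : pred nat) i k : i <= k ->
  count (fun j => (j < i) && p j) (iota 0 k) = count p (iota 0 i).
Proof.
move=> Hi; rewrite -(subnKC Hi) iotaD count_cat add0n.
rewrite (@eq_in_count _ _ p) => [|j]; last by rewrite mem_iota => /= ->.
rewrite (@eq_in_count _ _ pred0 (iota i (k - i))) ?count_pred0 ?addn0 // => j.
by rewrite mem_iota => /andP[Hj _] /=; rewrite ltnNge Hj.
Qed.

(** Induction on the list: the first block of ones has no zero before it, and behind the zero that
    closes it all counts of zeros go up by one. *)
Lemma token_unary (l : seq nat) p (b := unary l) :
  count (fun i => nth false b i &&
    (p == count (fun j => (j < i) && ~~ nth false b j) (iota 0 (size b))))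
    (iota 0 (size b)) = nth 0 l p.
Proof.
rewrite {}/b; pose z b i := count (fun j => ~~ nth false b j) (iota 0 i).
rewrite (@eq_in_count _ _ (fun i => nth false (unary l) i && (p == z (unary l) i)));
  last by move=> i; rewrite mem_iota => /andP[_ Hi]; rewrite count_ltn // ltnW.
elim: l p => [|k l IH] p; first by rewrite nth_nil.
set b := unary (k :: l).
have Eb : b = nseq k true ++ false :: unary l by rewrite /b /unary /= cat_rcons.
have N1 i : i < k -> nth false b i.
  by move=> Hi; rewrite Eb nth_cat size_nseq Hi nth_nseq Hi.
have N2 : nth false b k = false by rewrite Eb nth_cat size_nseq ltnn subnn.
have N3 i : nth false b (k + i.+1) = nth false (unary l) i.
  by rewrite Eb nth_cat size_nseq ltnNge leq_addr /= addKn.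
have Z1 i : i <= k -> z b i = 0.
  move=> Hi; rewrite /z (@eq_in_count _ _ pred0) ?count_pred0 // => j.
  by rewrite mem_iota => /andP[_ Hj]; rewrite N1 //; apply: leq_trans Hj Hi.
have Z3 i : z b (k + i.+1) = (z (unary l) i).+1.
  rewrite /z iotaD count_cat -/(z b k) Z1 // add0n /= N2 /= add1n -[k.+1]addn1.
  congr _.+1; rewrite -[k + 1]addn0 iotaDl count_map.
  by apply: eq_count => j /=; rewrite -addnA add1n N3.
rewrite (_ : size b = k + (size (unary l)).+1); last by rewrite Eb size_cat size_nseq.
rewrite iotaD count_cat /= add0n N2 /= add0n -[k.+1]addn0 iotaDl count_map.
rewrite (@eq_in_count _ _ (fun=> p == 0) (iota 0 k)); last first.
  by move=> i; rewrite mem_iota => /andP[_ Hi]; rewrite N1 // Z1 ?(ltnW Hi) // .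
case: p => [|p].
  rewrite count_predT size_iota (@eq_count _ _ pred0) ?count_pred0 ?addn0 // => i /=.
  by rewrite addSnnS Z3 andbF.
rewrite (@eq_count _ (fun=> p.+1 == 0) pred0) // count_pred0 add0n.
rewrite [RHS]/= -IH; apply: eq_count => i /=.
by rewrite addSnnS N3 Z3.
Qed.

Lemma size_unary (l : seq nat) : size l <= size (unary l).
Proof.
elim: l => // k l IH; rewrite /unary /= size_cat size_rcons size_nseq.
by rewrite addSn ltnS (leq_trans IH) // leq_addl.
Qed.

Section Digits.

Variables M : nat.
Hypothesis M_gt0 : 0 < M.

Definition digit x al := al %/ M ^ x %% M.
Definition update x al d := al + d * M ^ x - digit x al * M ^ x.

Lemma digitS x al : digit x.+1 al = digit x (al %/ M).
Proof. by rewrite /digit expnS divnMA. Qed.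

Lemma digit_lt x al : digit x al < M. Proof. by rewrite ltn_mod. Qed.

Lemma digit_mul_le x al : digit x al * M ^ x <= al.
Proof.
apply: (@leq_trans (al %/ M ^ x * M ^ x)); last exact: leq_divM.
by rewrite leq_mul2r leq_mod orbT.
Qed.

Lemma update0 al d : update 0 al d = al %/ M * M + d.
Proof.
rewrite /update /digit expn0 divn1 !muln1 {1}(divn_eq al M).
by rewrite addnAC addnK.
Qed.

(** Splitting off the last digit commutes with writing a higher one. The facts on [update] thus
    follow by induction on the position from the case of [update0]. *)
Lemma updateS x al d : update x.+1 al d = update x (al %/ M) d * M + al %% M.
Proof.
rewrite /update digitS expnSr !mulnA mulnBl mulnDl.
have H := digit_mul_le x (al %/ M).
have H' : digit x (al %/ M) * M ^ x * M <= al %/ M * M by rewrite leq_mul2r H orbT.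
by rewrite {1}(divn_eq al M); move: H'; generalize (digit x (al %/ M) * M ^ x * M); lia.
Qed.

Lemma update_lt x al d V : x < V -> al < M ^ V -> d < M -> update x al d < M ^ V.
Proof.
have key a r V' : a < M ^ V' -> r < M -> a * M + r < M ^ V'.+1.
  move=> Ha Hr; apply: (@leq_trans (a * M + M)); first by rewrite ltn_add2l.
  by rewrite -mulSnr expnSr leq_mul2r Ha orbT.
elim: x al V => [|x IH] al [|V] // Hx Hal Hd.
  by rewrite update0 key // ltn_divLR // -expnSr.
by rewrite updateS key ?ltn_mod // IH // ltn_divLR // -expnSr.
Qed.

Lemma digit_update x al d y : d < M ->
  digit y (update x al d) = if y == x then d else digit y al.
Proof.
move=> Hd; elim: x y al => [|x IH] [|y] al.
- by rewrite update0 /digit expn0 divn1 modnMDl modn_small.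
- by rewrite update0 !digitS divnMDl // (divn_small Hd) addn0.
- by rewrite updateS /digit expn0 !divn1 modnMDl modn_mod.
- by rewrite updateS !digitS divnMDl // (divn_small (ltn_pmod al M_gt0)) addn0 IH.
Qed.

End Digits.

Section Select.

Variables (n : nat) (p : pred nat).

Let rank y := count (fun z => (z <= y) && p z) (iota 0 n).

Lemma rankE y : y < n -> rank y = count p (iota 0 y.+1).
Proof. by move=> Hy; rewrite /rank -(count_ltn p Hy). Qed.

Lemma count_iota_le i k : i <= k -> count p (iota 0 i) <= count p (iota 0 k).
Proof. by move=> Hi; rewrite -(subnKC Hi) iotaD count_cat leq_addr. Qed.

(** The rank exceeds the number of elements before [y] from [y] on and not earlier, so exactly the
    [y] smaller numbers are counted. *)
Lemma select_count y : y < n -> p y -> select n p (count p (iota 0 y)) = y.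
Proof.
move=> Hy Hp; rewrite /select -[RHS](count_lt_iota (ltnW Hy)).
apply: eq_in_count => z; rewrite mem_iota => /= Hz.
rewrite -/(rank z) rankE //.
case: (ltnP z y) => Hzy; first by rewrite count_iota_le.
have Hzy' : y.+1 <= z.+1 by [].
have := count_iota_le Hzy'.
by rewrite -{1}addn1 iotaD count_cat /= Hp; lia.
Qed.

Lemma count_lt y : y < n -> p y -> count p (iota 0 y) < count p (iota 0 n).
Proof.
move=> Hy Hp; apply: leq_trans (count_iota_le Hy).
by rewrite -[in X in _ <= X]addn1 iotaD count_cat /= Hp; lia.
Qed.

Lemma select_lt i : i < count p (iota 0 n) -> select n p i < n.
Proof.
move=> Hi; have Hn : 0 < n by rewrite lt0n; apply/eqP => E; rewrite E in Hi.
rewrite -[X in _ < X](size_iota 0 n) -(count_predC (fun y => rank y <= i)).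
rewrite -[X in X < _]addn0 ltn_add2l -has_count; apply/hasP; exists n.-1.
  by rewrite mem_iota /= prednK.
by rewrite /= -ltnNge rankE ?prednK.
Qed.

End Select.

(** * Evaluation of the formula *)

Section Formula.

Variables (N n F M : nat) (adjn coln mk : nat -> nat -> bool) (m : mem) (tk : seq nat).

Let MV := M ^ F.

Hypothesis n_gt0 : 0 < n.
Hypothesis M_gt0 : 0 < M.
Hypothesis ME : M = count (mk F) (iota 0 n).
Hypothesis mk_le : forall c t t', c < n -> t <= t' -> mk t c -> mk t' c.
Hypothesis tkF : size tk <= F.
Hypothesis evAdj : forall env x y vx vy, eval m env x = vx -> eval m env y = vy ->
  vx < n -> vy < n -> eval m env (Adj x y) = adjn vx vy.
Hypothesis evCol : forall env x l vx vl, eval m env x = vx -> eval m env l = vl ->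
  vx < n -> vl < N -> eval m env (Col x l) = coln vx vl.
Hypothesis H6 : m 6 0 = n.
Hypothesis H9 : m 9 0 = F.
Hypothesis H10 : forall p, p < F + F -> m 10 p = nth 0 tk p.
Hypothesis H15 : forall t c, t <= F -> c < n -> m 15 (t * n + c) = mk t c.

Lemma ev_mk env et ec t c : eval m env et = t -> eval m env ec = c ->
  t <= F -> c < n -> eval m env (Mark et ec) = mk t c.
Proof.
move=> Ht Hc HtF Hcn; apply: ev_rd (H15 HtF Hcn).
by apply: ev_add => //; apply: ev_mul.
Qed.

Lemma ev_M env : eval m env (Sum (Gl 6) (Mark (Gl 9) (Loc 0))) = M.
Proof. by rewrite ME; apply: ev_sum_bool => // c Hc; apply: ev_mk. Qed.

Hypothesis H16 : m 16 0 = M.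

Definition marked i := select n (mk F) i.

Lemma ev_marked i : eval m [:: i] e_marked = marked i.
Proof.
rewrite /e_marked /marked /select; apply: ev_sum_bool => // y Hy; apply: ev_le => //.
apply: ev_sum_bool => // z Hz; apply: ev_and => [|_]; first exact: ev_le.
exact: ev_mk.
Qed.

Lemma marked_lt i : i < M -> marked i < n.
Proof. by rewrite ME; apply: select_lt. Qed.

Lemma ev_pow j : j < F.+1 -> (forall i, i < j -> m 18 i = M ^ i) ->
  eval m [:: j] e_pow = M ^ j.
Proof.
move=> Hj IH; have -> : M ^ j = if j == 0 then 1 else M ^ j.-1 * M.
  by case: (j) => // k; rewrite expnSr.
apply: ev_ite0 => // Hj0; apply: ev_mul => //.
by apply: ev_rd (IH j.-1 _); [rewrite /= subn1|lia].
Qed.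

Hypothesis H17 : forall i, i < M -> m 17 i = marked i.
Hypothesis H18 : forall i, i <= F -> m 18 i = M ^ i.

Lemma ev_MV env : eval m env (Rd 18 (Gl 9)) = MV.
Proof. by apply: ev_rd (H18 (leqnn F)). Qed.

Hypothesis H19 : m 19 0 = MV.

Lemma MV_gt0 : 0 < MV. Proof. by rewrite expn_gt0 M_gt0. Qed.

Lemma ev_quot j : j < F.+1 * MV ->
  (forall x al, x <= F -> al < MV -> x * MV + al < j -> m 20 (x * MV + al) = al %/ M ^ x) ->
  eval m [:: j] e_quot = j %% MV %/ M ^ (j %/ MV).
Proof.
move=> Hj IH; have Hx := divn_lt MV_gt0 Hj; rewrite ltnS in Hx.
apply: (ev_split H9 H19) => //; first exact: MV_gt0.
have Hal : j %% MV < MV by rewrite ltn_mod MV_gt0.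
set x := j %/ MV in Hx *; set al := j %% MV in Hal *.
have -> : al %/ M ^ x = if x == 0 then al else al %/ M ^ x.-1 %/ M.
  by case: (x) => [|k]; rewrite ?expn0 ?divn1 // expnSr divnMA.
apply: ev_ite0 => // Hx0; apply: (ev_div H19 H16) => //; last first.
  by rewrite (leq_trans (leq_div _ _)) // (leq_trans (leq_div _ _)) // ltnW.
apply: ev_rd (IH x.-1 al _ Hal _).
- by apply: ev_add => //; apply: ev_mul => //; rewrite /= subn1.
- by rewrite (leq_trans (leq_pred _)).
rewrite [X in _ < X](divn_eq j MV) -/x -/al -[in X in _ < X](prednK (n := x)) ?lt0n //.
by rewrite mulSnr; have := MV_gt0; lia.
Qed.

Hypothesis H20 : forall x al, x < F -> al < MV -> m 20 (x * MV + al) = al %/ M ^ x.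

Definition at_pos p (l : seq nat) :=
  p + size l <= F /\ forall i, i < size l -> nth 0 tk (p + i) = nth 0 l i.

Lemma at_cat p l1 l2 : at_pos p (l1 ++ l2) -> at_pos p l1 /\ at_pos (p + size l1) l2.
Proof.
move=> [H1 H2]; rewrite size_cat in H1 H2; split; split=> [|i Hi]; try lia.
  by rewrite H2 ?nth_cat ?Hi //; lia.
by rewrite -addnA H2 ?ltn_add2l // nth_cat ltnNge leq_addr /= addKn.
Qed.

Lemma at_cons p x l : at_pos p (x :: l) -> [/\ p < F, nth 0 tk p = x & at_pos (p + 1) l].
Proof.
move=> H; have [[Hp /(_ 0 isT) Hx] Hl] := at_cat (H : at_pos p ([:: x] ++ l)).
by rewrite addn0 in Hx; rewrite /= addn1 in Hp.
Qed.

Lemma size_code_var x : size (code_var x) = (size x.1).+2.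
Proof. by rewrite /= size_rcons. Qed.

(** The first position where the tokens of [x] can be read, even if they are not meant as a variable
    there. It depends on [x] alone, determines [x] and is below [F] for every variable that occurs,
    as a digit position has to be. *)
Definition var_id (x : var) : nat :=
  find (fun q => all (fun i => nth 0 tk (q + i) == nth 0 (code_var x) i)
                     (iota 0 (size (code_var x)))) (iota 0 F).

Lemma at_all p x : at_pos p (code_var x) ->
  all (fun i => nth 0 tk (p + i) == nth 0 (code_var x) i) (iota 0 (size (code_var x))).
Proof. by move=> [_ H]; apply/allP => i; rewrite mem_iota => Hi; rewrite H. Qed.

Lemma var_id_lt p x : at_pos p (code_var x) -> var_id x < F.
Proof.
move=> Hp; rewrite -[X in _ < X](size_iota 0 F) -has_find; apply/hasP; exists p.
  by rewrite mem_iota; case: Hp; rewrite size_code_var; lia.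
exact: at_all.
Qed.

Lemma code_var_inj : injective code_var.
Proof. by move=> [u i] [v j] [_ /rcons_inj [-> ->]]. Qed.

Lemma var_id_inj x y : var_id x < F -> var_id x = var_id y -> x = y.
Proof.
move=> Hx E; have Hy : var_id y < F by rewrite -E.
have key z : var_id z < F -> forall i, i < size (code_var z) ->
    nth 0 tk (var_id z + i) = nth 0 (code_var z) i.
  move=> Hz i Hi; have := Hz; rewrite -{1}[F](size_iota 0) -has_find => Hh.
  have := nth_find 0 Hh; rewrite nth_iota // add0n => /allP/(_ i).
  by rewrite mem_iota => /(_ Hi)/eqP.
have Kx := key _ Hx; have Ky := key _ Hy; rewrite -E in Ky.
have Es : size x.1 = size y.1 by have := Kx 0 isT; have := Ky 0 isT => /= -> ->.
apply: code_var_inj; apply: (@eq_from_nth _ 0); first by rewrite !size_code_var Es.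
move=> i Hi; rewrite -Kx // -Ky //; move: Hi; rewrite !size_code_var Es.
by [].
Qed.

Lemma ev_Tok env e p : eval m env e = p -> p < F + F -> eval m env (Tok e) = nth 0 tk p.
Proof. by move=> He Hp; apply: ev_rd (H10 Hp). Qed.

Lemma ev_VarEnd env e p x : eval m env e = p -> at_pos p (code_var x) ->
  eval m env (VarEnd e) = p + size (code_var x).
Proof.
move=> He /at_cons[Hp Hx _]; apply: ev_add => //.
have -> : size (code_var x) = size x.1 + 2 by rewrite size_code_var addn2.
by apply: ev_add => //; rewrite -Hx; apply: ev_Tok => //; lia.
Qed.

Lemma ev_VarEnd_Loc env p x : at_pos p (code_var x) ->
  eval m (p :: env) (VarEnd (Loc 0)) = p + size (code_var x).
Proof. exact: ev_VarEnd. Qed.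

Lemma ev_Plus env k c p : nth 0 env k = p -> eval m env (Plus k c) = p + c.
Proof. by move=> /= ->. Qed.

Lemma ev_Rev env e p : eval m env e = p -> eval m env (Rev e) = F.-1 - p.
Proof. by move=> /= ->; rewrite H9 subn1. Qed.

Lemma size_code (psi : formula N) : 0 < size (code_formula psi).
Proof. by case: psi. Qed.

Section Ends.

Variable p0 : nat.
Hypothesis H21 : forall p (psi : formula N), p0 < p ->
  at_pos p (code_formula psi) -> m 21 (F.-1 - p) = p + size (code_formula psi).

(** While array 21 is filled from the end of the formula, only the ends of subformulas starting
    after [p0] are available. *)
Lemma ev_End env e p (psi : formula N) : eval m env e = p -> p0 < p ->
  at_pos p (code_formula psi) ->
  eval m env (End e) = p + size (code_formula psi).
Proof. by move=> He Hp Hat; apply: ev_rd (H21 Hp Hat); apply: ev_Rev. Qed.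

End Ends.

Lemma ev_end j (psi : formula N) (p := F.-1 - j) : j < F ->
  (forall p' (psi : formula N), p < p' -> at_pos p' (code_formula psi) ->
     m 21 (F.-1 - p') = p' + size (code_formula psi)) ->
  at_pos p (code_formula psi) ->
  eval m [:: j] e_end = p + size (code_formula psi).
Proof.
move=> Hj IH Hat; apply: (ev_let (x := p)); first exact: ev_Rev.
have HpF : p < F by rewrite /p; lia.
have ET c : nth 0 tk p = c -> eval m [:: p; j] (Tok (Loc 0)) = 0 + c.
  by move=> <-; apply: ev_Tok => //; lia.
have PP c : eval m [:: p; j] (Plus 0 c) = p + c by [].
have Hp1 : p < p + 1 by lia.
case: psi Hat => [|l x|x y|c x y|q|q r|q r|x q] Hat;
  have [_ Hc Ha1] := at_cons Hat; apply: (ev_switch (ET _ Hc)) => //.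
- have [_ _ Ha2] := at_cons Ha1; rewrite -addnA in Ha2.
  by apply: etrans (ev_VarEnd (PP 2) Ha2) _; rewrite /=; lia.
- have [Ha2 Ha3] := at_cat Ha1; apply: (ev_let (ev_VarEnd (PP 1) Ha2)).
  by apply: etrans (ev_VarEnd_Loc _ Ha3) _; rewrite /= size_cat /=; lia.
- have [_ _ Ha2] := at_cons Ha1; rewrite -addnA in Ha2.
  have [Ha3 Ha4] := at_cat Ha2; apply: (ev_let (ev_VarEnd (PP 2) Ha3)).
  by apply: etrans (ev_VarEnd_Loc _ Ha4) _; rewrite /= size_cat /=; lia.
- by apply: etrans (ev_End IH (PP 1) Hp1 Ha1) _; rewrite /=; lia.
- have [Ha2 Ha3] := at_cat Ha1; have E1 := ev_End IH (PP 1) Hp1 Ha2.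
  by apply: etrans (ev_End IH E1 _ Ha3) _; rewrite /= ?size_cat; lia.
- have [Ha2 Ha3] := at_cat Ha1; have E1 := ev_End IH (PP 1) Hp1 Ha2.
  by apply: etrans (ev_End IH E1 _ Ha3) _; rewrite /= ?size_cat; lia.
- have [Ha2 Ha3] := at_cat Ha1; have E1 := ev_VarEnd (PP 1) Ha2.
  by apply: etrans (ev_End IH E1 _ Ha3) _; rewrite /= ?size_cat /=; lia.
Qed.

Lemma ev_id p x : at_pos p (code_var x) -> eval m [:: p] e_id = var_id x.
Proof.
move=> Hat; have [HpF Htp _] := at_cons Hat.
have [Hp2 Hn] := Hat; rewrite size_code_var in Hp2.
pose same q := all (fun i => nth 0 tk (q + i) == nth 0 (code_var x) i)
                   (iota 0 (size (code_var x))).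
(* The number of positions up to which no match has occurred is the position of the first match. *)
apply: etrans (_ : count (fun q => ~~ has (fun q' => (q' <= q) && same q')
  (iota 0 F)) (iota 0 F) = _).
  apply: ev_sum_bool => // q Hq; apply: ev_not; apply: ev_ex => // q' Hq'.
  apply: ev_and => [|_]; first exact: ev_le.
  have -> : same q' = all (fun i => (i < size x.1 + 2) ==>
      (nth 0 tk (q' + i) == nth 0 tk (p + i))) (iota 0 F).
    apply/allP/allP => [H i _|H i].
      apply/implyP; rewrite addn2 -size_code_var => Hi; rewrite Hn //; apply: H.
      by rewrite mem_iota.
    rewrite mem_iota => /andP[_ Hi]; rewrite -Hn //; rewrite add0n size_code_var in Hi.
    have HiF : i \in iota 0 F by rewrite mem_iota; lia.
    by have := H i HiF; rewrite addn2 Hi.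
  apply: ev_all => // i Hi; apply: ev_imp => [|_].
    by apply: ev_lt => //; apply: ev_add => //; rewrite -[RHS]Htp; apply: ev_Tok => //; lia.
  by apply: ev_eq; apply: ev_Tok; rewrite //; lia.
have HF := ltnW (var_id_lt Hat); rewrite -[RHS](count_lt_iota HF).
apply: eq_in_count => q; rewrite mem_iota => /andP[_ Hq]; rewrite add0n in Hq.
have Hh : has same (iota 0 F) by rewrite has_find size_iota; exact: (var_id_lt Hat).
have Hs : same (var_id x).
  by have := nth_find 0 Hh; rewrite nth_iota ?add0n //; exact: (var_id_lt Hat).
apply/hasPn/idP => [H|H q'].
  rewrite ltnNge; apply/negP => Hle; have := H (var_id x).
  by rewrite mem_iota Hle Hs (var_id_lt Hat) => /(_ isT).
rewrite mem_iota => /andP[_ Hq']; apply/negP => /andP[Hqq Hsq].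
have Hb := @before_find _ 0 same (iota 0 F) q'.
by rewrite nth_iota // add0n Hsq in Hb; have := Hb (leq_ltn_trans Hqq H).
Qed.

Hypothesis H21 : forall p (psi : formula N),
  at_pos p (code_formula psi) -> m 21 (F.-1 - p) = p + size (code_formula psi).
Hypothesis H22 : forall p x, at_pos p (code_var x) -> m 22 p = var_id x.

Definition value al (x : var) : nat := marked (digit M (var_id x) al).

Lemma value_lt al x : value al x < n.
Proof. by apply: marked_lt; apply: digit_lt. Qed.

Lemma ev_Digit env ex ea x al : eval m env ex = x -> eval m env ea = al ->
  x < F -> al < MV -> eval m env (Digit ex ea) = digit M x al.
Proof.
move=> Hx Ha HxF HaM; apply: (ev_mod H19 H16) => //.
  by apply: ev_rd (H20 HxF HaM); apply: ev_add => //; apply: ev_mul.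
by rewrite (leq_trans (leq_div _ _)) // (leq_trans (leq_div _ _)) // ltnW.
Qed.

Lemma ev_Value env ep ea p al x : eval m env ep = p -> eval m env ea = al ->
  at_pos p (code_var x) -> al < MV -> eval m env (Value ep ea) = value al x.
Proof.
move=> Hp Ha Hat HaM; apply: ev_rd (H17 (digit_lt M_gt0 _ _)).
by apply: ev_Digit => //; [apply: ev_rd (H22 Hat)|exact: var_id_lt Hat].
Qed.

Lemma ev_MulM env e1 e2 x y : eval m env e1 = x -> eval m env e2 = y -> x <= M ->
  eval m env (MulM e1 e2) = x * y.
Proof.
move=> H1 H2 Hx; apply: etrans (_ : \sum_(i < M) (if i < x then y else 0) = _).
  apply: (ev_sum (f := fun i => if i < x then y else 0)) => // i Hi.
  apply: ev_ite => [|_|_ //]; last exact: ev_lift.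
  by apply: ev_lt => //; apply: ev_lift.
rewrite -big_mkcond /= sum_nat_const; congr (_ * _).
rewrite -[RHS](count_lt_iota Hx) -sum1_card -(big_mkord (fun i => i < x) (fun=> 1)).
by rewrite sum1_count /index_iota subn0.
Qed.

Lemma ev_Update env ex ea ed x al d : eval m env ex = x -> eval m env ea = al ->
  eval m env ed = d -> x < F -> al < MV -> d < M ->
  eval m env (Update ex ea ed) = update M x al d.
Proof.
move=> Hx Ha Hd HxF HaM HdM.
have Hp : eval m env (Rd 18 ex) = M ^ x by apply: ev_rd (H18 (ltnW HxF)).
apply: ev_sub; last by apply: ev_MulM => //; [exact: ev_Digit|rewrite ltnW ?digit_lt].
by apply: ev_add => //; apply: ev_MulM => //; apply: ltnW.
Qed.

Lemma value_update al x d y : var_id x < F -> d < M ->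
  value (update M (var_id x) al d) y = if y == x then marked d else value al y.
Proof.
move=> Hx Hd; rewrite /value digit_update //; case: (eqVneq y x) => [->|Hne].
  by rewrite eqxx.
by case: eqP => // E; case/eqP: Hne; apply: esym; apply: var_id_inj.
Qed.

Definition dom (x : var) c := mk (level x) c.

Notation nsat := (nsat n adjn coln).

Lemma nsat_ext D (phi : formula N) : forall v v', v =1 v' ->
  nsat D v phi = nsat D v' phi.
Proof.
elim: phi => [|l x|x y|c x y|q IH|q IHq r IHr|q IHq r IHr|x q IH] v v' E //=;
  rewrite ?E //; try by rewrite (IH _ _ E).
- by rewrite (IHq _ _ E) (IHr _ _ E).
- by rewrite (IHq _ _ E) (IHr _ _ E).
- by apply: eq_has => c; congr (_ && _); apply: IH => y; rewrite E.
Qed.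

(** Marks increase with the level, so a vertex allowed at level [t] is among the [M] vertices of
    level [F]. Hence an assignment may store indices below [M] instead of vertices. *)
Lemma has_marked t (P : pred nat) : t <= F ->
  has (fun c => mk t c && P c) (iota 0 n) =
  has (fun d => mk t (marked d) && P (marked d)) (iota 0 M).
Proof.
move=> Ht; apply/hasP/hasP => -[c]; rewrite mem_iota => /andP[_ Hc] /andP[Hm HP].
  have HmF := mk_le Hc Ht Hm.
  exists (count (mk F) (iota 0 c)); last by rewrite /marked select_count // Hm.
  by rewrite mem_iota /= add0n ME; apply: count_lt.
exists (marked c); last by rewrite Hm.
by rewrite mem_iota /= add0n; apply: marked_lt.
Qed.

Section Vals.

Variable p0 : nat.
Hypothesis H23 : forall p (psi : formula N) al, p0 < p ->
  at_pos p (code_formula psi) -> al < MV ->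
  m 23 ((F.-1 - p) * MV + al) = nsat dom (value al) psi.

Lemma ev_Val env ep ea p al (psi : formula N) : eval m env ep = p ->
  eval m env ea = al -> p0 < p -> at_pos p (code_formula psi) -> al < MV ->
  eval m env (Val ep ea) = nsat dom (value al) psi.
Proof.
move=> Hp Ha Hp0 Hat HaM; apply: ev_rd (H23 Hp0 Hat HaM).
by apply: ev_add => //; apply: ev_mul => //; apply: ev_Rev.
Qed.

End Vals.

Lemma ev_val j (psi : formula N) (p := F.-1 - j %/ MV) (al := j %% MV) : j < F * MV ->
  (forall p' (psi : formula N) al, p < p' -> at_pos p' (code_formula psi) -> al < MV ->
     m 23 ((F.-1 - p') * MV + al) = nsat dom (value al) psi) ->
  at_pos p (code_formula psi) ->
  eval m [:: j] e_val = nsat dom (value al) psi.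
Proof.
move=> Hj IH Hat; have Hj' := divn_lt MV_gt0 Hj.
apply: (ev_split H9 H19) => //; [exact: MV_gt0|exact: ltnW|].
apply: (ev_let (x := p)); first exact: ev_Rev.
rewrite -/al; set env := [:: p, al & _].
have HpF : p < F by move: Hj'; rewrite /p; generalize (j %/ MV); lia.
have Hal : al < MV by rewrite ltn_mod MV_gt0.
rewrite {}/env; move: (j %/ MV) => j' in Hj' *; clearbody p al; set env := [:: p, al & _].
have ET c : nth 0 tk p = c -> eval m env (Tok (Loc 0)) = 0 + c.
  by move=> <-; apply: ev_Tok => //; lia.
have HE := @ev_End p (fun p psi _ => @H21 p psi).
have PP c : eval m env (Plus 0 c) = p + c by [].
have EA : eval m env (Loc 1) = al by [].
have Hp1 : p < p + 1 by lia.
case: psi Hat => [|l x|x y|c x y|q|q r|q r|x q] Hat;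
  have [_ Hc Ha1] := at_cons Hat; apply: (ev_switch (ET _ Hc)) => //.
- have [Hp2 Hl Ha2] := at_cons Ha1; rewrite -addnA in Ha2.
  apply: evCol; [exact: ev_Value (ev_Plus _ _) _ Ha2 _| |exact: value_lt|exact: ltn_ord].
  by rewrite -Hl; apply: ev_Tok; [exact: ev_Plus|lia].
- have [Ha2 Ha3] := at_cat Ha1.
  apply: evAdj; try exact: value_lt.
    exact: ev_Value (ev_Plus _ _) _ Ha2 _.
  by apply: ev_Value Ha3 _ => //; apply: ev_VarEnd Ha2; exact: ev_Plus.
- have [Hp2 Htc Ha2] := at_cons Ha1; rewrite -addnA in Ha2.
  have [Ha3 Ha4] := at_cat Ha2.
  apply: (ev_let (x := value al x)); first exact: ev_Value (ev_Plus _ _) _ Ha3 _.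
  apply: (ev_let (x := value al y)).
    by apply: ev_Value Ha4 _ => //; apply: ev_VarEnd Ha3; exact: ev_Plus.
  apply: (@ev_switch _ _ _ _ 0 (code_cmp c)); last 1 first.
  + by case: (c); [apply: (ev_eq (e1 := Loc 1) (e2 := Loc 0))|
      apply: (ev_lt (e1 := Loc 1) (e2 := Loc 0))|
      apply: (ev_lt (e1 := Loc 0) (e2 := Loc 1))].
  + by rewrite add0n -Htc; apply: ev_Tok; [exact: ev_Plus|lia].
  + by case: (c).
- exact: ev_not (ev_Val IH (PP 1) EA Hp1 Ha1 Hal).
- have [Ha2 Ha3] := at_cat Ha1; apply: ev_and (ev_Val IH (PP 1) EA Hp1 Ha2 Hal) _ => _.
  by apply: (ev_Val IH (HE _ _ _ _ (PP 1) Hp1 Ha2) EA _ Ha3 Hal); lia.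
- have [Ha2 Ha3] := at_cat Ha1.
  have -> : (nsat dom (value al) (FOr q r) : nat) =
    if nsat dom (value al) q then 1 else nsat dom (value al) r.
    by rewrite /=; case: (nsat _ _ q).
  apply: ev_ite (ev_Val IH (PP 1) EA Hp1 Ha2 Hal) _ _ => // _.
  by apply: (ev_Val IH (HE _ _ _ _ (PP 1) Hp1 Ha2) EA _ Ha3 Hal); lia.
- have [Ha2 Ha3] := at_cat Ha1; have [Hb1 Hb2] := Ha2.
  have [Hc1 _] := Ha3; have Hq := size_code q.
  apply: (ev_let (x := p + 1 + size (code_var x))).
    by apply: ev_VarEnd Ha2; exact: ev_Plus.
  rewrite size_code_var in Hb1 Hb2 Hc1 Ha3 *.
  (* The code of [x] alone takes [size x.1 + 2] of the at most [F] tokens. *)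
  have Hlev : level x <= F by rewrite /level; case: (x.2 != 0); lia.
  have EX : nsat dom (value al) (FEx x q) = has (fun d => mk (level x) (marked d) &&
      nsat dom (fun y => if y == x then marked d else value al y) q) (iota 0 M).
    exact: (has_marked (fun a => nsat dom (fun y => if y == x then a else value al y) q) Hlev).
  rewrite EX; apply: ev_ex => // d Hd.
  apply: ev_and => [|_].
    apply: ev_mk => //; last exact: marked_lt.
      apply: ev_add; first apply: ev_add => //.
        have E0 : nth 0 tk (p + 1) = size x.1 by have := Hb2 0 isT; rewrite addn0.
        by rewrite -E0; apply: ev_Tok; [exact: ev_Plus|lia].
      have -> : (x.2 != 0 : nat) = if x.2 == 0 then 0 else 1 by case: eqP.
      apply: ev_ite0 => //.
      have E1 : nth 0 tk (p + 1 + (size x.1).+1) = x.2.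
        by rewrite Hb2 //= nth_rcons ltnn eqxx.
      by rewrite -E1; apply: ev_Tok; [rewrite /=; lia|lia].
    exact: ev_rd (H17 Hd).
  have Hid := var_id_lt Ha2.
  have -> : nsat dom (fun y => if y == x then marked d else value al y) q =
      nsat dom (value (update M (var_id x) al d)) q.
    by apply: nsat_ext => y; rewrite value_update.
  apply: (ev_Val IH) Ha3 _ => //; last exact: update_lt; last by lia.
  apply: ev_Update => //; apply: ev_rd (H22 Ha2); exact: ev_Plus.
Qed.

Lemma ev_out (psi : formula N) :
  (forall p (psi : formula N) al, at_pos p (code_formula psi) -> al < MV ->
     m 23 ((F.-1 - p) * MV + al) = nsat dom (value al) psi) ->
  at_pos 0 (code_formula psi) ->
  eval m [:: 0] (Val (Cst 0) (Cst 0)) = nsat dom (value 0) psi.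
Proof.
move=> H23 Hat; apply: ev_rd (H23 _ _ _ Hat MV_gt0).
by apply: ev_add => //; apply: ev_mul => //; apply: ev_Rev.
Qed.

End Formula.

(** * Correctness of the program *)

Lemma nth_pairs (S T R : Type) (f : S -> T -> R) s t x0 y0 z0 i j :
  i < size s -> j < size t ->
  nth z0 [seq f x y | x <- s, y <- t] (i * size t + j) = f (nth x0 s i) (nth y0 t j).
Proof.
elim: s i => // x s IH [|i] Hi Hj /=; rewrite nth_cat size_map.
  by rewrite Hj (nth_map y0).
rewrite ltnNge mulSn -addnA leq_addr /= addKn; exact: IH.
Qed.

Lemma index2 a b i j : i < a -> j < b ->
  [/\ i * b + j < a * b, (i * b + j) %/ b = i & (i * b + j) %% b = j].
Proof.
move=> Hi Hj; have Hb : 0 < b by apply: leq_ltn_trans Hj.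
split; last 1 first.
- by rewrite modnMDl modn_small.
- apply: (@leq_trans (i * b + b)); first by rewrite ltn_add2l.
  by rewrite -mulSnr leq_mul2r Hi orbT.
- by rewrite divnMDl // divn_small // addn0.
Qed.

Section Correctness.

Variables (N D n F : nat) (w : seq bool) (adjn coln : nat -> nat -> bool)
  (phi : formula N).

Let bit i := nth false w i.
Let start := n.+1 + n * n + n * N.
Let tk := code_formula phi.

Hypothesis D_gt0 : 0 < D.
Hypothesis n_gt0 : 0 < n.
Hypothesis w_ones : forall i, i < n -> bit i.
Hypothesis w_zero : bit n = false.
Hypothesis w_size : size w = start + F.
Hypothesis w_adj : forall x y, x < n -> y < n -> bit (n.+1 + x * n + y) = adjn x y.
Hypothesis w_col : forall x l, x < n -> l < N -> bit (n.+1 + n * n + x * N + l) = coln x l.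
Hypothesis F_def : F = fsize phi.
Hypothesis w_phi : forall i, i < F -> bit (start + i) = nth false (enc_formula phi) i.

Let nb := nbf n adjn.
Let mk := mark N n D F adjn coln nb.
Let M := count (mk F) (iota 0 n).
Let MV := M ^ F.

Definition bounds : seq nat :=
  [:: (size w).+1; 1; 1; size w; 1; 1; 1; 1; 1; 1; F + F; n * D; 1; n * W D F;
      F.+1 * (n * n); F.+1 * n; 1; M; F.+1; 1; F.+1 * MV; F; F; F * MV; 1].

Definition bound_of a := nth 0 bounds a.

(** Arrays 21 to 23 are specified only at positions where the code of a formula or variable can be
    read; their other entries are arbitrary. *)
Definition contents (a i v : nat) : Prop :=
  match a with
  | 0 => 5 <= i -> v = bit i.-1
  | 1 => v = size w
  | 2 => v = pack w
  | 3 => v = bit i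
  | 4 => v = D
  | 5 => v = N
  | 6 => v = n
  | 7 => v = n * n
  | 8 => v = start
  | 9 => v = F
  | 10 => v = nth 0 tk i
  | 11 => v = nb (i %/ D) (i %% D)
  | 12 => v = W D F
  | 13 => v = walk D nb (i %/ W D F) (i %% W D F)
  | 14 => v = (tau N n D F adjn coln nb (i %/ (n * n)) (i %% (n * n) %/ n) ==
               tau N n D F adjn coln nb (i %/ (n * n)) (i %% (n * n) %% n))
  | 15 => v = mk (i %/ n) (i %% n)
  | 16 => v = M
  | 17 => v = marked n F mk i
  | 18 => v = M ^ i
  | 19 => v = MV
  | 20 => v = i %% MV %/ M ^ (i %/ MV)
  | 21 => forall psi : formula N, at_pos F tk (F.-1 - i) (code_formula psi) ->
      v = F.-1 - i + size (code_formula psi)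
  | 22 => forall x, at_pos F tk i (code_var x) -> v = var_id F tk x
  | 23 => forall psi : formula N, at_pos F tk (F.-1 - i %/ MV) (code_formula psi) ->
      v = nsat n adjn coln (dom mk) (value n F M mk tk (i %% MV)) psi
  | 24 => v = nsat n adjn coln (dom mk) (value n F M mk tk 0) phi
  | _ => True
  end.

Lemma tkF : size tk <= F.
Proof. by rewrite F_def size_unary. Qed.

Lemma mk_le c t t' : c < n -> t <= t' -> mk t c -> mk t' c.
Proof. exact: mark_le. Qed.

Lemma M_gt0 : 0 < M.
Proof.
rewrite -has_count; apply/hasP; exists 0; first by rewrite mem_iota.
exact: (@mk_le 0 0 F).
Qed.

Lemma MVp_gt0 : 0 < MV. Proof. by rewrite expn_gt0 M_gt0. Qed.

Lemma tokfE p : tokf w N n F p = nth 0 tk p.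
Proof.
rewrite -token_unary /tokf -/start.
have -> : size (unary tk) = F by rewrite F_def.
apply: eq_in_count => i; rewrite mem_iota => /andP[_ Hi]; rewrite add0n in Hi.
rewrite -/(bit _) w_phi //; congr (_ && (_ == _)); apply: eq_in_count => j.
by rewrite mem_iota => /andP[_ Hj]; rewrite -/(bit _) w_phi.
Qed.

Section Facts.

Variables (k : nat) (m : mem).
Hypothesis Hm : inv bound_of contents k m.

Lemma fact0 : 0 < k -> forall i, 4 <= i -> i < size w -> m 0 i.+1 = bit i.
Proof. by move=> Hk i Hi Hi'; apply: (Hm Hk (i := i.+1)). Qed.
Lemma fact1 : 1 < k -> m 1 0 = size w. Proof. by move=> Hk; apply: (Hm Hk (i := 0)). Qed.
Lemma fact2 : 2 < k -> m 2 0 = pack w. Proof. by move=> Hk; apply: (Hm Hk (i := 0)). Qed.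
Lemma fact3 : 3 < k -> forall i, i < size w -> m 3 i = bit i.
Proof. by move=> Hk i Hi; apply: (Hm Hk (i := i)). Qed.
Lemma fact4 : 4 < k -> m 4 0 = D. Proof. by move=> Hk; apply: (Hm Hk (i := 0)). Qed.
Lemma fact5 : 5 < k -> m 5 0 = N. Proof. by move=> Hk; apply: (Hm Hk (i := 0)). Qed.
Lemma fact6 : 6 < k -> m 6 0 = n. Proof. by move=> Hk; apply: (Hm Hk (i := 0)). Qed.
Lemma fact7 : 7 < k -> m 7 0 = n * n. Proof. by move=> Hk; apply: (Hm Hk (i := 0)). Qed.
Lemma fact8 : 8 < k -> m 8 0 = start. Proof. by move=> Hk; apply: (Hm Hk (i := 0)). Qed.
Lemma fact9 : 9 < k -> m 9 0 = F. Proof. by move=> Hk; apply: (Hm Hk (i := 0)). Qed.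
Lemma fact10 : 10 < k -> forall p, p < F + F -> m 10 p = nth 0 tk p.
Proof. by move=> Hk i Hi; apply: (Hm Hk (i := i)). Qed.
Lemma fact11 : 11 < k -> forall x i, x < n -> i < D -> m 11 (x * D + i) = nb x i.
Proof.
move=> Hk x i Hx Hi; have [H1 H2 H3] := index2 Hx Hi.
by have /= -> := Hm Hk H1; rewrite H2 H3.
Qed.
Lemma fact12 : 12 < k -> m 12 0 = W D F. Proof. by move=> Hk; apply: (Hm Hk (i := 0)). Qed.
Lemma fact13 : 13 < k -> forall b u, b < n -> u < W D F ->
  m 13 (b * W D F + u) = walk D nb b u.
Proof.
move=> Hk x i Hx Hi; have [H1 H2 H3] := index2 Hx Hi.
by have /= -> := Hm Hk H1; rewrite H2 H3.
Qed.
Lemma fact14 : 14 < k -> forall t b c, t <= F -> b < n -> c < n ->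
  m 14 (t * (n * n) + b * n + c) = (tau N n D F adjn coln nb t b == tau N n D F adjn coln nb t c).
Proof.
move=> Hk t b c Ht Hb Hc; have [H1 H2 H3] := index2 Hb Hc.
have [H4 H5 H6] := index2 (Ht : t < F.+1) H1.
rewrite -addnA; have /= -> := Hm Hk H4.
by rewrite H5 H6 H2 H3.
Qed.
Lemma fact15 : 15 < k -> forall t c, t <= F -> c < n -> m 15 (t * n + c) = mk t c.
Proof.
move=> Hk x i Hx Hi; have [H1 H2 H3] := index2 (Hx : x < F.+1) Hi.
by have /= -> := Hm Hk H1; rewrite H2 H3.
Qed.
Lemma fact16 : 16 < k -> m 16 0 = M. Proof. by move=> Hk; apply: (Hm Hk (i := 0)). Qed.
Lemma fact17 : 17 < k -> forall i, i < M -> m 17 i = marked n F mk i.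
Proof. by move=> Hk i Hi; apply: (Hm Hk (i := i)). Qed.
Lemma fact18 : 18 < k -> forall i, i <= F -> m 18 i = M ^ i.
Proof. by move=> Hk i Hi; apply: (Hm Hk (i := i)). Qed.
Lemma fact19 : 19 < k -> m 19 0 = MV. Proof. by move=> Hk; apply: (Hm Hk (i := 0)). Qed.
Lemma fact20 : 20 < k -> forall x al, x < F -> al < MV -> m 20 (x * MV + al) = al %/ M ^ x.
Proof.
move=> Hk x i Hx Hi; have [H1 H2 H3] := index2 (ltnW Hx : x < F.+1) Hi.
by have /= -> := Hm Hk H1; rewrite H2 H3.
Qed.

Lemma rev_pos p (psi : formula N) : at_pos F tk p (code_formula psi) ->
  F.-1 - p < F /\ F.-1 - (F.-1 - p) = p.
Proof. by case=> Hp _; have := size_code psi; lia. Qed.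

Lemma fact21 : 21 < k -> forall p (psi : formula N), at_pos F tk p (code_formula psi) ->
  m 21 (F.-1 - p) = p + size (code_formula psi).
Proof.
move=> Hk p psi Hp; have [H1 H2] := rev_pos Hp.
by have := Hm Hk H1; rewrite /= H2; apply.
Qed.
Lemma fact22 : 22 < k -> forall p x, at_pos F tk p (code_var x) -> m 22 p = var_id F tk x.
Proof.
move=> Hk p x Hp; have Hp' : p < F by case: Hp; rewrite size_code_var; lia.
by have := Hm Hk Hp'; apply.
Qed.
Lemma fact23 : 23 < k -> forall p (psi : formula N) al, at_pos F tk p (code_formula psi) ->
  al < MV -> m 23 ((F.-1 - p) * MV + al) =
  nsat n adjn coln (dom mk) (value n F M mk tk al) psi.
Proof.
move=> Hk p psi al Hp Hal; have [H1 H2] := rev_pos Hp.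
have [H3 H4 H5] := index2 H1 Hal.
by have := Hm Hk H3; rewrite /= H4 H5 H2; apply.
Qed.

End Facts.

Ltac facts Hm :=
  try have G0 := fact0 Hm isT; try have G1 := fact1 Hm isT; try have G2 := fact2 Hm isT;
  try have G3 := fact3 Hm isT; try have G4 := fact4 Hm isT; try have G5 := fact5 Hm isT;
  try have G6 := fact6 Hm isT; try have G7 := fact7 Hm isT; try have G8 := fact8 Hm isT;
  try have G9 := fact9 Hm isT; try have G10 := fact10 Hm isT; try have G11 := fact11 Hm isT;
  try have G12 := fact12 Hm isT; try have G13 := fact13 Hm isT; try have G14 := fact14 Hm isT;
  try have G15 := fact15 Hm isT; try have G16 := fact16 Hm isT; try have G17 := fact17 Hm isT;
  try have G18 := fact18 Hm isT; try have G19 := fact19 Hm isT; try have G20 := fact20 Hm isT;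
  try have G21 := fact21 Hm isT; try have G22 := fact22 Hm isT; try have G23 := fact23 Hm isT.

Lemma checker_obligation j : j < 22 ->
  obligation bound_of contents (3 + j) (nth (Cst 0, Cst 0) (checker N D) j).
Proof.
have TF := tkF; have M0 := M_gt0; have ML := mk_le; have MV0 := MVp_gt0.
have ME : M = count (mk F) (iota 0 n) by [].
move=> Hj m Hm.
case: j Hj Hm => [|[|[|[|[|[|[|[|[|[|[|[|[|[|[|[|[|[|[|[|[|[|j]]]]]]]]]]]]]]]]]]]]]] Hj Hm;
  last (by []); clear Hj; facts Hm; rewrite [nth _ _ _]/=.
- by split=> [|j Hj IH]; [exact: G1|apply: (ev_bits (w := w) (N := N) (n := n) (D := D) (F := F))].
- by split=> // j Hj IH.
- by split=> // j Hj IH.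
- by split=> // -[|//] _ IH; apply: (ev_n (w := w) (N := N) (n := n) (D := D) (F := F)).
- by split=> // j Hj IH; apply: ev_sq.
- by split=> // j Hj IH; apply: ev_start.
- by split=> // j Hj IH; exact: (ev_F w_size G1 G8).
- split=> [|p Hp IH]; first by rewrite /= G9.
  exact: etrans (ev_tok w_size G3 G8 G9 p) (tokfE p).
- split=> [|j Hj IH]; first exact: (ev_mul G4 (G6 : eval m [::] (Gl 6) = n)).
  by apply: (ev_nb (w := w) (N := N) (n := n) (D := D) (F := F)).
- by split=> // j Hj IH; apply: (ev_W (w := w) (N := N) (n := n) (D := D) (F := F)).
- split=> [|j Hj IH]; first exact: (ev_mul G12 (G6 : eval m [::] (Gl 6) = n)).
  apply: (ev_walk (w := w) (N := N) (n := n) (D := D) (F := F)) => // b u Hb Hu Hlt.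
  have [_ H2 H3] := index2 Hb Hu.
  by have /= -> := IH _ Hlt; rewrite H2 H3.
- split=> [|j Hj IH].
    exact: etrans (ev_add (ev_mul G7 (G9 : eval m [::] (Gl 9) = F)) (G7 : eval m [::] (Gl 7) = n * n)) (esym (mulSnr _ _)).
  apply: (ev_type (w := w) (N := N) (n := n) (D := D) (F := F)) => // t b c Ht Hb Hc Hlt.
  have [H1 H2 H3] := index2 Hb Hc.
  have [_ H5 H6] := index2 (Ht : t < F.+1) H1; rewrite -addnA in Hlt *.
  by have /= -> := IH _ Hlt; rewrite H5 H6 H2 H3.
- split=> [|j Hj IH].
    exact: etrans (ev_add (ev_mul G6 (G9 : eval m [::] (Gl 9) = F)) (G6 : eval m [::] (Gl 6) = n)) (esym (mulSnr _ _)).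
  apply: (ev_mark (w := w) (N := N) (n := n) (D := D) (F := F)) => // t c Ht Hc Hlt.
  have [_ H2 H3] := index2 (Ht : t < F.+1) Hc.
  by have /= -> := IH _ Hlt; rewrite H2 H3.
- by split=> // j Hj IH; exact: (ev_M ME G6 G9 G15).
- by split=> [|j Hj IH]; [exact: G16|exact: (ev_marked G6 G9 G15)].
- split=> [|j Hj IH]; first by rewrite /= G9 addn1.
  exact: (ev_pow n_gt0 M0 ME TF G6 G9 G16 Hj IH).
- by split=> // j Hj IH; exact: (ev_MV G9 G18).
- split=> [|j Hj IH].
    exact: etrans (ev_add (ev_mul G19 (G9 : eval m [::] (Gl 9) = F)) (G19 : eval m [::] (Gl 19) = MV)) (esym (mulSnr _ _)).
  apply: (ev_quot n_gt0 M0 ME TF G6 G9 G16 G19 Hj) => x al Hx Hal Hlt.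
  have [_ H2 H3] := index2 (Hx : x < F.+1) Hal.
  by have /= -> := IH _ Hlt; rewrite H2 H3.
- split=> [|j Hj IH psi Hpsi]; first exact: G9.
  apply: (ev_end n_gt0 M0 ME TF G6 G9 G10 G16 G19 Hj _ Hpsi) => p' psi' Hp' Hat.
  have [H1 H2] := rev_pos Hat; have Hlt : F.-1 - p' < j by move: Hj => /=; lia.
  by have := IH _ Hlt psi'; rewrite /= H2; apply.
- split=> [|j Hj IH x Hx]; first exact: G9.
  exact: (ev_id n_gt0 M0 ME TF G6 G9 G10 G16 G19 Hx).
- split=> [|j Hj IH psi Hpsi]; first exact: (ev_mul G19 (G9 : eval m [::] (Gl 9) = F)).
  have EA env x y vx vy : eval m env x = vx -> eval m env y = vy ->
    vx < n -> vy < n -> eval m env (Adj x y) = adjn vx vy by apply: (ev_Adj (w := w) (N := N) (n := n) (D := D) (F := F)).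
  have EC env x l vx vl : eval m env x = vx -> eval m env l = vl ->
    vx < n -> vl < N -> eval m env (Col x l) = coln vx vl by apply: (ev_Col (w := w) (N := N) (n := n) (D := D) (F := F)).
  apply: (ev_val n_gt0 M0 ME ML TF EA EC G6 G9 G10 G15 G16 G17 G18 G19 G20 G21 G22 Hj _ Hpsi).
  move=> p' psi' al Hp' Hat Hal; have [H1 H2] := rev_pos Hat.
  have [_ H3 H4] := index2 H1 Hal.
  (* A later position has a smaller reversed index, so its whole block of [MV] entries comes before
     [j], whatever the assignment [al]. *)
  have Hlt : (F.-1 - p') * MV + al < j.
    have Hp : F.-1 - p' < j %/ MV.
      have := divn_lt MV0 Hj; move: Hp'; rewrite -/MV; generalize (j %/ MV); lia.
    rewrite [X in _ < X](divn_eq j MV); apply: (@leq_trans (j %/ MV * MV)).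
      by apply: leq_trans (leq_mul Hp (leqnn MV)); rewrite mulSnr ltn_add2l.
    by rewrite leq_addr.
  by have := IH _ Hlt psi'; rewrite /= H3 H4 H2; apply.
- split=> // -[|//] _ IH; apply: (ev_out M0 G9 G19 G23).
  by split; [exact: TF|].
Qed.

Definition global_vars := [:: 1; 4; 5; 6; 7; 9; 12; 16; 19].

Lemma checker_bounded j : j < 22 -> let c := nth (Cst 0, Cst 0) (checker N D) j in
  bounded (globals global_vars (3 + j)) c.1 && bounded (globals global_vars (3 + j)) c.2.
Proof.
move=> Hj; have /allP/(_ j) : all (fun j => let c := nth (Cst 0, Cst 0) (checker N D) j in
  bounded (globals global_vars (3 + j)) c.1 && bounded (globals global_vars (3 + j)) c.2)
  (iota 0 22) by vm_compute.
by rewrite mem_iota; apply.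
Qed.

Lemma run_checker Z m : 0 < Z -> all (fun b => b <= Z)
    (bounds ++ [:: size w; D; N; n; n * n; F; W D F; M; MV]) -> initial w m ->
  run m 3 (checker N D) 24 0 = nsat n adjn coln (dom mk) (value n F M mk tk 0) phi /\
  run_cost 25 m 3 (checker N D) <= (\sum_(c <- checker N D) cmd_size 25 c) *
    Z ^ (\max_(c <- checker N D) cmd_depth c).
Proof.
rewrite all_cat => HZ /andP[HB HG] [I1 I2 I0].
have Hm : inv bound_of contents 3 m.
  case=> [|[|[|//]]] _ [|i] //= Hi; rewrite ?I1 ?I2 //.
  by rewrite ltnS => Hi4; apply: (I0 _ Hi4 Hi).
have [||||//||H1 H2] := @run_spec 25 Z global_vars bound_of contents (checker N D) 3 m.
- exact: checker_obligation.
- exact: checker_bounded.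
- move=> j Hj; apply: (all_nthP 0 HB); exact: (Hj : j.+3 < 25).
- move=> b; rewrite !inE; move: HG => /= /andP[K1 /andP[K2 /andP[K3 /andP[K4 /andP[K5 /andP[K6 /andP[K7 /andP[K8 /andP[K9 _]]]]]]]]].
  by do 8 (case/orP => [/eqP->|]; first by split=> // v ->); move=> /eqP ->; split=> // v ->.
- exact: Hm.
- split=> //; exact: (H1 24 isT 0 isT).
Qed.

End Correctness.

(** * The time bound *)

Definition markbound N D F := nreps N D F ^ F.
(** A crude common bound: [M] is at most [markbound] and [M ^ F] at most its [F]-th power; the other
    factors provide for walks, levels, neighbours and the length of the input. The factor [n * n] is
    added in [leq_bounds]. *)
Definition sizebound N D F :=
  (N + D + 4) * ((F + 2) * (W D F * (markbound N D F * markbound N D F ^ F))).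

Lemma nreps_gt0 N D F : 0 < nreps N D F.
Proof.
rewrite muln_gt0 expn_gt0 /=; suff H j : 0 < ntypes N D F j by exact: H.
rewrite /ntypes; elim: j => [|j IH] /=; first by rewrite muln_gt0 !expn_gt0.
by rewrite muln_gt0 IH expn_gt0.
Qed.

Lemma sizebound_gt0 N D F : 0 < sizebound N D F.
Proof. by rewrite !muln_gt0 !addn_gt0 !orbT !expn_gt0 nreps_gt0. Qed.

Lemma leq_bounds N D F n size_w M (Z := sizebound N D F * (n * n)) :
  0 < n -> 0 < M -> M <= markbound N D F -> size_w = n.+1 + n * n + n * N + F ->
  all (fun b => b <= Z) ([:: size_w.+1; 1; 1; size_w; 1; 1; 1; 1; 1; 1; F + F; n * D; 1;
      n * W D F; F.+1 * (n * n); F.+1 * n; 1; M; F.+1; 1; F.+1 * M ^ F; F; F; F * M ^ F; 1] ++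
    [:: size_w; D; N; n; n * n; F; W D F; M; M ^ F]).
Proof.
move=> Hn HM HMx ->; pose V := W D F; pose X := markbound N D F; pose Y := X ^ F.
have HV : 0 < V by apply: W_gt0.
have HX : 0 < X by rewrite expn_gt0 nreps_gt0.
have HY : 0 < Y by rewrite expn_gt0 HX.
have HMV : M ^ F <= Y by rewrite /Y; case: (F) => // k; rewrite leq_exp2r.
pose q := n * n; have Hq : n <= q by rewrite leq_pmulr.
have Hq0 : 0 < q by apply: leq_trans Hq.
have EZ : Z = (N + D + 4) * ((F + 2) * (V * (X * Y)) * q).
  exact: esym (mulnA _ _ _).
pose T := (F + 2) * (V * (X * Y)) * q.
have HVXY : 0 < V * (X * Y) by rewrite !muln_gt0 HV HX HY.
have T1 : (F + 2) * q <= T.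
  by rewrite /T leq_mul2r leq_pmulr ?orbT.
have T2 : V * q <= T.
  rewrite /T leq_mul2r; apply/orP; right; apply: (@leq_trans (V * (X * Y))).
    by rewrite leq_pmulr // muln_gt0 HX HY.
  by rewrite leq_pmull // addn2.
have T3 : X <= T.
  apply: (@leq_trans (V * (X * Y))).
    by rewrite mulnCA leq_pmulr // muln_gt0 HV HY.
  by rewrite /T mulnAC leq_pmull // muln_gt0 addn2 Hq0.
have T4 : (F + 2) * Y <= T.
  apply: (@leq_trans ((F + 2) * (V * (X * Y)))); last by rewrite /T leq_pmulr.
  by rewrite leq_mul2l mulnA leq_pmull ?orbT // muln_gt0 HV HX.
have TZ : 4 * T + (N + D) * T <= Z by rewrite EZ -mulnDl addnC.
have NT : N * q <= N * T by rewrite leq_mul2l (leq_trans _ T1) ?orbT // leq_pmull // addn2.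
have DT : D * q <= D * T by rewrite leq_mul2l (leq_trans _ T1) ?orbT // leq_pmull // addn2.
have EF : (F + 2) * q = F * q + q + q by rewrite mulnDl mul2n -addnn addnA.
have FQ : F <= F * q by rewrite leq_pmulr.
have DQ : n * D <= D * q by rewrite mulnC leq_mul2l Hq orbT.
have NQ : n * N <= N * q by rewrite mulnC leq_mul2l Hq orbT.
have D1 : D <= D * q by rewrite leq_pmulr.
have N1 : N <= N * q by rewrite leq_pmulr.
have VQ : n * V <= V * q by rewrite mulnC leq_mul2l Hq orbT.
have V1 : V <= V * q by rewrite leq_pmulr.
have FN : F.+1 * n <= F.+1 * q by rewrite leq_mul2l Hq orbT.
have EF1 : F.+1 * q = F * q + q by rewrite mulSnr.
have FY : F.+1 * M ^ F <= (F + 2) * Y by rewrite leq_mul //; lia.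
have FY2 : F * M ^ F <= (F + 2) * Y by rewrite leq_mul //; lia.
have FY3 : Y <= (F + 2) * Y by rewrite leq_pmull // addn2.
rewrite -/V -/q; have HMX : M <= X by [].
rewrite mulnDl in TZ.
have HT : T <= Z by lia.
have HT4 : 4 * T <= Z by lia.
have HTN : N * T + 4 * T <= Z by lia.
have HTD : D * T <= Z by lia.
move: HMV FY FY2; generalize (M ^ F) (F.+1 * M ^ F) (F * M ^ F) => a b c *.
do ! (apply/andP; split); rewrite /=; lia.
Qed.

(** * Computability of the parameter dependence *)

Definition MulE e1 e2 := Sum e1 (lift 0 1 e2).
Definition PowE e1 e2 := Rec e2 (Cst 1) (MulE (lift 0 2 e1) (Loc 1)).

Lemma eval_MulE m env e1 e2 : eval m env (MulE e1 e2) = eval m env e1 * eval m env e2.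
Proof.
rewrite [LHS]/= (@eq_iteri _ _ (fun i acc => acc + eval m env e2)) => [|i y].
  by rewrite iteri_sum sum_nat_const card_ord.
by rewrite (eval_lift m e2 [::] [:: i] env).
Qed.

Lemma eval_PowE m env e1 e2 : eval m env (PowE e1 e2) = eval m env e1 ^ eval m env e2.
Proof.
transitivity (iteri (eval m env e2) (fun _ y => eval m env e1 * y) 1).
  apply: (@eq_iteri _ (fun i y => eval m [:: i, y & env] (MulE (lift 0 2 e1) (Loc 1)))).
  by move=> i y; rewrite eval_MulE (eval_lift m e1 [::] [:: i; y] env).
by elim: (eval m env e2) => //= k ->; rewrite expnS.
Qed.

Definition e_walks D := PowE (Cst D.+1) (Gl 1).
Definition e_types N D := Rec (Gl 1)
  (MulE (PowE (Cst 4) (MulE (e_walks D) (e_walks D)))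
        (PowE (Cst 2) (MulE (e_walks D) (Cst N))))
  (MulE (Loc 1) (PowE (Cst 2) (MulE (PowE (Cst 4) (lift 0 2 (e_walks D))) (Loc 1)))).
Definition e_markbound N D :=
  PowE (MulE (PowE (Cst 4) (e_walks D)) (e_types N D)) (Gl 1).
Definition e_sizebound N D :=
  MulE (Cst (N + D + 4)) (MulE (Add (Gl 1) (Cst 2)) (MulE (e_walks D)
    (MulE (e_markbound N D) (PowE (e_markbound N D) (Gl 1))))).

Lemma eval_sizebound N D F m : m 1 0 = F ->
  eval m [:: 0] (e_sizebound N D) = sizebound N D F.
Proof.
move=> HF; have EF env : eval m env (Gl 1) = F by [].
have EW env : eval m env (e_walks D) = W D F by rewrite eval_PowE EF.
have ET : eval m [:: 0] (e_types N D) = ntypes N D F F.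
  rewrite /e_types; set base := MulE (PowE _ _) _; set body := MulE (Loc 1) _.
  transitivity (iteri F (fun i y => eval m [:: i; y; 0] body) (eval m [:: 0] base)).
    by rewrite -HF.
  rewrite /base !(EW, eval_MulE, eval_PowE); apply: eq_iteri => i y.
  rewrite /body eval_MulE eval_PowE eval_MulE eval_PowE.
  by rewrite (eval_lift m (e_walks D) [::] [:: i; y] [:: 0]) EW.
have EM : eval m [:: 0] (e_markbound N D) = markbound N D F.
  by rewrite eval_PowE eval_MulE eval_PowE EW ET EF.
by rewrite !(EM, EW, eval_MulE, eval_PowE) /= HF.
Qed.

(** The input is in unary, so its length, the global 1, is [F]. No time limit is imposed here, hence
    [MulE] and [PowE] may loop up to computed values. *)
Lemma computable_sizebound N D a e : computable (fun F => a * sizebound N D F ^ e).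
Proof.
pose cs := [:: (Cst 1, MulE (Cst a) (PowE (e_sizebound N D) (Cst e)))].
exists (compile cs) => F; have [|m [I1 I2 I3] Hout] := @compileP cs (nseq F true).
  by vm_compute.
have E : run m 3 cs (size cs).+2 0 = a * sizebound N D F ^ e.
  transitivity (eval m [:: 0] (MulE (Cst a) (PowE (e_sizebound N D) (Cst e)))); first by [].
  by rewrite eval_MulE eval_PowE (@eval_sizebound N D F) // I1 size_nseq.
by eexists; rewrite -E; exact: Hout.
Qed.


(** * Graphs as input words *)

Lemma nth_catr (T : Type) (d : T) s1 s2 i : nth d (s1 ++ s2) (size s1 + i) = nth d s2 i.
Proof. by rewrite nth_cat ltnNge leq_addr /= addKn. Qed.

Lemma nth_catl (T : Type) (d : T) s1 s2 i : i < size s1 -> nth d (s1 ++ s2) i = nth d s1 i.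
Proof. by rewrite nth_cat => ->. Qed.

Lemma size_pairs (S T R : Type) (f : S -> T -> R) s t :
  size [seq f x y | x <- s, y <- t] = size s * size t.
Proof. exact: size_allpairs. Qed.

Section Encoding.

Variables (N : nat) (A : cgraph N) (s : seq A) (phi : formula N) (x0 : A).
Hypothesis Hs : enumeration s.

Let n := size s.
Let w := enc_graph s ++ enc_formula phi.
Let F := fsize phi.

Lemma enum_uniqs : uniq s.
Proof. by rewrite (perm_uniq Hs) enum_uniq. Qed.

Lemma mem_s x : x \in s.
Proof. by rewrite (perm_mem Hs) mem_enum. Qed.

Lemma index_s_inj x y : index x s = index y s -> x = y.
Proof. by move=> E; rewrite -(nth_index x0 (mem_s x)) E nth_index ?mem_s. Qed.

Lemma size_s : n = #|A|.
Proof. by rewrite cardE; apply: perm_size. Qed.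

Definition adji x y := [&& x < n, y < n & adj (nth x0 s x) (nth x0 s y)].
(** Read off the word, and so defined for every number [l], whereas [col] expects an element of
    ['I_N]. *)
Definition coli x l := nth false w (n.+1 + n * n + x * N + l).

Let a1 := rcons (nseq n true) false.
Let a2 := [seq adj x y | x <- s, y <- s].
Let a3 := [seq col l x | x <- s, l <- enum 'I_N].

Lemma wE : w = a1 ++ (a2 ++ (a3 ++ enc_formula phi)).
Proof. by rewrite /w /enc_graph /unary /= cats0 -!catA. Qed.

Lemma size_a1 : size a1 = n.+1. Proof. by rewrite size_rcons size_nseq. Qed.
Lemma size_a2 : size a2 = n * n. Proof. exact: size_pairs. Qed.
Lemma size_a3 : size a3 = n * N. Proof. by rewrite size_pairs -cardE card_ord. Qed.

Lemma size_w : size w = n.+1 + n * n + n * N + F.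
Proof. by rewrite wE !size_cat size_a1 size_a2 size_a3 !addnA. Qed.

Lemma w_ones i : i < n -> nth false w i.
Proof.
move=> Hi; rewrite wE nth_catl ?size_a1 ?ltnS ?(ltnW Hi) //.
by rewrite nth_rcons size_nseq Hi nth_nseq Hi.
Qed.

Lemma w_zero : nth false w n = false.
Proof. by rewrite wE nth_catl ?size_a1 // nth_rcons size_nseq ltnn eqxx. Qed.

Lemma w_adj x y : x < n -> y < n -> nth false w (n.+1 + x * n + y) = adji x y.
Proof.
move=> Hx Hy; rewrite wE -size_a1 -addnA nth_catr nth_catl.
  by rewrite (nth_pairs _ x0 x0) // /adji Hx Hy.
by rewrite size_a2; case: (index2 Hx Hy).
Qed.

Lemma w_coli x (l : 'I_N) : x < n -> coli x l = col l (nth x0 s x).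
Proof.
move=> Hx; rewrite /coli wE -size_a1 -!addnA nth_catr -size_a2 nth_catr nth_catl.
  rewrite -[in X in x * X](card_ord N) cardE (nth_pairs _ x0 l) ?nth_ord_enum //.
  by rewrite -cardE card_ord.
by rewrite size_a3; case: (index2 Hx (ltn_ord l)).
Qed.

Lemma w_phi i : i < F ->
  nth false w (n.+1 + n * n + n * N + i) = nth false (enc_formula phi) i.
Proof.
by move=> _; rewrite wE -size_a1 -!addnA nth_catr -size_a2 nth_catr -size_a3 nth_catr.
Qed.

Lemma adji_sym x y : adji x y = adji y x.
Proof. by rewrite /adji adj_sym; case: (x < n); case: (y < n). Qed.

(** The index of [y] is the number of neighbours of [x] before it in the enumeration. *)
Lemma degree d x y : (forall a : A, #|adj a| <= d) -> x < n -> y < n -> adji x y ->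
  exists2 i, i < d.+1 & nbf n adji x i = y.
Proof.
move=> Hd Hx Hy Hxy; exists (count (adji x) (iota 0 y)); last first.
  by rewrite /nbf select_count ?Hy.
apply: leq_trans (count_lt Hy Hxy) _; apply: leqW; apply: leq_trans (Hd (nth x0 s x)).
have -> : count (adji x) (iota 0 n) = count (adj (nth x0 s x)) s.
  transitivity (count (adj (nth x0 s x)) [seq nth x0 s i | i <- iota 0 n]); last first.
    by rewrite -/(mkseq _ n) mkseq_nth.
  rewrite count_map; apply: eq_in_count => z.
  by rewrite mem_iota => /andP[_ Hz]; rewrite /adji Hx /= (Hz : z < n).
rewrite -size_filter cardE; apply: uniq_leq_size; first by rewrite filter_uniq ?enum_uniqs.
by move=> z; rewrite mem_filter mem_enum => /andP[].
Qed.

Definition ltA : rel A := fun x y => index x s < index y s.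

Lemma ltA_linear : linear_order ltA.
Proof.
split=> [x|y x z|x y Hxy]; rewrite /ltA ?ltnn //; first exact: ltn_trans.
rewrite -neq_ltn; apply: contraNneq Hxy => E.
by apply/eqP; apply: index_s_inj.
Qed.

Lemma sat_nsat (psi : formula N) : forall v : var -> A,
  sat ltA v psi = nsat n adji coli domT (fun x => index (v x) s) psi.
Proof.
have Hi x : index x s < n by rewrite index_mem mem_s.
have Hn x : nth x0 s (index x s) = x by rewrite nth_index ?mem_s.
elim: psi => [|l x|x y|c x y|p IH|p IHp q IHq|p IHp q IHq|x p IH] v //=.
- by rewrite w_coli // Hn.
- by rewrite /adji !Hi !Hn.
- case: c => //=; apply/eqP/eqP => [->//|E].
  exact: index_s_inj.
- by rewrite IH.
- by rewrite IHp IHq.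
- by rewrite IHp IHq.
- apply/existsP/hasP => -[a].
    rewrite IH => Ha; exists (index a s); first by rewrite mem_iota Hi.
    rewrite /=; move: Ha; rewrite (@nsat_ext _ _ _ _ _ _ _
      (fun y => if y == x then index a s else index (v y) s)) // => y.
    by case: eqP.
  rewrite mem_iota => /andP[_ Ha] /= H; exists (nth x0 s a); rewrite IH; move: H.
  rewrite (@nsat_ext _ _ _ _ _ _ _
      (fun y => index (if y == x then nth x0 s a else v y) s)) // => y.
  by case: eqP => // _; rewrite index_uniq ?enum_uniqs.
Qed.

End Encoding.

(** * Assembly of the fixed-parameter algorithm *)

Lemma qrank_size N (phi : formula N) : qrank phi <= size (code_formula phi).
Proof.
elim: phi => //= [p IH|p IHp q IHq|p IHp q IHq|x p IH]; rewrite ?size_cat /=.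
- exact: leqW.
- by rewrite geq_max; apply/andP; split; lia.
- by rewrite geq_max; apply/andP; split; lia.
- lia.
Qed.


Unset Implicit Arguments.

Theorem mainTheorem2 (N : nat) (C : cgraph N -> Prop) (hC : bounded_degree C) :
  exists (P : program) (f : nat -> nat) (c : nat),
    computable f /\
    forall (A : cgraph N) (s : seq A) (phi : formula N),
      C A -> enumeration s -> CFO_sentence phi -> order_invariant phi ->
      exists b : bool,
        outputs P (enc_graph s ++ enc_formula phi)
          (f (fsize phi) * #|A| ^ c) (nat_of_bool b) /\
        (b <-> inv_models A phi).
Proof.
(* The successor keeps [D] positive even if [d] is 0, as division by [D] demands. *)
have [d Hd] := hC; pose D := d.+1; pose cs := checker N D.
pose S := \sum_(c <- cs) cmd_size 25 c; pose e := (\max_(c <- cs) cmd_depth c).+1.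
(* With [Z] the size bound times the square of the number of vertices, the time is at most
   [(49 + S) * Z ^ e], whence the exponent [e + e]. Here 49 is [19 + 22] for the set-up plus 8 per
   input bit, and [e] was made positive so that [Z <= Z ^ e]. *)
exists (compile cs), (fun F => (49 + S) * sizebound N D F ^ e), (e + e).
split=> [|A s phi HA Hs [kk Hphi] Hinv]; first exact: computable_sizebound.
have [x0 _] : exists x : A, x \in A by apply/card_gt0P; apply: vert_gt0.
set n := size s; set F := fsize phi; set w := enc_graph s ++ _.
pose av := adji s x0; pose cv := coli s phi.
have Hn : 0 < n by rewrite /n (size_s Hs) vert_gt0.
have D0 : 0 < D by [].
have Wadj x y : x < n -> y < n -> nth false w (n.+1 + x * n + y) = av x y.
  exact: w_adj.
have Wcol x l : x < n -> l < N -> nth false w (n.+1 + n * n + x * N + l) = cv x l by [].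
have Wones i : i < n -> nth false w i by apply: w_ones.
have Wzero : nth false w n = false by apply: w_zero.
have Wsize : size w = n.+1 + n * n + n * N + F by apply: size_w.
have Wphi i : i < F -> nth false w (n.+1 + n * n + n * N + i) = nth false (enc_formula phi) i.
  exact: w_phi.
pose nb := nbf n av; pose mk := mark N n D F av cv nb; pose M := count (mk F) (iota 0 n).
pose val0 := value n F M mk (code_formula phi) 0.
exists (nsat n av cv (dom mk) val0 phi).
have nblt x i : x < n -> i < D -> nb x i < n by move=> Hx _; apply: nbf_lt.
have nbsurj x y : x < n -> y < n -> av x y -> exists2 i, i < D & nb x i = y.
  exact: (degree Hs (Hd A HA)).
have qF : qrank phi <= F.
  exact: leq_trans (qrank_size phi) (size_unary _).
have avsym : forall x y, av x y = av y x by exact: adji_sym.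
split; last first.
  have Hg v : good N n D F av cv nb F fset0 v by split=> x; rewrite in_fset0.
  have Hsim v v' : sim N n D F av cv nb F fset0 v v' by split=> [u|u|x|u a]; rewrite in_fset0.
  (* Over the empty set of variables any two assignments are similar, so the one coded by 0 stands
     for all. *)
  have E v : nsat n av cv (dom mk) val0 phi = sat (ltA s) v phi.
    rewrite (sat_nsat phi x0 Hs).
    rewrite [LHS](nsat_domL avsym D0 nblt nbsurj Hphi valid0 qF (leqnn F) (Hg _)).
    exact: (sim_nsat avsym D0 nblt nbsurj Hphi valid0 qF (leqnn F) (Hsim _ _)).
  have HL : linear_order (ltA s) by exact: (ltA_linear x0 Hs).
  split=> [Hb lt Hlt|H].
    by apply: (proj1 (Hinv A (ltA s) lt HL Hlt)) => v; rewrite -E.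
  by rewrite (E (fun=> x0)); apply: H.
have Harr : all (fun c => arrs_ok (3 + size cs) c.1 && arrs_ok (3 + size cs) c.2) cs.
  by vm_compute.
have [m Im Hout] := compileP w Harr.
pose Z := sizebound N D F * (n * n).
have HZ : 0 < Z by rewrite muln_gt0 sizebound_gt0 muln_gt0 Hn.
have M0 : 0 < M by exact: M_gt0.
have MX : M <= markbound N D F by apply: count_mark.
have HB := leq_bounds Hn M0 MX Wsize.
have [R1 R2] := run_checker D0 Hn Wones Wzero Wsize Wadj Wcol (erefl : F = fsize phi) Wphi HZ HB Im.
move: Hout; rewrite R1 => -[t Ht Hres]; exists t => //; apply: leq_trans Ht _.
have HwZ : size w <= Z by case/andP: HB => /ltnW.
have EZ : sizebound N D F ^ e * #|A| ^ (e + e) = Z ^ e.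
  by rewrite -(size_s Hs) /Z !expnMn -expnD.
rewrite -mulnA EZ mulnDl; have HZe : Z <= Z ^ e by rewrite -[X in X <= _]expn1 leq_pexp2l.
have HS : run_cost 25 m 3 (checker N D) <= S * Z ^ e.
  by apply: leq_trans R2 _; rewrite leq_mul2l leq_pexp2l ?orbT.
rewrite -[3 + size cs]/25 -[19 + size cs]/41.
apply: leq_add HS; apply: (@leq_trans (49 * Z)); last by rewrite leq_mul2l HZe orbT.
have -> : 49 * Z = 41 * Z + 8 * Z by rewrite -mulnDl.
by apply: leq_add; [rewrite -[X in X <= _]muln1 leq_mul2l HZ orbT|rewrite leq_mul2l HwZ orbT].
Qed.
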